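(* Let $\alpha>0$ be real, let $k\in(0,1)$ be the modulus determined by $K(k')/K(k)=\alpha$ with $k'=\sqrt{1-k^2}$, and write $K=K(k)$. Then $$\int_{0}^{\pi/2}\ln\left(\cosh \frac{x}{\alpha}-\cos \frac{\ln (2 \cos x)}{\alpha}\right)dx=-\frac{\pi^2\alpha}{12}-\frac{\pi}{6}\ln\frac{16\,k\,k'K^3\alpha^6}{\pi^3}\qquad\text{if } \alpha>\frac{\ln 2}{2\pi},$$ and $$\int_{0}^{\pi/2}\ln\left(\cosh \frac{x}{\alpha}+\cos \frac{\ln (2 \cos x)}{\alpha}\right)dx=\frac{\pi^2\alpha}{24}+\frac{\pi}{6}\ln\frac{4\sqrt{k}}{k'}\qquad\text{if } \alpha>\frac{\ln 2}{\pi}.$$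
   Context: For a modulus $k\in(0,1)$, the complementary modulus is $k'=\sqrt{1-k^2}$, and the complete elliptic integral of the first kind with modulus $k$ is $K=K(k)=\int_0^{\pi/2}\frac{d\varphi}{\sqrt{1-k^2\sin^2\varphi}}$; $K'=K(k')$. Given $\alpha>0$, the modulus $k$ is the one for which $\alpha=K'/K$, and $k',K,K'$ are the corresponding quantities. *)

(* Defs.v *)
(* Classical real numbers of the standard library, with Coquelicot's Riemann
   integral. *)
From Stdlib Require Import Reals.
From Coquelicot Require Import Coquelicot.

Local Open Scope R_scope.

Definition compl_modulus (k : R) : R := sqrt (1 - k ^ 2).

(* The argument is the modulus k, not the parameter m = k ^ 2. *)
Definition ellK (k : R) : R :=
  RInt (fun phi => 1 / sqrt (1 - k ^ 2 * sin phi ^ 2)) 0 (PI / 2).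

(* Main.v *)
(* With L = ln (1 + z) and z = e^(2 i x), the first integrand is ln (2 |sin (L / (2 alpha))|^2), so twice the
   integral is the integral over the upper unit half circle of the logarithm of an analytic function whose zeros in the
   disc are z = 0 and z = q^(2n) - 1, where q = exp (- pi alpha).  Jensen's formula evaluates it by the product
   G = prod (1 - q^(2n)).  Jensen's formula is obtained by differentiating the means over half circles of
   radius r: the derivative is an increment of the argument of the sine between two real points, hence a
   constant over r on every interval free of zeros, and the means are continuous across the zeros and up to
   r = 1.  The second integral follows from cosh 2a - cos 2b = 2 (cosh a - cos b)(cosh a + cos b).

   It remains to express G by the moduli.  The theta functions phi (-q), 2 q^(1/4) psi (q^2), phi (q) satisfy
   theta_3 (q) = theta_3 (q^4) + theta_2 (q^4) and theta_2 (q)^2 = 2 theta_2 (q^2) theta_3 (q^2), by Shanks's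
   finite forms of Gauss's identities.  The square roots of the normalised AGM sequences started at (1, k')
   satisfy the same recurrences along q, q^2, q^4, ..., because I(a, b) = I((a + b) / 2, sqrt (a b)) for
   I(a, b), the integral of 1 / sqrt (a^2 cos^2 + b^2 sin^2).  Logarithmic discrepancies do not grow under
   the recurrence, so the crude asymptotics I(1, x) = - ln x + O(1) forces the two families to coincide.  *)
Require Import Defs.
From Stdlib Require Import Reals Lra Lia Psatz.
From Coquelicot Require Import Coquelicot.

Local Open Scope R_scope.

(** * Euler's product *)

(** The bound $\alpha>\ln 2/(2\pi)$ keeps the positive zeros $e^{2\pi n\alpha}-1$ of the sine
    outside the closed unit disc. All zeros are real, so a half circle ends at real points, where
    the argument of the sine is constant between zeros; real derivatives in $r$ and $t$ then
    suffice. The obstacle is that the zeros $q^{2n}-1$ accumulate at the boundary point $-1$. The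
    passage to $r=1$ therefore rests on a bound of the integrand by an integrable singularity at
    $t=\pi$, uniform in $r$, and on the radii $1-q^{2n+1}$, along which the term $2\pi(n+1)\ln r$
    collected from the zeros tends to 0. On the elliptic side everything is compared in logarithms.
    Since $\ln\theta_2(q^{2^n})$ has size $2^n$ and each backward step halves the discrepancy, an
    $O(1)$ error in the asymptotics is harmless, while the leading coefficient identifies $q=e^{-\pi
    K'/K}$. Neither the inversion of the modulus as a function of the nome nor a modular
    transformation of theta functions is involved. *)

Lemma ln_le_sub_1 (u : R) : 0 < u -> ln u <= u - 1.
Proof.
  intros hu. generalize (exp_ineq1_le (ln u)). rewrite exp_ln; lra.
Qed.

Lemma ln_ge_1_sub_inv (u : R) : 0 < u -> 1 - / u <= ln u.
Proof.
  intros hu. generalize (ln_le_sub_1 (/ u) (Rinv_0_lt_compat u hu)).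
  rewrite ln_Rinv; lra.
Qed.

Lemma Rabs_ln_1_sub (y : R) : Rabs y < 1 -> Rabs (ln (1 - y)) <= Rabs y / (1 - Rabs y).
Proof.
  intros hy. assert (h := Rabs_def2 _ _ hy).
  assert (h1 := ln_le_sub_1 (1 - y) ltac:(lra)).
  assert (h2 := ln_ge_1_sub_inv (1 - y) ltac:(lra)).
  replace (1 - / (1 - y)) with (- (y / (1 - y))) in h2 by (field; lra).
  assert (h0 := Rabs_pos y).
  assert (hq : Rabs y <= Rabs y / (1 - Rabs y)).
  { apply Rle_div_r; nra. }
  apply Rabs_le; split.
  - apply Rle_trans with (2 := h2). apply Ropp_le_contravar.
    unfold Rdiv. destruct (Rle_or_lt 0 y) as [hp | hn].
    + rewrite Rabs_pos_eq by lra. lra.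
    + apply Rle_trans with 0.
      * assert (0 < / (1 - y)) by (apply Rinv_0_lt_compat; lra). nra.
      * apply Rle_trans with (Rabs y); [lra | exact hq].
  - apply Rle_trans with (2 := hq). generalize (Rle_abs (- y)).
    rewrite Rabs_Ropp. lra.
Qed.

Lemma lim_seq_ext_eq (u v : nat -> R) (a b : R) :
  (forall n, u n = v n) -> is_lim_seq u a -> is_lim_seq v b -> a = b.
Proof.
  intros e hu hv. apply (is_lim_seq_ext _ _ _ e) in hu.
  apply is_lim_seq_unique in hu. apply is_lim_seq_unique in hv.
  apply Rbar_finite_eq. rewrite <- hu. exact hv.
Qed.

Fixpoint euler_prod (x : R) (n : nat) : R :=
  match n with
  | O => 1
  | S m => euler_prod x m * (1 - x ^ S m)
  end.

(** The product $\prod_{n\ge1}(1-x^n)$ as the exponential of a logarithmic series: it is positive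
    for every [x], and estimates of its logarithm are estimates of a series. *)
Definition euler (x : R) : R := exp (Series (fun n => ln (1 - x ^ S n))).

Lemma euler_pos (x : R) : 0 < euler x.
Proof. apply exp_pos. Qed.

Lemma Rabs_pow_lt_1 (x : R) (n : nat) : Rabs x < 1 -> Rabs (x ^ S n) < 1.
Proof.
  intros hx. rewrite <- RPow_abs. apply pow_lt_1_compat; [|lia].
  split; [apply Rabs_pos | exact hx].
Qed.

Lemma one_sub_pow_pos (x : R) (n : nat) : Rabs x < 1 -> 0 < 1 - x ^ S n.
Proof.
  intros hx. generalize (Rabs_pow_lt_1 x n hx) (Rle_abs (x ^ S n)). lra.
Qed.

Lemma one_add_pow_pos (x : R) (n : nat) : Rabs x < 1 -> 0 < 1 + x ^ S n.
Proof.
  intros hx. generalize (Rabs_pow_lt_1 x n hx) (Rle_abs (- x ^ S n)).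
  rewrite Rabs_Ropp. lra.
Qed.

Lemma euler_prod_pos (x : R) (n : nat) : Rabs x < 1 -> 0 < euler_prod x n.
Proof.
  intros hx. induction n as [|n IH]; [simpl; lra|].
  apply Rmult_lt_0_compat; [exact IH | apply one_sub_pow_pos; exact hx].
Qed.

Lemma Rabs_pow_S_le (x : R) (n : nat) : Rabs x < 1 -> Rabs (x ^ S n) <= Rabs x.
Proof.
  intros hx. simpl. rewrite Rabs_mult, <- RPow_abs.
  assert (h0 := Rabs_pos x).
  assert (Rabs x ^ n <= 1).
  { rewrite <- (pow1 n). apply pow_incr. lra. }
  nra.
Qed.

Lemma Rabs_ln_euler_term (x : R) (n : nat) : Rabs x < 1 ->
  Rabs (ln (1 - x ^ S n)) <= Rabs x / (1 - Rabs x) * Rabs x ^ n.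
Proof.
  intros hx. eapply Rle_trans; [apply Rabs_ln_1_sub, Rabs_pow_lt_1, hx|].
  generalize (Rabs_pow_S_le x n hx) (Rabs_pos x). intros h h0.
  replace (Rabs x / (1 - Rabs x) * Rabs x ^ n)
    with (Rabs (x ^ S n) * / (1 - Rabs x)).
  - apply Rmult_le_compat_l; [apply Rabs_pos|]. apply Rinv_le_contravar; lra.
  - rewrite <- RPow_abs. simpl. field. lra.
Qed.

Lemma is_series_euler_bound (x : R) : Rabs x < 1 ->
  is_series (fun n => Rabs x / (1 - Rabs x) * Rabs x ^ n)
    (Rabs x / (1 - Rabs x) * / (1 - Rabs x)).
Proof.
  intros hx.
  assert (h : is_series (fun n => Rabs x ^ n) (/ (1 - Rabs x))).
  { apply is_series_geom. rewrite Rabs_Rabsolu. exact hx. }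
  exact (is_series_scal (Rabs x / (1 - Rabs x)) _ _ h).
Qed.

Lemma ex_series_ln_euler (x : R) : Rabs x < 1 ->
  ex_series (fun n => ln (1 - x ^ S n)).
Proof.
  intros hx. apply (@ex_series_le R_AbsRing R_CompleteNormedModule)
    with (b := fun n => Rabs x / (1 - Rabs x) * Rabs x ^ n).
  - intros n. apply Rabs_ln_euler_term, hx.
  - eexists. apply is_series_euler_bound, hx.
Qed.

Lemma ln_euler_bound (x : R) : Rabs x < 1 ->
  Rabs (ln (euler x)) <= Rabs x / (1 - Rabs x) * / (1 - Rabs x).
Proof.
  intros hx. unfold euler. rewrite ln_exp.
  assert (ex : ex_series (fun n => Rabs (ln (1 - x ^ S n)))).
  { apply (@ex_series_le R_AbsRing R_CompleteNormedModule)
      with (b := fun n => Rabs x / (1 - Rabs x) * Rabs x ^ n).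
    - intros n. unfold norm; simpl; unfold abs; simpl. rewrite Rabs_Rabsolu.
      apply (Rabs_ln_euler_term x n hx).
    - eexists. apply is_series_euler_bound, hx. }
  eapply Rle_trans; [apply Series_Rabs, ex|].
  rewrite <- (is_series_unique _ _ (is_series_euler_bound x hx)).
  apply Series_le.
  - intros n. split; [apply Rabs_pos | apply Rabs_ln_euler_term, hx].
  - eexists. apply is_series_euler_bound, hx.
Qed.

Lemma euler_prod_lim (x : R) : Rabs x < 1 -> is_lim_seq (euler_prod x) (euler x).
Proof.
  intros hx.
  apply is_lim_seq_incr_1.
  apply is_lim_seq_ext with (fun n => exp (sum_n (fun n => ln (1 - x ^ S n)) n)).
  - induction n as [|n IH].
    + rewrite sum_O, exp_ln by (apply (one_sub_pow_pos x 0), hx). simpl. ring.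
    + rewrite sum_Sn.
      change (exp (sum_n (fun n => ln (1 - x ^ S n)) n + ln (1 - x ^ S (S n)))
        = euler_prod x (S (S n))).
      rewrite exp_plus, IH, exp_ln by (apply (one_sub_pow_pos x (S n)), hx).
      reflexivity.
  - unfold euler. apply (is_lim_seq_continuous exp).
    + apply derivable_continuous_pt, derivable_pt_exp.
    + apply Series_correct, ex_series_ln_euler, hx.
Qed.

Lemma Rabs_sqr_lt_1 (x : R) : Rabs x < 1 -> Rabs (x ^ 2) < 1.
Proof. exact (Rabs_pow_lt_1 x 1). Qed.

(* The even factors of [euler_prod (-x)] and [euler_prod x] agree, the odd ones multiply to [1 - x^(2m)]. *)
Lemma euler_prod_opp (x : R) (n : nat) : Rabs x < 1 ->
  euler_prod (- x) (2 * n) * euler_prod x (2 * n) * euler_prod (x ^ 4) n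
  = euler_prod (x ^ 2) n ^ 2 * euler_prod (x ^ 2) (2 * n).
Proof.
  intros hx. induction n as [|n IH]; [simpl; ring|].
  replace (2 * S n)%nat with (S (S (2 * n))) by lia.
  cbn [euler_prod].
  replace ((- x) ^ S (2 * n)) with (- x ^ S (2 * n)).
  2:{ rewrite <- !tech_pow_Rmult, !pow_mult.
      replace ((- x) ^ 2) with (x ^ 2) by ring. ring. }
  replace ((- x) ^ S (S (2 * n))) with (x ^ S (S (2 * n))).
  2:{ rewrite <- !tech_pow_Rmult, !pow_mult.
      replace ((- x) ^ 2) with (x ^ 2) by ring. ring. }
  replace ((x ^ 4) ^ S n) with ((x ^ 2) ^ S (S (2 * n))).
  2:{ rewrite <- !pow_mult. f_equal. lia. }
  replace (x ^ S (S (2 * n))) with ((x ^ 2) ^ S n).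
  2:{ rewrite <- !pow_mult. f_equal. lia. }
  replace ((x ^ 2) ^ S (2 * n)) with ((x ^ S (2 * n)) ^ 2).
  2:{ rewrite <- !pow_mult. f_equal. lia. }
  transitivity (euler_prod (- x) (2 * n) * euler_prod x (2 * n) * euler_prod (x ^ 4) n
    * ((1 - (x ^ S (2 * n)) ^ 2) * (1 - (x ^ 2) ^ S n) ^ 2 * (1 - (x ^ 2) ^ S (S (2 * n))))).
  - ring.
  - rewrite IH. ring.
Qed.

Lemma is_lim_seq_double (u : nat -> R) (l : Rbar) :
  is_lim_seq u l -> is_lim_seq (fun n => u (2 * n)%nat) l.
Proof.
  intros h. apply (is_lim_seq_subseq u l (fun n => (2 * n)%nat)); [|exact h].
  apply eventually_subseq. intros n. lia.
Qed.

(** The sign of $(-x)^m$ depends on the parity of $m$, so the finite identity holds at even indices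
    and the limit is taken along $2n$. It eliminates [euler (- x)] in favour of powers of [x]. *)
Lemma euler_opp (x : R) : Rabs x < 1 ->
  euler (- x) * euler x * euler (x ^ 4) = euler (x ^ 2) ^ 3.
Proof.
  intros hx.
  assert (hx' : Rabs (- x) < 1) by (rewrite Rabs_Ropp; exact hx).
  assert (h2 := Rabs_sqr_lt_1 x hx).
  assert (h4 : Rabs (x ^ 4) < 1) by exact (Rabs_pow_lt_1 x 3 hx).
  assert (l1 : is_lim_seq (fun n => euler_prod (- x) (2 * n) * euler_prod x (2 * n) * euler_prod (x ^ 4) n)
     (euler (- x) * euler x * euler (x ^ 4))).
  { apply is_lim_seq_mult'; [apply is_lim_seq_mult'|].
    - apply (is_lim_seq_double (euler_prod (- x))), euler_prod_lim, hx'.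
    - apply (is_lim_seq_double (euler_prod x)), euler_prod_lim, hx.
    - apply euler_prod_lim, h4. }
  assert (l2 : is_lim_seq (fun n => euler_prod (x ^ 2) n * euler_prod (x ^ 2) n * euler_prod (x ^ 2) (2 * n))
     (euler (x ^ 2) * euler (x ^ 2) * euler (x ^ 2))).
  { apply is_lim_seq_mult'; [apply is_lim_seq_mult'|].
    - apply euler_prod_lim, h2.
    - apply euler_prod_lim, h2.
    - apply (is_lim_seq_double (euler_prod (x ^ 2))), euler_prod_lim, h2. }
  replace (euler (x ^ 2) ^ 3) with (euler (x ^ 2) * euler (x ^ 2) * euler (x ^ 2)) by ring.
  refine (lim_seq_ext_eq _ _ _ _ _ l1 l2). intros n.
  rewrite euler_prod_opp by exact hx. ring.
Qed.

(** * The theta functions of Gauss *)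

(** Partial products of Gauss's product for $\sum_{s\in\mathbb Z}(-1)^sx^{s^2}$. *)
Fixpoint gauss_prod (x : R) (n : nat) : R :=
  match n with
  | O => 1
  | S m => gauss_prod x m * ((1 - x ^ S m) / (1 + x ^ S m))
  end.

Lemma gauss_prod_pos (x : R) (n : nat) : Rabs x < 1 -> 0 < gauss_prod x n.
Proof.
  intros hx. induction n as [|n IH]; [simpl; lra|].
  apply Rmult_lt_0_compat; [exact IH|]. apply Rdiv_lt_0_compat.
  - apply one_sub_pow_pos, hx.
  - apply one_add_pow_pos, hx.
Qed.

Lemma gauss_prod_euler (x : R) (n : nat) : Rabs x < 1 ->
  gauss_prod x n = euler_prod x n ^ 2 / euler_prod (x ^ 2) n.
Proof.
  intros hx. assert (h2 := Rabs_sqr_lt_1 x hx).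
  induction n as [|n IH]; [simpl; field|].
  assert (h := euler_prod_pos _ n h2).
  assert (h3 := one_sub_pow_pos _ n h2).
  assert (h4 := one_add_pow_pos x n hx).
  cbn [gauss_prod euler_prod]. rewrite IH.
  replace ((x ^ 2) ^ S n) with ((x ^ S n) ^ 2) in *.
  2: { rewrite <- !pow_mult. f_equal. lia. }
  set (y := x ^ S n) in *. field. repeat split; nra.
Qed.

Definition theta_sum (y : R) (n : nat) : R := 2 * sum_f_R0 (fun s => y ^ (s * s)) n - 1.

(** At $s=0$ the factor $2/(1+x^s)$ equals 1, so that term is [gauss_prod x n] itself; every other
    term carries at least $x^{n+1}$. This is what links the theta series to the product. *)
Definition shanks_term (x : R) (n s : nat) : R :=
  (-1) ^ s * (2 / (1 + x ^ s)) * (gauss_prod x n / gauss_prod x s) * x ^ (s * S n).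

(** A telescoping certificate: the difference in [n], summed over [s], has a closed form, so that
    each induction step is a rational identity in $x^{m+1}$, $x^{n+1}$ and $x^{(m+1)(n+1)}$. *)
Lemma shanks_diff (x : R) (n m : nat) : Rabs x < 1 ->
  sum_f_R0 (fun s => shanks_term x (S n) s - shanks_term x n s) m
  = - 2 * (-1) ^ m * (x ^ (S m * S n) * (gauss_prod x n / gauss_prod x m))
    / (1 + x ^ S n).
Proof.
  intros hx. assert (hq := one_add_pow_pos x n hx).
  assert (hn := gauss_prod_pos x n hx).
  induction m as [|m IH].
  - unfold shanks_term. cbn [sum_f_R0 gauss_prod].
    replace (S 0 * S n)%nat with (S n) by lia. rewrite !Nat.mul_0_l.
    change (x ^ 0) with 1. change ((-1) ^ 0) with 1. field. lra.
  - rewrite tech5, IH. unfold shanks_term. cbn [gauss_prod].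
    assert (hm := gauss_prod_pos x m hx).
    assert (h1 := one_sub_pow_pos x m hx).
    assert (h2 := one_add_pow_pos x m hx).
    replace (S (S m) * S n)%nat with (S n + S m * S n)%nat by lia.
    replace (S m * S (S n))%nat with (S m + S m * S n)%nat by lia.
    rewrite !pow_add.
    set (w := x ^ (S m * S n)). set (a := x ^ S m) in *. set (b := x ^ S n) in *.
    change ((-1) ^ S m) with (-1 * (-1) ^ m).
    field. repeat split; lra.
Qed.

Lemma pow_opp_square (x : R) (s : nat) : (- x) ^ (s * s) = (-1) ^ s * x ^ (s * s).
Proof.
  replace (- x) with (-1 * x) by ring. rewrite Rpow_mult_distr. f_equal.
  induction s as [|s IH]; [reflexivity|].
  replace (S s * S s)%nat with (s * s + 2 * s + 1)%nat by lia.
  rewrite !pow_add, IH, pow_1_even. simpl. ring.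
Qed.

(** From [n] to [n + 1] the closed form of [shanks_diff] and the new last term share the denominator
    $1+x^{n+1}$, which cancels and leaves the next term $2(-x)^{(n+1)^2}$ of the theta series. *)
Lemma shanks_identity (x : R) (n : nat) : Rabs x < 1 ->
  theta_sum (- x) n = sum_f_R0 (shanks_term x n) n.
Proof.
  intros hx. induction n as [|n IH].
  - unfold theta_sum, shanks_term. simpl. field.
  - assert (e : theta_sum (- x) (S n) = theta_sum (- x) n + 2 * (- x) ^ (S n * S n)).
    { unfold theta_sum. rewrite tech5. ring. }
    assert (d := shanks_diff x n n hx). rewrite minus_sum in d.
    rewrite tech5, e, IH, pow_opp_square.
    apply (Rplus_eq_reg_r (- sum_f_R0 (shanks_term x n) n)).
    transitivity (- 2 * (-1) ^ n * (x ^ (S n * S n) * (gauss_prod x n / gauss_prod x n))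
      / (1 + x ^ S n) + shanks_term x (S n) (S n)); [|rewrite <- d; ring].
    assert (hn := gauss_prod_pos x n hx).
    assert (hn1 := gauss_prod_pos x (S n) hx).
    assert (hq := one_add_pow_pos x n hx).
    unfold shanks_term.
    replace (S n * S (S n))%nat with (S n + S n * S n)%nat by lia.
    rewrite pow_add. change ((-1) ^ S n) with (-1 * (-1) ^ n).
    field. repeat split; lra.
Qed.

(** The sign convention is that of $\theta_4$: [phi x] is $\sum_{s\in\mathbb Z}(-1)^sx^{s^2}$, hence
    $\theta_3(q)$ is [phi (- q)]. [psi x] is $\sum_{s\ge0}x^{s(s+1)/2}$. *)
Definition phi (x : R) : R := euler x ^ 2 / euler (x ^ 2).
Definition psi (x : R) : R := euler (x ^ 2) ^ 2 / euler x.

Lemma phi_pos (x : R) : 0 < phi x.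
Proof. apply Rdiv_lt_0_compat; [apply pow_lt|]; apply euler_pos. Qed.

Lemma psi_pos (x : R) : 0 < psi x.
Proof. apply Rdiv_lt_0_compat; [apply pow_lt|]; apply euler_pos. Qed.

Lemma gauss_prod_lim (x : R) : Rabs x < 1 -> is_lim_seq (gauss_prod x) (phi x).
Proof.
  intros hx. assert (h2 := Rabs_sqr_lt_1 x hx).
  apply is_lim_seq_ext with (fun n => euler_prod x n ^ 2 / euler_prod (x ^ 2) n).
  - intros n. symmetry. apply gauss_prod_euler, hx.
  - apply is_lim_seq_div'.
    + apply (is_lim_seq_ext (fun n => euler_prod x n * euler_prod x n)).
      * intros n. ring.
      * replace (euler x ^ 2) with (euler x * euler x) by ring.
        apply is_lim_seq_mult'; apply euler_prod_lim, hx.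
    + apply euler_prod_lim, h2.
    + apply Rgt_not_eq, euler_pos.
Qed.

(** Bounds the quotients of partial products in the finite identities uniformly in both indices. *)
Lemma ratio_bounded (u : nat -> R) (l : R) : (forall n, 0 < u n) -> 0 < l -> is_lim_seq u l ->
  exists C, 0 < C /\ forall n m, u n / u m <= C.
Proof.
  intros hu hl h.
  assert (h' : is_lim_seq (fun n => / u n) (/ l)).
  { apply (is_lim_seq_inv u l h). intros e. injection e. lra. }
  assert (b : forall v : nat -> R, forall a : R, is_lim_seq v a -> exists M, forall n, v n <= M).
  { intros v a hv. apply is_lim_seq_Reals in hv.
    destruct (maj_by_pos v) as [M [hM HM]]; [eexists; exact hv|].
    exists M. intros n. eapply Rle_trans; [apply Rle_abs | apply HM]. }
  destruct (b _ _ h) as [A hA]. destruct (b _ _ h') as [B hB].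
  assert (0 < A) by (generalize (hu 0%nat) (hA 0%nat); lra).
  assert (hi := Rinv_0_lt_compat _ (hu 0%nat)).
  assert (0 < B) by (generalize (hB 0%nat); lra).
  exists (A * B). split; [apply Rmult_lt_0_compat; lra|].
  intros n m. apply Rmult_le_compat.
  - apply Rlt_le, hu.
  - apply Rlt_le, Rinv_0_lt_compat, hu.
  - apply hA.
  - apply hB.
Qed.

Lemma is_lim_seq_nat_geom (r : R) : 0 <= r < 1 -> is_lim_seq (fun n => INR n * r ^ n) 0.
Proof.
  intros hr. apply ex_series_lim_0.
  (* The ratio test requires nonzero terms, so $r=0$ is separated. *)
  destruct (Req_dec r 0) as [-> | h0].
  - apply (ex_series_ext (fun n => 0 ^ S n)).
    + intros n. destruct n; simpl; ring.
    + apply (ex_series_incr_1 (fun n => 0 ^ n)). apply ex_series_geom. rewrite Rabs_R0. lra.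
  - apply ex_series_incr_1. apply ex_series_Rabs. apply ex_series_DAlembert with r; [lra| |].
    + intros n. apply Rmult_integral_contrapositive_currified.
      * apply not_0_INR. lia.
      * apply pow_nonzero, h0.
    + apply is_lim_seq_ext with (fun n => (1 + / INR (S n)) * r).
      * intros n. rewrite (S_INR (S n)). assert (0 < INR (S n)) by (apply lt_0_INR; lia).
        simpl pow. assert (0 < r ^ n) by (apply pow_lt; lra).
        assert (0 < / INR (S n)) by (apply Rinv_0_lt_compat; lra).
        rewrite Rabs_pos_eq.
        -- field. repeat split; lra.
        -- apply Rmult_le_pos; [|apply Rlt_le, Rinv_0_lt_compat];
             repeat apply Rmult_le_pos; repeat apply Rmult_lt_0_compat; lra.
      * replace (Finite r) with (Finite ((1 + 0) * r)) by (f_equal; ring).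
        apply is_lim_seq_mult'; [|apply is_lim_seq_const].
        apply is_lim_seq_plus'; [apply is_lim_seq_const|].
        apply (is_lim_seq_inv (fun n => INR (S n)) p_infty).
        -- apply (is_lim_seq_incr_1 INR), is_lim_seq_INR.
        -- discriminate.
Qed.

Lemma sum_f_R0_abs_le_const (f : nat -> R) (c : R) (n : nat) :
  (forall s, (s <= n)%nat -> Rabs (f s) <= c) -> Rabs (sum_f_R0 f n) <= INR (S n) * c.
Proof.
  intros h. induction n as [|n IH].
  - simpl. rewrite Rmult_1_l. apply h. lia.
  - rewrite tech5, S_INR. eapply Rle_trans; [apply Rabs_triang|].
    assert (h1 := h (S n) ltac:(lia)).
    assert (h2 := IH ltac:(intros; apply h; lia)). lra.
Qed.

(** In Shanks's form the term $s=0$ is the partial product, and the remaining terms, one per $s\le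
    n$ after reindexing, are each $O(|x|^{n+2})$; their sum vanishes in the limit. *)
Lemma theta_sum_lim (x : R) : Rabs x < 1 -> is_lim_seq (theta_sum (- x)) (phi x).
Proof.
  intros hx. assert (h0 := Rabs_pos x).
  destruct (ratio_bounded (gauss_prod x) (phi x)) as [C [hC H]].
  { intros n. apply gauss_prod_pos, hx. }
  { apply phi_pos. }
  { apply gauss_prod_lim, hx. }
  (* The factor $2/(1-|x|)$ bounds $2/(1+x^s)$, and [C] bounds the quotient of products. *)
  set (D := 2 / (1 - Rabs x) * C).
  assert (hD : 0 <= D).
  { apply Rmult_le_pos; [|lra]. apply Rlt_le, Rdiv_lt_0_compat; lra. }
  apply is_lim_seq_incr_1.
  apply is_lim_seq_ext with
    (fun n => gauss_prod x (S n) + (theta_sum (- x) (S n) - gauss_prod x (S n))); [intros n; ring|].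
  replace (Finite (phi x)) with (Finite (phi x + 0)) by (f_equal; ring).
  apply is_lim_seq_plus'; [apply (is_lim_seq_incr_1 (gauss_prod x)), gauss_prod_lim, hx|].
  apply is_lim_seq_abs_0.
  apply is_lim_seq_le_le with (fun _ => 0) (fun n => D * Rabs x * (INR (S n) * Rabs x ^ S n)).
  - intros n. split; [apply Rabs_pos|].
    rewrite shanks_identity by exact hx. rewrite decomp_sum by lia.
    replace (shanks_term x (S n) 0) with (gauss_prod x (S n)).
    2:{ unfold shanks_term. rewrite Nat.mul_0_l. cbn [gauss_prod pow].
        assert (hq := one_add_pow_pos x n hx). simpl in hq.
        field. lra. }
    replace (gauss_prod x (S n) + sum_f_R0 (fun i => shanks_term x (S n) (S i)) (pred (S n))
      - gauss_prod x (S n)) with (sum_f_R0 (fun i => shanks_term x (S n) (S i)) n)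
      by (simpl pred; ring).
    replace (D * Rabs x * (INR (S n) * Rabs x ^ S n)) with (INR (S n) * (D * Rabs x ^ S (S n)))
      by (simpl; ring).
    apply sum_f_R0_abs_le_const. intros s hs. unfold shanks_term, D.
    rewrite !Rabs_mult. rewrite <- (RPow_abs x (S s * S (S n))), <- (RPow_abs (-1)).
    replace (Rabs (-1)) with 1 by (rewrite Rabs_left; lra).
    rewrite pow1, Rmult_1_l.
    assert (hp := gauss_prod_pos x (S n) hx). assert (hp' := gauss_prod_pos x (S s) hx).
    assert (h1 := one_add_pow_pos x s hx).
    apply Rmult_le_compat; [| |apply Rmult_le_compat|].
    + apply Rmult_le_pos; apply Rabs_pos.
    + apply pow_le, h0.
    + apply Rabs_pos.
    + apply Rabs_pos.
    + rewrite Rabs_pos_eq by (apply Rlt_le, Rdiv_lt_0_compat; lra).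
      apply Rmult_le_compat_l; [lra|]. apply Rinv_le_contravar; [lra|].
      generalize (Rabs_pow_S_le x s hx) (Rle_abs (- x ^ S s)). rewrite Rabs_Ropp. lra.
    + rewrite Rabs_pos_eq by (apply Rlt_le, Rdiv_lt_0_compat; lra). apply H.
    + replace (S s * S (S n))%nat with (S (S n) + s * S (S n))%nat by lia.
      rewrite pow_add. rewrite <- (Rmult_1_r (Rabs x ^ S (S n))) at 2.
      apply Rmult_le_compat_l; [apply pow_le, h0|].
      rewrite <- (pow1 (s * S (S n))). apply pow_incr. lra.
  - apply is_lim_seq_const.
  - replace (Finite 0) with (Finite (D * Rabs x * 0)) by (f_equal; ring).
    apply is_lim_seq_mult'; [apply is_lim_seq_const|].
    apply (is_lim_seq_incr_1 (fun n => INR n * Rabs x ^ n)), is_lim_seq_nat_geom. lra.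
Qed.

(** * The triangular-number series and its product *)

Fixpoint tri (s : nat) : nat :=
  match s with
  | O => O
  | S m => (tri m + S m)%nat
  end.

Lemma tri_double (n : nat) : tri (2 * n) = (n * S (2 * n))%nat.
Proof.
  induction n as [|n IH]; [reflexivity|].
  replace (2 * S n)%nat with (S (S (2 * n))) by lia. cbn [tri]. rewrite IH. lia.
Qed.

Lemma odd_square_tri (s : nat) : (S (2 * s) * S (2 * s) = S (8 * tri s))%nat.
Proof. induction s as [|s IH]; [reflexivity|]. cbn [tri]. lia. Qed.

Fixpoint psi_prod (x : R) (n : nat) : R :=
  match n with
  | O => 1
  | S m => psi_prod x m * ((1 - x ^ (2 * S m)) / (1 - x ^ S (2 * m)))
  end.

Lemma psi_prod_pos (x : R) (n : nat) : Rabs x < 1 -> 0 < psi_prod x n.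
Proof.
  intros hx. induction n as [|n IH]; [simpl; lra|].
  apply Rmult_lt_0_compat; [exact IH|]. apply Rdiv_lt_0_compat.
  - replace (2 * S n)%nat with (S (S (2 * n))) by lia. apply one_sub_pow_pos, hx.
  - apply one_sub_pow_pos, hx.
Qed.

Lemma psi_prod_euler (x : R) (n : nat) : Rabs x < 1 ->
  psi_prod x n = euler_prod (x ^ 2) n ^ 2 / euler_prod x (2 * n).
Proof.
  intros hx. induction n as [|n IH]; [simpl; field|].
  assert (h := euler_prod_pos _ (2 * n) hx).
  assert (h3 := one_sub_pow_pos _ (2 * n) hx).
  assert (h4 := one_sub_pow_pos x (S (2 * n)) hx).
  replace (2 * S n)%nat with (S (S (2 * n))) in * by lia.
  cbn [psi_prod euler_prod]. rewrite IH.
  replace ((x ^ 2) ^ S n) with (x ^ S (S (2 * n))).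
  2: { rewrite <- !pow_mult. f_equal. lia. }
  replace (2 * S n)%nat with (S (S (2 * n))) in * by lia.
  field. repeat split; lra.
Qed.

Definition psi_term (x : R) (n s : nat) : R :=
  psi_prod x n / psi_prod x s * x ^ (s * S (2 * n)).

(** The telescoping certificate for triangular numbers, in the same role as [shanks_diff]. *)
Lemma psi_diff (x : R) (n m : nat) : Rabs x < 1 ->
  sum_f_R0 (fun s => psi_term x (S n) s - psi_term x n s) m
  = x ^ (S m * S (2 * n)) * (1 - x ^ S (2 * m)) * (psi_prod x n / psi_prod x m)
    / (1 - x ^ S (2 * n)).
Proof.
  intros hx. assert (hq := one_sub_pow_pos x (2 * n) hx).
  assert (hn := psi_prod_pos x n hx).
  induction m as [|m IH].
  - unfold psi_term. cbn [sum_f_R0 psi_prod].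
    replace (1 * S (2 * n))%nat with (S (2 * n)) by lia. rewrite !Nat.mul_0_l.
    replace (2 * S n)%nat with (S (S (2 * n))) by lia.
    rewrite <- (tech_pow_Rmult x (S (2 * n))).
    rewrite Nat.mul_0_r. simpl pow at 4. simpl pow at 3. cbn [pow] in *. field. lra.
  - rewrite tech5, IH. unfold psi_term. cbn [psi_prod].
    assert (hm := psi_prod_pos x m hx).
    assert (h1 := one_sub_pow_pos x (2 * m) hx).
    assert (h2 := one_sub_pow_pos x (S (2 * m)) hx).
    replace (S (S m) * S (2 * n))%nat with (S (2 * n) + S m * S (2 * n))%nat by lia.
    replace (S m * S (2 * S n))%nat with (S (S (2 * m)) + S m * S (2 * n))%nat by lia.
    replace (2 * S n)%nat with (S (S (2 * n))) by lia.
    replace (2 * S m)%nat with (S (S (2 * m))) by lia.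
    rewrite !pow_add.
    rewrite <- (tech_pow_Rmult x (S (S (2 * m)))), <- (tech_pow_Rmult x (S (2 * m))) in *.
    rewrite <- (tech_pow_Rmult x (S (2 * n))).
    set (w := x ^ (S m * S (2 * n))). set (a := x ^ S (2 * m)) in *. set (b := x ^ S (2 * n)) in *.
    field. repeat split; lra.
Qed.

(** Each step adds two triangular exponents, so the left side ends at an odd index. The right side
    stops at $s=n$, one below the product index: the term $s=n+1$ would already be
    $x^{(n+1)(2n+3)}$, the next power of the series. *)
Lemma psi_identity (x : R) (n : nat) : Rabs x < 1 ->
  sum_f_R0 (fun s => x ^ tri s) (S (2 * n)) = sum_f_R0 (psi_term x (S n)) n.
Proof.
  intros hx. induction n as [|n IH].
  - unfold psi_term. simpl.
    assert (h := one_sub_pow_pos x 0 hx). simpl in h. field. lra.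
  - replace (S (2 * S n)) with (S (S (S (2 * n)))) by lia.
    rewrite (tech5 _ (S (S (2 * n)))), (tech5 _ (S (2 * n))), (tech5 _ n), IH.
    assert (d := psi_diff x (S n) n hx). rewrite minus_sum in d.
    apply (Rplus_eq_reg_r (- sum_f_R0 (psi_term x (S n)) n)).
    transitivity (x ^ (S n * S (2 * S n)) * (1 - x ^ S (2 * n)) * (psi_prod x (S n) / psi_prod x n)
      / (1 - x ^ S (2 * S n)) + psi_term x (S (S n)) (S n)); [|rewrite <- d; ring].
    assert (hn := psi_prod_pos x n hx).
    assert (hn1 := psi_prod_pos x (S n) hx).
    assert (h1 := one_sub_pow_pos x (2 * n) hx).
    assert (h2 := one_sub_pow_pos x (2 * S n) hx).
    assert (h3 := one_sub_pow_pos x (S (2 * S n)) hx).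
    assert (h4 := one_sub_pow_pos x (S (2 * n)) hx).
    replace (S (S (2 * n))) with (2 * S n)%nat in * by lia.
    replace (tri (S (2 * S n))) with (tri (2 * S n) + S (2 * S n))%nat by reflexivity.
    rewrite tri_double.
    unfold psi_term. cbn [psi_prod] in *.
    replace (S n * S (2 * S (S n)))%nat with (2 * S n + S n * S (2 * S n))%nat by lia.
    replace (2 * S (S n))%nat with (S (S (2 * S n))) by lia.
    rewrite !pow_add.
    rewrite <- (tech_pow_Rmult x (S (2 * S n))) in *.
    rewrite <- (tech_pow_Rmult x (2 * S n)) in *.
    set (w := x ^ (S n * S (2 * S n))). set (a := x ^ (2 * S n)) in *. set (b := x ^ S (2 * n)) in *.
    field. repeat split; lra.
Qed.

Lemma psi_prod_lim (x : R) : Rabs x < 1 -> is_lim_seq (psi_prod x) (psi x).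
Proof.
  intros hx. assert (h2 := Rabs_sqr_lt_1 x hx).
  apply is_lim_seq_ext with (fun n => euler_prod (x ^ 2) n ^ 2 / euler_prod x (2 * n)).
  - intros n. symmetry. apply psi_prod_euler, hx.
  - apply is_lim_seq_div'.
    + apply (is_lim_seq_ext (fun n => euler_prod (x ^ 2) n * euler_prod (x ^ 2) n)).
      * intros n. ring.
      * replace (euler (x ^ 2) ^ 2) with (euler (x ^ 2) * euler (x ^ 2)) by ring.
        apply is_lim_seq_mult'; apply euler_prod_lim, h2.
    + apply (is_lim_seq_double (euler_prod x)), euler_prod_lim, hx.
    + apply Rgt_not_eq, euler_pos.
Qed.

Lemma tri_sum_lim (x : R) : Rabs x < 1 ->
  is_lim_seq (fun n => sum_f_R0 (fun s => x ^ tri s) (S (2 * n))) (psi x).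
Proof.
  intros hx. assert (h0 := Rabs_pos x).
  destruct (ratio_bounded (psi_prod x) (psi x)) as [C [hC H]].
  { intros n. apply psi_prod_pos, hx. }
  { apply psi_pos. }
  { apply psi_prod_lim, hx. }
  apply is_lim_seq_incr_1.
  apply is_lim_seq_ext with
    (fun n => psi_prod x (S (S n)) + (sum_f_R0 (fun s => x ^ tri s) (S (2 * S n)) - psi_prod x (S (S n))));
    [intros n; ring|].
  replace (Finite (psi x)) with (Finite (psi x + 0)) by (f_equal; ring).
  apply is_lim_seq_plus'.
  { apply (is_lim_seq_incr_1 (fun n => psi_prod x (S n))), (is_lim_seq_incr_1 (psi_prod x)), psi_prod_lim, hx. }
  apply is_lim_seq_abs_0.
  apply is_lim_seq_le_le with (fun _ => 0) (fun n => C * (INR (S n) * Rabs x ^ S n)).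
  - intros n. split; [apply Rabs_pos|].
    rewrite psi_identity by exact hx. rewrite decomp_sum by lia.
    replace (psi_term x (S (S n)) 0) with (psi_prod x (S (S n))).
    2:{ unfold psi_term. rewrite Nat.mul_0_l. change (psi_prod x 0) with 1. change (x ^ 0) with 1. field. }
    replace (psi_prod x (S (S n)) + sum_f_R0 (fun i => psi_term x (S (S n)) (S i)) (pred (S n))
      - psi_prod x (S (S n))) with (sum_f_R0 (fun i => psi_term x (S (S n)) (S i)) n)
      by (simpl pred; ring).
    replace (C * (INR (S n) * Rabs x ^ S n)) with (INR (S n) * (C * Rabs x ^ S n)) by ring.
    apply sum_f_R0_abs_le_const. intros s hs. unfold psi_term.
    rewrite Rabs_mult. rewrite <- RPow_abs.
    assert (hp := psi_prod_pos x (S (S n)) hx). assert (hp' := psi_prod_pos x (S s) hx).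
    apply Rmult_le_compat.
    + apply Rabs_pos.
    + apply pow_le, h0.
    + rewrite Rabs_pos_eq by (apply Rlt_le, Rdiv_lt_0_compat; lra). apply H.
    + replace (S s * S (2 * S (S n)))%nat with (S n + (S (S (S (S n))) + s * S (2 * S (S n))))%nat by lia.
      rewrite pow_add. rewrite <- (Rmult_1_r (Rabs x ^ S n)) at 2.
      apply Rmult_le_compat_l; [apply pow_le, h0|].
      rewrite <- (pow1 (S (S (S (S n))) + s * S (2 * S (S n)))). apply pow_incr. lra.
  - apply is_lim_seq_const.
  - replace (Finite 0) with (Finite (C * 0)) by (f_equal; ring).
    apply is_lim_seq_mult'; [apply is_lim_seq_const|].
    apply (is_lim_seq_incr_1 (fun n => INR n * Rabs x ^ n)), is_lim_seq_nat_geom. lra.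
Qed.

(** * Functional equations of the theta functions *)

Lemma theta_sum_split (x : R) (n : nat) :
  theta_sum x (2 * S n)
  = theta_sum (x ^ 4) (S n) + 2 * x * sum_f_R0 (fun s => (x ^ 8) ^ tri s) n.
Proof.
  unfold theta_sum. induction n as [|n IH].
  - simpl. ring.
  - replace (2 * S (S n))%nat with (S (S (2 * S n))) by lia.
    rewrite !tech5 in *.
    replace (S (2 * S n) * S (2 * S n))%nat with (S (8 * tri (S n))) by (rewrite <- odd_square_tri; lia).
    replace (x ^ (S (S (2 * S n)) * S (S (2 * S n)))) with ((x ^ 4) ^ (S (S n) * S (S n))).
    2:{ rewrite <- pow_mult. f_equal. lia. }
    rewrite <- tech_pow_Rmult, pow_mult. lra.
Qed.

Lemma Rabs_pow_pos_lt_1 (x : R) (n : nat) : (0 < n)%nat -> Rabs x < 1 -> Rabs (x ^ n) < 1.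
Proof. intros hn hx. destruct n; [lia | apply Rabs_pow_lt_1, hx]. Qed.

Lemma phi_split (x : R) : Rabs x < 1 ->
  phi (- x) = phi (- x ^ 4) + 2 * x * psi (x ^ 8).
Proof.
  intros hx.
  assert (h4 : Rabs (- x ^ 4) < 1) by (rewrite Rabs_Ropp; apply Rabs_pow_pos_lt_1, hx; lia).
  assert (h8 : Rabs (x ^ 8) < 1) by (apply Rabs_pow_pos_lt_1, hx; lia).
  assert (h1 : Rabs (- x) < 1) by (rewrite Rabs_Ropp; exact hx).
  assert (l1 := theta_sum_lim _ h1). rewrite Ropp_involutive in l1.
  assert (l2 := theta_sum_lim _ h4). rewrite Ropp_involutive in l2.
  assert (l3 := tri_sum_lim _ h8).
  assert (sub : forall u : nat -> R, forall l : Rbar, forall g : nat -> nat,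
     (forall n, (g n < g (S n))%nat) -> is_lim_seq u l -> is_lim_seq (fun n => u (g n)) l).
  { intros u l g hg h. apply (is_lim_seq_subseq u l g); [|exact h]. now apply eventually_subseq. }
  (* The triangular sums are known to converge along odd indices, so the finite splitting is used at
     $2n+1$ and the two theta sums are taken along matching subsequences. *)
  apply (sub _ _ (fun n => (2 * S (S (2 * n)))%nat)) in l1; [|intros; lia].
  apply (sub _ _ (fun n => S (S (2 * n)))) in l2; [|intros; lia].
  refine (lim_seq_ext_eq _ _ _ _ _ l1
    (is_lim_seq_plus' _ _ _ _ l2 (is_lim_seq_mult' _ _ _ _ (is_lim_seq_const (2 * x)) l3))).
  intros n. apply theta_sum_split.
Qed.

(** This is $\theta_4(q)\theta_3(q)=\theta_4(q^2)^2$, an identity of Euler products once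
    [euler (- x)] is eliminated. *)
Lemma phi_mul_phi_opp (x : R) : Rabs x < 1 -> phi x * phi (- x) = phi (x ^ 2) ^ 2.
Proof.
  intros hx. assert (h := euler_opp x hx). unfold phi.
  replace ((- x) ^ 2) with (x ^ 2) by ring. replace ((x ^ 2) ^ 2) with (x ^ 4) by ring.
  assert (h1 := euler_pos x). assert (h2 := euler_pos (x ^ 2)). assert (h4 := euler_pos (x ^ 4)).
  assert (e : euler (- x) = euler (x ^ 2) ^ 3 / (euler x * euler (x ^ 4))).
  { rewrite <- h. field. lra. }
  rewrite e. field. lra.
Qed.

(** At $x=q^2$ it becomes $\theta_2(q)^2=2\theta_2(q^2)\theta_3(q^2)$, the multiplicative half of
    the recurrence. *)
Lemma psi_sqr (x : R) : Rabs x < 1 -> psi x ^ 2 = phi (- x) * psi (x ^ 2).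
Proof.
  intros hx. assert (h := euler_opp x hx). unfold phi, psi.
  replace ((- x) ^ 2) with (x ^ 2) by ring. replace ((x ^ 2) ^ 2) with (x ^ 4) by ring.
  assert (h1 := euler_pos x). assert (h2 := euler_pos (x ^ 2)). assert (h4 := euler_pos (x ^ 4)).
  assert (e : euler (- x) = euler (x ^ 2) ^ 3 / (euler x * euler (x ^ 4))).
  { rewrite <- h. field. lra. }
  rewrite e. field. lra.
Qed.

(** With [phi_mul_phi_opp] it writes the cube of the Euler product at $q^2$ through the three theta
    values at $q$, in the spirit of Jacobi's $\theta_1'=\theta_2\theta_3\theta_4$. *)
Lemma psi_mul_phi_sqr (x : R) : psi x * phi x ^ 2 = euler x ^ 3.
Proof.
  unfold phi, psi. assert (h1 := euler_pos x). assert (h2 := euler_pos (x ^ 2)). field. lra.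
Qed.

(** * Gauss's form of the complete elliptic integral *)

Ltac eqR := match goal with |- ?x = ?y => change (@eq R x y) end.

Lemma ex_RInt_cont (f : R -> R) (a b : R) : (forall x, continuous f x) -> ex_RInt f a b.
Proof. intros h. apply (@ex_RInt_continuous R_CompleteNormedModule). intros; apply h. Qed.

Lemma RInt_comp_R (f g dg : R -> R) (a b : R) :
  (forall x, Rmin a b <= x <= Rmax a b -> continuous f (g x)) ->
  (forall x, Rmin a b <= x <= Rmax a b -> is_derive g x (dg x) /\ continuous dg x) ->
  RInt (fun y => dg y * f (g y)) a b = RInt f (g a) (g b).
Proof. exact (RInt_comp (V := R_CompleteNormedModule) f g dg a b). Qed.

Lemma RInt_scal_R (f : R -> R) (a b l : R) : ex_RInt f a b ->
  RInt (fun x => l * f x) a b = l * RInt f a b.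
Proof. exact (RInt_scal (V := R_CompleteNormedModule) f a b l). Qed.

Lemma RInt_swap_R (f : R -> R) (a b : R) : ex_RInt f a b -> RInt f b a = - RInt f a b.
Proof.
  intros h. rewrite <- (opp_RInt_swap f a b h). reflexivity.
Qed.

Definition quad (a b t : R) : R := a ^ 2 * cos t ^ 2 + b ^ 2 * sin t ^ 2.

Definition gauss_int (a b : R) : R := RInt (fun t => / sqrt (quad a b t)) 0 (PI / 2).

Lemma sin2_pow (t : R) : sin t ^ 2 = 1 - cos t ^ 2.
Proof. generalize (sin2_cos2 t). unfold Rsqr. intros; nra. Qed.

Lemma quad_pos (a b t : R) : 0 < a -> 0 < b -> 0 < quad a b t.
Proof.
  intros ha hb. unfold quad. rewrite sin2_pow.
  assert (h := COS_bound t). assert (0 <= cos t ^ 2 <= 1) by (split; nra).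
  assert (0 < a ^ 2) by (apply pow_lt, ha). assert (0 < b ^ 2) by (apply pow_lt, hb).
  destruct (Rle_or_lt (cos t ^ 2) (1 / 2)); nra.
Qed.

Lemma continuous_gauss (a b t : R) : 0 < a -> 0 < b ->
  continuous (fun t => / sqrt (quad a b t)) t.
Proof.
  intros ha hb. assert (h := quad_pos a b t ha hb).
  apply (@ex_derive_continuous R_AbsRing R_NormedModule).
  unfold quad in *. auto_derive. repeat split.
  - exact h.
  - apply Rgt_not_eq, sqrt_lt_R0, h.
Qed.

Lemma ex_RInt_gauss (a b u v : R) : 0 < a -> 0 < b ->
  ex_RInt (fun t => / sqrt (quad a b t)) u v.
Proof.
  intros ha hb. apply ex_RInt_cont. intros; now apply continuous_gauss.
Qed.

Lemma RInt_reflect (f : R -> R) (a b : R) :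
  (forall x, continuous f x) -> RInt f a b = RInt (fun x => f (a + b - x)) a b.
Proof.
  intros hf.
  rewrite <- (Ropp_involutive (RInt f a b)), <- RInt_swap_R by (apply ex_RInt_cont, hf).
  replace b with (a + b - a) at 1 by ring. replace a with (a + b - b) at 3 by ring.
  rewrite <- (RInt_comp_R f (fun x => a + b - x) (fun _ => -1)).
  - rewrite RInt_scal_R; [eqR; ring|]. apply ex_RInt_cont. intros z.
    apply continuous_comp; [|apply hf].
    apply (@ex_derive_continuous R_AbsRing R_NormedModule). auto_derive. exact I.
  - intros; apply hf.
  - intros x _. split; [auto_derive; [exact I | ring] | apply continuous_const].
Qed.

Lemma gauss_int_sym (a b : R) : 0 < a -> 0 < b -> gauss_int a b = gauss_int b a.
Proof.
  intros ha hb. unfold gauss_int. rewrite RInt_reflect.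
  - apply RInt_ext. intros x _. unfold quad. replace (0 + PI / 2 - x) with (PI / 2 - x) by ring.
    rewrite cos_shift, sin_shift. do 2 f_equal. ring.
  - intros; now apply continuous_gauss.
Qed.

(** Gauss's substitution maps $[0,\pi/2]$ onto $[0,\pi]$; this folds the image back. *)
Lemma gauss_int_half (a b : R) : 0 < a -> 0 < b ->
  RInt (fun t => / sqrt (quad a b t)) 0 PI = 2 * gauss_int a b.
Proof.
  intros ha hb. unfold gauss_int.
  rewrite <- (RInt_Chasles _ 0 (PI / 2) PI) by now apply ex_RInt_gauss.
  replace (RInt (fun t => / sqrt (quad a b t)) (PI / 2) PI)
    with (RInt (fun t => / sqrt (quad a b t)) 0 (PI / 2)).
  { unfold plus; simpl. ring. }
  rewrite <- (Ropp_involutive (RInt _ (PI / 2) PI)), <- RInt_swap_R by now apply ex_RInt_gauss.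
  replace PI with (PI - 0) at 2 by ring. replace (PI / 2) with (PI - PI / 2) at 2 by field.
  rewrite <- (RInt_comp_R _ (fun x => PI - x) (fun _ => -1)).
  - transitivity (- RInt (fun y => -1 * / sqrt (quad a b y)) 0 (PI / 2)).
    + rewrite RInt_scal_R by now apply ex_RInt_gauss. symmetry. eqR. ring.
    + f_equal. apply RInt_ext. intros x _. do 3 f_equal. unfold quad.
      rewrite sin_PI_x, Rtrigo_facts.cos_pi_minus. ring.
  - intros; now apply continuous_gauss.
  - intros x _. split; [auto_derive; [exact I | ring] | apply continuous_const].
Qed.

(* Gauss's substitution: with [g t = arg ((cos t + i sin t)(a cos t + i b sin t))], written without branch cuts. *)
Lemma gauss_int_mean (a b : R) : 0 < a -> 0 < b ->
  gauss_int a b = gauss_int ((a + b) / 2) (sqrt (a * b)).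
Proof.
  intros ha hb.
  assert (hab : 0 < sqrt (a * b)) by (apply sqrt_lt_R0; nra).
  assert (e : 2 * gauss_int a b = 2 * gauss_int ((a + b) / 2) (sqrt (a * b))); [|lra].
  assert (hN : forall t, 0 < a * cos t ^ 2 + b * sin t ^ 2).
  { intros t. assert (h := quad_pos (sqrt a) (sqrt b) t (sqrt_lt_R0 _ ha) (sqrt_lt_R0 _ hb)).
    unfold quad in h. rewrite !pow2_sqrt in h by lra. exact h. }
  (* The argument of $a\cos t+ib\sin t$ is $t$ minus this arctangent; its denominator is positive
     for all $t$, so [g] is smooth. *)
  set (g := fun t => t + t - atan ((a - b) * sin t * cos t / (a * cos t ^ 2 + b * sin t ^ 2))).
  set (dg := fun t => (a * cos t ^ 2 + b * sin t ^ 2) * (a + b) / quad a b t).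
  (* The squared modulus of $(\cos t+i\sin t)(a\cos t-ib\sin t)$, computed from its real and
     imaginary parts. *)
  assert (hsum : forall t, ((a - b) * sin t * cos t) ^ 2 + (a * cos t ^ 2 + b * sin t ^ 2) ^ 2 = quad a b t).
  { intros t. unfold quad. rewrite !Rpow_mult_distr, sin2_pow.
    replace ((a * cos t ^ 2 + b * (1 - cos t ^ 2)) ^ 2) with
     (a ^ 2 * cos t ^ 4 + 2 * a * b * cos t ^ 2 * (1 - cos t ^ 2) + b ^ 2 * (1 - cos t ^ 2) ^ 2) by ring.
    ring. }
  rewrite <- (gauss_int_half ((a + b) / 2)) by lra.
  replace (2 * gauss_int a b) with (RInt (fun t => 2 * / sqrt (quad a b t)) 0 (PI / 2)).
  2:{ rewrite RInt_scal_R by now apply ex_RInt_gauss. reflexivity. }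
  replace 0 with (g 0) at 2.
  2:{ unfold g. rewrite sin_0. replace (_ / _) with 0 by (unfold Rdiv; ring). rewrite atan_0. ring. }
    replace PI with (g (PI / 2)) at 2.
  2:{ unfold g. rewrite cos_PI2, Rmult_0_r, Rdiv_0_l, atan_0. field. }
  rewrite <- (RInt_comp_R _ g dg).
  - apply RInt_ext. intros t _.
    assert (hq := quad_pos a b t ha hb). assert (hn := hN t). assert (hs := hsum t).
    set (N := a * cos t ^ 2 + b * sin t ^ 2) in *.
    (* The real part of $(\cos t+i\sin t)(a\cos t+ib\sin t)$ is $a\cos^2t-b\sin^2t$, and its modulus
       is the square root of [quad a b t]. *)
    assert (ec : cos (g t) ^ 2 = (a * cos t ^ 2 - b * sin t ^ 2) ^ 2 / quad a b t).
    { unfold g. fold N. set (h := (a - b) * sin t * cos t / N).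
      assert (eh : 1 + h ^ 2 = quad a b t / N ^ 2).
      { rewrite <- hs. unfold h. field. lra. }
      assert (hh : 0 < 1 + h ^ 2) by (generalize (pow2_ge_0 h); lra).
      rewrite cos_minus, cos_atan, sin_atan.
      replace (1 + h²) with (1 + h ^ 2) by (unfold Rsqr; ring).
      replace (_ + _) with ((cos (t + t) + h * sin (t + t)) / sqrt (1 + h ^ 2)).
      2:{ field. apply Rgt_not_eq, sqrt_lt_R0, hh. }
      unfold Rdiv at 1. rewrite Rpow_mult_distr, pow_inv, pow2_sqrt by lra.
      rewrite eh.
      replace (cos (t + t) + h * sin (t + t)) with ((a * cos t ^ 2 - b * sin t ^ 2) / N).
      - field. lra.
      - rewrite cos_plus, sin_plus. unfold h. apply (Rmult_eq_reg_r N); [|lra].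
        field_simplify; [|lra|lra]. unfold N.
        replace (a * cos t ^ 2 - b * sin t ^ 2) with
          ((a * cos t ^ 2 - b * sin t ^ 2) * (cos t ^ 2 + sin t ^ 2)) by (rewrite (sin2_pow t); ring).
        ring. }
    (* The new quadratic form is a perfect square along [g], so its square root cancels against [dg]
       and leaves twice the old integrand. *)
    assert (eq : quad ((a + b) / 2) (sqrt (a * b)) (g t) = ((a + b) / 2 * N / sqrt (quad a b t)) ^ 2).
    { unfold quad at 1. rewrite sin2_pow, ec, pow2_sqrt by nra.
      replace (((a + b) / 2 * N / sqrt (quad a b t)) ^ 2)
        with (((a + b) / 2 * N) ^ 2 / sqrt (quad a b t) ^ 2)
        by (field; apply Rgt_not_eq, sqrt_lt_R0, hq).
      rewrite pow2_sqrt by lra.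
      rewrite <- hs. unfold N. field.
      fold N. rewrite hs. lra. }
    rewrite eq, sqrt_pow2.
    + unfold dg. fold N.
      assert (hr := sqrt_lt_R0 _ hq).
      rewrite <- (pow2_sqrt (quad a b t)) at 2 by lra. eqR. field. lra.
    + assert (hr := sqrt_lt_R0 _ hq). apply Rlt_le, Rdiv_lt_0_compat; nra.
  - intros x _. apply continuous_gauss; lra.
  - intros x _. assert (hq := quad_pos a b x ha hb). assert (hn := hN x). assert (hs := hsum x). split.
    + unfold g, dg. auto_derive; [lra|].
      assert (hsc := sin2_pow x). assert (hQ : quad a b x = a ^ 2 * cos x ^ 2 + b ^ 2 * sin x ^ 2) by reflexivity.
      set (s := sin x) in *. set (c := cos x) in *.
      transitivity (2 - (a - b) * ((c ^ 2 - s ^ 2) * (a * c ^ 2 + b * s ^ 2) + 2 * (a - b) * s ^ 2 * c ^ 2)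
        / (((a - b) * s * c) ^ 2 + (a * c ^ 2 + b * s ^ 2) ^ 2)).
      * field. split; [rewrite hs; lra|].
        replace (a * (c * c) + b * (s * s)) with (a * c ^ 2 + b * s ^ 2) by ring. lra.
      * rewrite hs.
        replace ((a * c ^ 2 + b * s ^ 2) * (a + b)) with
          (2 * quad a b x - (a - b) * ((c ^ 2 - s ^ 2) * (a * c ^ 2 + b * s ^ 2) + 2 * (a - b) * s ^ 2 * c ^ 2)).
        -- field. lra.
        -- rewrite hQ, hsc. ring.
    + unfold dg. apply (@ex_derive_continuous R_AbsRing R_NormedModule).
      unfold quad in *. auto_derive. lra.
Qed.

Lemma gauss_int_scal (c a b : R) : 0 < c -> 0 < a -> 0 < b ->
  gauss_int (c * a) (c * b) = gauss_int a b / c.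
Proof.
  intros hc ha hb. unfold gauss_int.
  transitivity (/ c * RInt (fun t => / sqrt (quad a b t)) 0 (PI / 2)); [|unfold Rdiv; ring].
  rewrite <- RInt_scal_R by now apply ex_RInt_gauss.
  apply RInt_ext. intros t _. assert (h := quad_pos a b t ha hb).
  replace (quad (c * a) (c * b) t) with (c ^ 2 * quad a b t) by (unfold quad; ring).
  rewrite sqrt_mult, sqrt_pow2 by (try apply pow2_ge_0; lra).
  apply Rinv_mult.
Qed.

(** The integrand lies between $1/a$ and $1/b$. Along the AGM, where the integral is invariant, this
    alone squeezes the common limit. *)
Lemma gauss_int_bounds (a b : R) : 0 < b -> b <= a ->
  PI / 2 / a <= gauss_int a b <= PI / 2 / b.
Proof.
  intros hb hab. assert (ha : 0 < a) by lra. assert (hpi := PI_RGT_0).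
  assert (hc : forall c, RInt (fun _ => c) 0 (PI / 2) = PI / 2 * c).
  { intros c. rewrite (RInt_const (V := R_CompleteNormedModule)).
    unfold scal; simpl; unfold mult; simpl. ring. }
  assert (hq : forall t, b <= sqrt (quad a b t) <= a).
  { intros t. unfold quad. rewrite sin2_pow. assert (h := COS_bound t).
    assert (0 <= cos t ^ 2 <= 1) by (split; nra).
    assert (b ^ 2 <= a ^ 2) by (apply pow_incr; lra). split.
    - rewrite <- (sqrt_pow2 b) at 1 by lra. apply sqrt_le_1_alt. nra.
    - rewrite <- (sqrt_pow2 a) at 2 by lra. apply sqrt_le_1_alt. nra. }
  split; unfold Rdiv at 1; rewrite <- hc; apply RInt_le; try lra;
    try (apply ex_RInt_const); try (now apply ex_RInt_gauss);
    intros t _; specialize (hq t).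
  - apply Rinv_le_contravar; lra.
  - apply Rinv_le_contravar; lra.
Qed.

Lemma compl_modulus_range (k : R) : 0 < k < 1 -> 0 < compl_modulus k < 1.
Proof.
  intros hk. unfold compl_modulus. split.
  - apply sqrt_lt_R0. nra.
  - rewrite <- sqrt_1 at 2. apply sqrt_lt_1_alt. nra.
Qed.

Lemma compl_modulus_sqr (k : R) : 0 < k < 1 -> compl_modulus k ^ 2 = 1 - k ^ 2.
Proof. intros hk. apply pow2_sqrt. nra. Qed.

Lemma ellK_gauss (k : R) : 0 < k < 1 -> ellK k = gauss_int 1 (compl_modulus k).
Proof.
  intros hk. apply RInt_ext. intros t _. unfold Rdiv. rewrite Rmult_1_l. do 2 f_equal.
  unfold quad. rewrite compl_modulus_sqr by exact hk. rewrite sin2_pow. ring.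
Qed.

Lemma ellK_compl_gauss (k : R) : 0 < k < 1 -> ellK (compl_modulus k) = gauss_int 1 k.
Proof.
  intros hk. apply RInt_ext. intros t _. unfold Rdiv. rewrite Rmult_1_l. do 2 f_equal.
  unfold quad. rewrite compl_modulus_sqr by exact hk. rewrite sin2_pow. ring.
Qed.

Lemma RInt_derive_R (f df : R -> R) (a b : R) :
  (forall x, Rmin a b <= x <= Rmax a b -> is_derive f x (df x)) ->
  (forall x, Rmin a b <= x <= Rmax a b -> continuous df x) ->
  RInt df a b = f b - f a.
Proof.
  intros h1 h2.
  exact (is_RInt_unique (V := R_CompleteNormedModule) _ _ _ _ (is_RInt_derive f df a b h1 h2)).
Qed.

(* The comparison integrand is [d/dt arsinh (sin t / x)]. *)
Lemma gauss_int_log (x : R) : 0 < x <= 1 ->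
  - ln x <= gauss_int 1 x <= - ln x + 3.
Proof.
  intros hx. rewrite gauss_int_sym by lra. assert (hpi := PI_RGT_0).
  set (w := fun t => ln (sin t + sqrt (sin t ^ 2 + x ^ 2))).
  set (dw := fun t => cos t / sqrt (sin t ^ 2 + x ^ 2)).
  assert (hA : forall t, 0 < sin t ^ 2 + x ^ 2) by (intros t; generalize (pow2_ge_0 (sin t)); nra).
  assert (hw : forall t, 0 < sin t + sqrt (sin t ^ 2 + x ^ 2)).
  { intros t. assert (h : Rabs (sin t) < sqrt (sin t ^ 2 + x ^ 2)).
    { rewrite <- (sqrt_pow2 (Rabs (sin t))) by apply Rabs_pos. rewrite pow2_abs.
      apply sqrt_lt_1_alt. split; [apply pow2_ge_0 | nra]. }
    generalize (Rle_abs (- sin t)). rewrite Rabs_Ropp. lra. }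
  assert (cdw : forall t, continuous dw t).
  { intros t. apply (@ex_derive_continuous R_AbsRing R_NormedModule). unfold dw.
    auto_derive. specialize (hA t). repeat split; [exact hA|].
    apply Rgt_not_eq, sqrt_lt_R0, hA. }
  assert (iw : RInt dw 0 (PI / 2) = ln (1 + sqrt (1 + x ^ 2)) - ln x).
  { rewrite (RInt_derive_R w dw).
    - unfold w. rewrite sin_PI2, sin_0. f_equal; f_equal.
      + do 3 f_equal. ring.
      + rewrite Rplus_0_l. replace (0 ^ 2 + x ^ 2) with (x ^ 2) by ring. apply sqrt_pow2. lra.
    - intros t _. unfold w, dw. assert (h1 := hA t). assert (h2 := hw t).
      assert (h3 := sqrt_lt_R0 _ h1).
      auto_derive; [repeat split; first [exact h1 | exact h2]|].
      replace (sin t * (sin t * 1) + x * (x * 1)) with (sin t ^ 2 + x ^ 2) by ring.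
      field. lra.
    - intros; apply cdw. }
  assert (hs : 1 <= sqrt (1 + x ^ 2) <= 2).
  { split.
    - rewrite <- sqrt_1 at 1. apply sqrt_le_1_alt. nra.
    - rewrite <- (sqrt_pow2 2) by lra. apply sqrt_le_1_alt. nra. }
  (* Write $A=\sin^2t+x^2$ and $B$ for the quadratic form. Below, $\cos t\le1$ and $B\le A$. Above,
     $1/\sqrt B$ is split as $(\cos^2t+\sin^2t)/\sqrt B$: the first part is at most $\cos t/\sqrt A$
     because $\cos t\sqrt A\le\sqrt B$, the second at most $\sin t$ because $\sin t\le\sqrt B$. *)
  assert (key : forall t, 0 < t < PI / 2 ->
    dw t <= / sqrt (quad x 1 t) <= dw t + sin t).
  { intros t ht. assert (hc : 0 < cos t) by (apply cos_gt_0; lra).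
    assert (hsn : 0 < sin t) by (apply sin_gt_0; lra).
    assert (hsc := sin2_pow t). assert (hq := quad_pos x 1 t ltac:(lra) ltac:(lra)).
    assert (h1 := hA t). unfold dw. unfold quad in *.
    set (A := sin t ^ 2 + x ^ 2) in *.
    set (B := x ^ 2 * cos t ^ 2 + 1 ^ 2 * sin t ^ 2) in *.
    assert (hAp := sqrt_lt_R0 _ h1). assert (hBp := sqrt_lt_R0 _ hq).
    assert (hc1 : cos t <= 1) by apply COS_bound.
    assert (hBA : sqrt B <= sqrt A).
    { apply sqrt_le_1_alt. unfold A, B. nra. }
    assert (hcA : cos t * sqrt A <= sqrt B).
    { rewrite <- (sqrt_pow2 (cos t)) by lra. rewrite <- sqrt_mult by (try apply pow2_ge_0; lra).
      apply sqrt_le_1_alt. unfold A, B. nra. }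
    assert (hsB : sin t <= sqrt B).
    { rewrite <- (sqrt_pow2 (sin t)) by lra. apply sqrt_le_1_alt. unfold B. nra. }
    split.
    - unfold Rdiv. apply Rle_trans with (1 * / sqrt A).
      + apply Rmult_le_compat_r; [apply Rlt_le, Rinv_0_lt_compat|]; lra.
      + rewrite Rmult_1_l. apply Rinv_le_contravar; lra.
    - replace (/ sqrt B) with (cos t * (cos t / sqrt B) + sin t * (sin t / sqrt B)).
      2:{ transitivity ((sin t ^ 2 + cos t ^ 2) / sqrt B); [field; lra|]. rewrite hsc. field. lra. }
      apply Rplus_le_compat.
      + unfold Rdiv at 2. apply Rmult_le_compat_l; [lra|].
        apply Rle_div_l; [lra|]. apply (Rmult_le_reg_r (sqrt A)); [lra|].
        replace (/ sqrt A * sqrt B * sqrt A) with (sqrt B) by (field; lra). lra.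
      + rewrite <- (Rmult_1_r (sin t)) at 3. apply Rmult_le_compat_l; [lra|].
        apply Rle_div_l; lra. }
  unfold gauss_int. split.
  - apply Rle_trans with (RInt dw 0 (PI / 2)).
    + rewrite iw. generalize (ln_le 1 (1 + sqrt (1 + x ^ 2)) Rlt_0_1 ltac:(lra)). rewrite ln_1. lra.
    + apply RInt_le; [lra | apply ex_RInt_cont, cdw | apply ex_RInt_gauss; lra |].
      intros t ht. apply key, ht.
  - assert (csin : forall t, continuous (fun t => dw t + sin t) t).
    { intros t. apply (continuous_plus dw sin); [apply cdw|].
      apply (@ex_derive_continuous R_AbsRing R_NormedModule). auto_derive. exact I. }
    assert (cs : forall t, continuous sin t).
    { intros t. apply (@ex_derive_continuous R_AbsRing R_NormedModule). auto_derive. exact I. }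
    apply Rle_trans with (RInt (fun t => dw t + sin t) 0 (PI / 2)).
    + apply RInt_le; [lra | apply ex_RInt_gauss; lra | apply ex_RInt_cont, csin |].
      intros t ht. apply key, ht.
    + rewrite (RInt_plus (V := R_CompleteNormedModule) dw sin);
        [|apply ex_RInt_cont, cdw | apply ex_RInt_cont, cs].
      unfold plus; simpl. rewrite iw.
      assert (is : RInt sin 0 (PI / 2) = 1).
      { rewrite (RInt_derive_R (fun t => - cos t) sin).
        - rewrite cos_PI2, cos_0. eqR; ring.
        - intros t _. auto_derive; [exact I | eqR; ring].
        - intros; apply cs. }
      (* The constant 3 is 1 from the integral of the sine plus
         $\ln(1+\sqrt{1+x^2})\le\sqrt{1+x^2}\le2$. *)
      rewrite is.
      generalize (ln_le_sub_1 (1 + sqrt (1 + x ^ 2)) ltac:(lra)). lra.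
Qed.

(** * Theta functions and the arithmetic-geometric mean *)

Ltac positive :=
  first [ lra | apply pow_lt; positive | apply Rdiv_lt_0_compat; positive
        | apply Rmult_lt_0_compat; positive ].

(** The multiplicative form of the bound is stable under addition of pairs; this is how the additive
    recurrence for [A] preserves logarithmic discrepancies. *)
Lemma Rabs_ln_sub_le (x y e : R) : 0 < x -> 0 < y ->
  Rabs (ln x - ln y) <= e <-> (x <= exp e * y /\ y <= exp e * x).
Proof.
  intros hx hy. split.
  - intros h. apply Rabs_le_between in h. split.
    + rewrite <- (exp_ln x) at 1 by lra. rewrite <- (exp_ln y) by lra. rewrite <- exp_plus.
      destruct (Req_dec (ln x) (e + ln y)) as [-> | hn]; [lra|].
      apply Rlt_le, exp_increasing. lra.
    + rewrite <- (exp_ln y) at 1 by lra. rewrite <- (exp_ln x) by lra. rewrite <- exp_plus.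
      destruct (Req_dec (ln y) (e + ln x)) as [-> | hn]; [lra|].
      apply Rlt_le, exp_increasing. lra.
  - intros [h1 h2]. assert (he := exp_pos e).
    apply ln_le in h1; [|lra]. apply ln_le in h2; [|lra].
    rewrite ln_mult, ln_exp in h1, h2 by lra. apply Rabs_le. lra.
Qed.

Lemma ln_sqrt (x : R) : 0 < x -> ln (sqrt x) = ln x / 2.
Proof.
  intros hx. rewrite <- (sqrt_sqrt x) at 2 by lra.
  rewrite ln_mult by (apply sqrt_lt_R0; exact hx). field.
Qed.

(* The logarithmic discrepancy between two solutions of the recurrence never grows when going from
   large to small indices, so it is controlled by the behaviour at infinity. *)
Section Uniqueness.

Variables A C A' C' : nat -> R.
Hypothesis A_pos : forall n, 0 < A n.
Hypothesis C_pos : forall n, 0 < C n.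
Hypothesis A'_pos : forall n, 0 < A' n.
Hypothesis C'_pos : forall n, 0 < C' n.
Hypothesis A_rec : forall n, A n = A (S (S n)) + C (S (S n)).
Hypothesis A'_rec : forall n, A' n = A' (S (S n)) + C' (S (S n)).
Hypothesis C_rec : forall n, C n ^ 2 = 2 * C (S n) * A (S n).
Hypothesis C'_rec : forall n, C' n ^ 2 = 2 * C' (S n) * A' (S n).
Hypothesis A_lim : is_lim_seq A 1.
Hypothesis A'_lim : is_lim_seq A' 1.
Hypothesis C_asymp : is_lim_seq (fun n => (ln (C n) - ln (C' n)) / 2 ^ n) 0.

Let e n := Rabs (ln (A n) - ln (A' n)).
Let f n := Rabs (ln (C n) - ln (C' n)).

(** Up to the common factor $\sqrt2$, [C n] is a geometric mean, and in logarithms a geometric mean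
    averages the discrepancies. *)
Lemma discrepancy_C_step (n : nat) : f n <= (f (S n) + e (S n)) / 2.
Proof.
  unfold e, f.
  assert (h : forall u v w : R, 0 < u -> 0 < v -> 0 < w -> u ^ 2 = 2 * v * w ->
    ln u = (ln 2 + ln v + ln w) / 2).
  { intros u v w hu hv hw h. rewrite <- !ln_mult by nra. rewrite <- h.
    replace (u ^ 2) with (u * u) by ring. rewrite ln_mult by lra. field. }
  rewrite (h _ _ _ (C_pos n) (C_pos (S n)) (A_pos (S n)) (C_rec n)).
  rewrite (h _ _ _ (C'_pos n) (C'_pos (S n)) (A'_pos (S n)) (C'_rec n)).
  replace (_ - _) with (((ln (C (S n)) - ln (C' (S n))) + (ln (A (S n)) - ln (A' (S n)))) / 2) by field.
  unfold Rdiv. rewrite Rabs_mult, (Rabs_pos_eq (/ 2)) by lra.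
  apply Rmult_le_compat_r; [lra|]. apply Rabs_triang.
Qed.

Lemma discrepancy_A_step (n : nat) (c : R) : e (S (S n)) <= c -> f (S (S n)) <= c -> e n <= c.
Proof.
  unfold e, f. rewrite !Rabs_ln_sub_le by auto. rewrite (A_rec n), (A'_rec n). intros; lra.
Qed.

(** After $N$ steps $f_J\le c(1-2^{-N})+f_{J+N}/2^N$. The last term vanishes since the discrepancy
    of [C] is $o(2^n)$, so a bound on [e] alone controls [f]. *)
Lemma discrepancy_C_le (J : nat) (c : R) : (forall i, (J <= i)%nat -> e (S i) <= c) -> f J <= c.
Proof.
  intros h.
  assert (hN : forall N, f J <= c + f (J + N)%nat / 2 ^ N).
  { assert (hc : 0 <= c) by (apply Rle_trans with (e (S J)); [apply Rabs_pos | apply h; lia]).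
    assert (hN : forall N, f J <= c * (1 - / 2 ^ N) + f (J + N)%nat / 2 ^ N).
    { induction N as [|N IH].
      - rewrite Nat.add_0_r. simpl. lra.
      - assert (hp : 0 < / 2 ^ N) by (apply Rinv_0_lt_compat, pow_lt; lra).
        assert (hs := discrepancy_C_step (J + N)). assert (hj := h (J + N)%nat ltac:(lia)).
        replace (J + S N)%nat with (S (J + N)) by lia.
        assert (hs' : f (J + N)%nat / 2 ^ N <= (f (S (J + N)) + c) / 2 / 2 ^ N).
        { apply Rmult_le_compat_r; lra. }
        eapply Rle_trans; [exact IH|]. simpl pow. unfold Rdiv in *. rewrite !Rinv_mult. lra. }
    intros N. eapply Rle_trans; [apply (hN N)|].
    assert (hp : 0 < / 2 ^ N) by (apply Rinv_0_lt_compat, pow_lt; lra). assert (0 <= c * / 2 ^ N) by (apply Rmult_le_pos; lra). lra. }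
  assert (l : is_lim_seq (fun N => c + f (J + N)%nat / 2 ^ N) (c + 2 ^ J * 0)).
  { apply is_lim_seq_plus'; [apply is_lim_seq_const|].
    apply is_lim_seq_ext with (fun N => 2 ^ J * Rabs ((ln (C (N + J)) - ln (C' (N + J))) / 2 ^ (N + J))).
    - intros N. unfold f. rewrite Rabs_div by (apply pow_nonzero; lra).
      rewrite (Rabs_pos_eq (2 ^ (N + J))) by (apply pow_le; lra).
      rewrite pow_add, (Nat.add_comm N J).
      assert (0 < 2 ^ N) by (apply pow_lt; lra). assert (0 < 2 ^ J) by (apply pow_lt; lra).
      field. lra.
    - apply is_lim_seq_mult'; [apply is_lim_seq_const|].
      rewrite <- Rabs_R0.
      apply (is_lim_seq_abs (fun N => (ln (C (N + J)) - ln (C' (N + J))) / 2 ^ (N + J)) 0).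
      apply (is_lim_seq_incr_n (fun N => (ln (C N) - ln (C' N)) / 2 ^ N) J), C_asymp. }
  rewrite Rmult_0_r, Rplus_0_r in l.
  exact (is_lim_seq_le _ _ (Finite (f J)) (Finite c) hN (is_lim_seq_const _) l).
Qed.

(** Descent on [J]: the additive recurrence reaches index $J$ from $J+2$, where [e] is bounded by
    assumption and [f] by the preceding lemma. *)
Lemma discrepancy_le (c : R) (J n : nat) :
  (forall i, (J <= i)%nat -> e i <= c) -> e n <= c /\ f n <= c.
Proof.
  intros h. assert (H : forall i, e i <= c).
  { induction J as [|J IH]; [intros; apply h; lia|].
    apply IH. intros i hi. destruct (Nat.eq_dec i J) as [-> | hn]; [|apply h; lia].
    apply discrepancy_A_step; [apply h; lia|]. apply discrepancy_C_le. intros; apply h; lia. }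
  split; [apply H | apply discrepancy_C_le; intros; apply H].
Qed.

Lemma recurrence_unique (n : nat) : A n = A' n /\ C n = C' n.
Proof.
  (* Both [A] and [A'] tend to 1, so every positive [c] bounds a tail of [e], and by descent all
     discrepancies. *)
  assert (l : is_lim_seq e 0).
  { unfold e. rewrite <- Rabs_R0. apply (is_lim_seq_abs _ 0).
    replace 0 with (ln 1 - ln 1) by ring.
    apply is_lim_seq_minus'; apply is_lim_seq_continuous; try assumption;
      apply derivable_continuous_pt; exists (/ 1); apply derivable_pt_lim_ln; lra. }
  assert (h : forall c, 0 < c -> e n <= c /\ f n <= c).
  { intros c hc. apply is_lim_seq_spec in l. destruct (l (mkposreal c hc)) as [J hJ].
    apply (discrepancy_le c J). intros i hi. specialize (hJ i hi). simpl in hJ.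
    rewrite Rminus_0_r in hJ. apply Rlt_le. eapply Rle_lt_trans; [apply Rle_abs | exact hJ]. }
  assert (he : e n = 0).
  { apply Rle_antisym; [|apply Rabs_pos]. apply le_epsilon. intros c hc.
    rewrite Rplus_0_l. apply h, hc. }
  assert (hf : f n = 0).
  { apply Rle_antisym; [|apply Rabs_pos]. apply le_epsilon. intros c hc.
    rewrite Rplus_0_l. apply h, hc. }
  unfold e, f in he, hf.
  split; apply ln_inv; auto; apply Rminus_diag_uniq; revert he hf; unfold Rabs;
    repeat destruct Rcase_abs; lra.
Qed.

End Uniqueness.

Lemma ln_euler_le (x : R) : Rabs x <= 1 / 2 -> Rabs (ln (euler x)) <= 4 * Rabs x.
Proof.
  intros hx. assert (h0 := Rabs_pos x).
  eapply Rle_trans; [apply ln_euler_bound; lra|].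
  assert (h1 : / (1 - Rabs x) <= 2).
  { rewrite <- (Rinv_inv 2). apply Rinv_le_contravar; lra. }
  assert (h2 : 0 < / (1 - Rabs x)) by (apply Rinv_0_lt_compat; lra).
  unfold Rdiv. rewrite Rmult_assoc, (Rmult_comm 4). apply Rmult_le_compat_l; [lra|]. nra.
Qed.

Lemma ln_phi_psi_le (x : R) : Rabs x <= 1 / 2 ->
  Rabs (ln (phi x)) <= 12 * Rabs x /\ Rabs (ln (psi x)) <= 12 * Rabs x.
Proof.
  intros hx. assert (h0 := Rabs_pos x).
  assert (e : Rabs (x ^ 2) = Rabs x ^ 2) by (symmetry; apply RPow_abs).
  assert (h2 : Rabs (x ^ 2) <= Rabs x) by (rewrite e; nra).
  assert (h3 := ln_euler_le x hx). assert (h4 := ln_euler_le (x ^ 2) ltac:(lra)).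
  assert (p1 := euler_pos x). assert (p2 := euler_pos (x ^ 2)).
  apply Rabs_le_between in h3. apply Rabs_le_between in h4.
  (* The constant is $12=2\cdot4+4$: one Euler product squared and one simple, with
     $|x^2|\le|x|$. *)
  unfold phi, psi. split; rewrite ln_div by (try apply pow_lt; assumption);
    rewrite ln_pow by assumption; simpl INR; apply Rabs_le; lra.
Qed.

Lemma ln_phi_psi_lim (u : nat -> R) : is_lim_seq u 0 ->
  is_lim_seq (fun n => ln (phi (u n))) 0 /\ is_lim_seq (fun n => ln (psi (u n))) 0.
Proof.
  intros hu.
  assert (ha : is_lim_seq (fun n => 12 * Rabs (u n)) 0).
  { replace 0 with (12 * Rabs 0) by (rewrite Rabs_R0; ring).
    apply is_lim_seq_mult'; [apply is_lim_seq_const | apply (is_lim_seq_abs u 0 hu)]. }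
  assert (he : eventually (fun n => Rabs (u n) <= 1 / 2)).
  { apply is_lim_seq_spec in hu. destruct (hu (mkposreal (1 / 2) ltac:(lra))) as [N hN].
    exists N. intros n hn. specialize (hN n hn). simpl in hN. rewrite Rminus_0_r in hN. lra. }
  split; apply is_lim_seq_abs_0.
  - apply (is_lim_seq_le_le_loc (fun _ => 0) _ (fun n => 12 * Rabs (u n)));
      [|apply is_lim_seq_const | exact ha].
    revert he. apply filter_imp. intros n hn. split; [apply Rabs_pos|].
    exact (proj1 (ln_phi_psi_le _ hn)).
  - apply (is_lim_seq_le_le_loc (fun _ => 0) _ (fun n => 12 * Rabs (u n)));
      [|apply is_lim_seq_const | exact ha].
    revert he. apply filter_imp. intros n hn. split; [apply Rabs_pos|].
    exact (proj2 (ln_phi_psi_le _ hn)).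
Qed.

(** * The arithmetic-geometric mean started at $(1,k')$ *)

Fixpoint agm (a b : R) (n : nat) : R * R :=
  match n with
  | O => (a, b)
  | S m => let (x, y) := agm a b m in ((x + y) / 2, sqrt (x * y))
  end.

Section Agm_sequences.

Variable k : R.
Hypothesis hk : 0 < k < 1.

Let k' := compl_modulus k.
Let a n := fst (agm 1 k' n).
Let b n := snd (agm 1 k' n).
(** The initial value $c_0=k$ makes $a_n^2=b_n^2+c_n^2$ hold from $n=0$ on. *)
Let c n := match n with O => k | S m => (a m - b m) / 2 end.
Let K := ellK k.
(** Gauss's value of the arithmetic-geometric mean of 1 and $k'$. *)
Let M := PI / 2 / K.

Lemma agm_a_S n : a (S n) = (a n + b n) / 2.
Proof. unfold a, b. simpl. destruct (agm 1 k' n). reflexivity. Qed.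

Lemma agm_b_S n : b (S n) = sqrt (a n * b n).
Proof. unfold a, b. simpl. destruct (agm 1 k' n). reflexivity. Qed.

Lemma agm_order n : 0 < b n < a n.
Proof.
  assert (hk' := compl_modulus_range k hk).
  induction n as [|n IH]; [unfold a, b; simpl; exact hk'|].
  rewrite agm_a_S, agm_b_S. split.
  - apply sqrt_lt_R0. nra.
  - rewrite <- (sqrt_pow2 ((a n + b n) / 2)) by lra. apply sqrt_lt_1_alt. nra.
Qed.

Lemma agm_c_pos n : 0 < c n.
Proof. destruct n as [|n]; simpl; [lra|]. generalize (agm_order n). lra. Qed.

Lemma agm_sqr n : a n ^ 2 = b n ^ 2 + c n ^ 2.
Proof.
  destruct n as [|n].
  - unfold a, b, c. simpl fst. simpl snd. unfold k'. rewrite compl_modulus_sqr by exact hk. ring.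
  - generalize (agm_order n). intros h. simpl c. rewrite agm_a_S, agm_b_S, pow2_sqrt by nra. field.
Qed.

Lemma agm_a_pred n : a n = a (S n) + c (S n).
Proof. rewrite agm_a_S. simpl. field. Qed.

Lemma agm_b_pred n : b n = a (S n) - c (S n).
Proof. rewrite agm_a_S. simpl. field. Qed.

Lemma agm_c_pred n : c n ^ 2 = 4 * a (S n) * c (S n).
Proof. generalize (agm_sqr n). rewrite agm_a_S. simpl c. intros h. nra. Qed.

Lemma ellK_pos : 0 < K.
Proof.
  unfold K. rewrite ellK_gauss by exact hk.
  assert (hk' := compl_modulus_range k hk).
  eapply Rlt_le_trans; [|apply gauss_int_bounds; lra].
  generalize PI_RGT_0. intros. apply Rdiv_lt_0_compat; lra.
Qed.

Lemma gauss_int_ab n : gauss_int (a n) (b n) = K.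
Proof.
  induction n as [|n IH].
  - unfold K. rewrite ellK_gauss by exact hk. reflexivity.
  - rewrite <- IH, agm_a_S, agm_b_S. generalize (agm_order n). intros h.
    symmetry. apply gauss_int_mean; lra.
Qed.

(** One mean step sends $(a_{n+1},c_{n+1})$ to $(a_n/2,c_n/2)$, since $a_{n+1}+c_{n+1}=a_n$ and
    $4a_{n+1}c_{n+1}=c_n^2$; homogeneity then contributes a factor 2 per index. *)
Lemma gauss_int_ac n : gauss_int (a n) (c n) = 2 ^ n * ellK (compl_modulus k).
Proof.
  induction n as [|n IH].
  - rewrite ellK_compl_gauss by exact hk. simpl. rewrite Rmult_1_l. reflexivity.
  - generalize (agm_order n) (agm_c_pos (S n)) (agm_c_pos n). intros h hc hc'.
    rewrite gauss_int_mean by (rewrite ?agm_a_S; lra).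
    rewrite <- agm_a_pred.
    replace (a (S n) * c (S n)) with ((c n / 2) ^ 2) by (generalize (agm_c_pred n); intros; lra).
    rewrite sqrt_pow2 by lra.
    replace (a n / 2) with (/ 2 * a n) by field. replace (c n / 2) with (/ 2 * c n) by field.
    rewrite gauss_int_scal, IH by lra. simpl. field.
Qed.

Lemma agm_limit_pos : 0 < M.
Proof. generalize PI_RGT_0 ellK_pos. intros. apply Rdiv_lt_0_compat; lra. Qed.

Lemma agm_limit_between n : b n <= M <= a n.
Proof.
  generalize (agm_order n) ellK_pos. intros h hK.
  destruct (gauss_int_bounds (a n) (b n)) as [h1 h2]; [lra|lra|].
  rewrite gauss_int_ab in h1, h2. unfold M. split.
  - apply Rle_div_r; [lra|]. apply Rle_div_r in h2; lra.
  - apply Rle_div_l; [lra|]. apply Rle_div_l in h1; lra.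
Qed.

Lemma agm_gap n : a n - b n <= / 2 ^ n.
Proof.
  induction n as [|n IH].
  - generalize (agm_order 0). unfold a, b. simpl. lra.
  - generalize (agm_order n). intros h.
    assert (hb : b n <= b (S n)).
    { rewrite agm_b_S. rewrite <- (sqrt_pow2 (b n)) at 1 by lra. apply sqrt_le_1_alt. nra. }
    rewrite agm_a_S. simpl pow. rewrite Rinv_mult. lra.
Qed.

Lemma is_lim_seq_inv_pow2 : is_lim_seq (fun n => / 2 ^ n) 0.
Proof.
  apply is_lim_seq_ext with (fun n => (/ 2) ^ n).
  - intros n. apply pow_inv.
  - apply is_lim_seq_geom. rewrite Rabs_pos_eq; lra.
Qed.

Lemma agm_lim : is_lim_seq a M.
Proof.
  apply is_lim_seq_le_le with (fun _ => M) (fun n => M + / 2 ^ n).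
  - intros n. generalize (agm_limit_between n) (agm_gap n). lra.
  - apply is_lim_seq_const.
  - replace (Finite M) with (Finite (M + 0)) by (f_equal; ring).
    apply is_lim_seq_plus'; [apply is_lim_seq_const | apply is_lim_seq_inv_pow2].
Qed.

(** The logarithmic asymptotics at $c_n/a_n$, together with $I(a_n,c_n)=2^nK'$, give $\ln c_n=\ln
    a_n-2^na_nK'+O(1)$; division by $2^n$ removes the bounded error. *)
Lemma agm_ln_c_lim : is_lim_seq (fun n => ln (c n) / 2 ^ n) (- (M * ellK (compl_modulus k))).
Proof.
  set (K' := ellK (compl_modulus k)).
  assert (hb : forall n, ln (a n) - a n * (2 ^ n * K') <= ln (c n) <= ln (a n) - a n * (2 ^ n * K') + 3).
  { intros n. generalize (agm_order n) (agm_c_pos n) (agm_sqr n). intros h hc hs.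
    assert (hca : 0 < c n / a n <= 1).
    { split; [apply Rdiv_lt_0_compat; lra|]. apply Rle_div_l; [lra|]. nra. }
    assert (hl := gauss_int_log _ hca).
    assert (e : gauss_int (a n) (c n) = gauss_int 1 (c n / a n) / a n).
    { rewrite <- gauss_int_scal by lra. f_equal; field; lra. }
    rewrite gauss_int_ac in e. fold K' in e.
    assert (e' : a n * (2 ^ n * K') = gauss_int 1 (c n / a n)) by (rewrite e; field; lra).
    rewrite ln_div in hl by lra. lra. }
  assert (la : is_lim_seq (fun n => ln (a n) * / 2 ^ n - a n * K') (ln M * 0 - M * K')).
  { apply is_lim_seq_minus'.
    - apply is_lim_seq_mult'; [|apply is_lim_seq_inv_pow2].
      apply is_lim_seq_continuous; [|apply agm_lim].
      apply derivable_continuous_pt; exists (/ M); apply derivable_pt_lim_ln, agm_limit_pos.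
    - apply is_lim_seq_mult'; [apply agm_lim | apply is_lim_seq_const]. }
  assert (lb : is_lim_seq (fun n => ln (a n) * / 2 ^ n - a n * K' + 3 * / 2 ^ n)
     (ln M * 0 - M * K' + 3 * 0)).
  { apply is_lim_seq_plus'; [exact la|].
    apply is_lim_seq_mult'; [apply is_lim_seq_const | apply is_lim_seq_inv_pow2]. }
  replace (ln M * 0 - M * K' + 3 * 0) with (- (M * K')) in lb by ring.
  replace (ln M * 0 - M * K') with (- (M * K')) in la by ring.
  refine (is_lim_seq_le_le _ _ _ _ _ la lb).
  intros n. specialize (hb n). assert (hp : 0 < 2 ^ n) by (apply pow_lt; lra).
  assert (hi : 0 < / 2 ^ n) by (apply Rinv_0_lt_compat; lra).
  replace (ln (a n) * / 2 ^ n - a n * K') with ((ln (a n) - a n * (2 ^ n * K')) * / 2 ^ n) by (field; lra).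
  split.
  - apply Rmult_le_compat_r; lra.
  - replace ((ln (a n) - a n * (2 ^ n * K')) * / 2 ^ n + 3 * / 2 ^ n) with
      ((ln (a n) - a n * (2 ^ n * K') + 3) * / 2 ^ n) by ring.
    apply Rmult_le_compat_r; lra.
Qed.

(** Since $2\sqrt{a_{n+2}c_{n+2}}=c_{n+1}$, the square of $\sqrt{a_{n+2}}+\sqrt{c_{n+2}}$ is
    $a_{n+1}+c_{n+1}=a_n$. *)
Lemma sqrt_agm_a_pred n : sqrt (a n / M) = sqrt (a (S (S n)) / M) + sqrt (c (S (S n)) / M).
Proof.
  generalize agm_limit_pos (agm_order (S (S n))) (agm_c_pos (S (S n))) (agm_c_pos (S n)) (agm_order n). intros hM h hc hc1 h0.
  assert (h1 : 0 < a (S (S n)) / M) by (apply Rdiv_lt_0_compat; lra).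
  assert (h2 : 0 < c (S (S n)) / M) by (apply Rdiv_lt_0_compat; lra).
  assert (h3 := sqrt_lt_R0 _ h1). assert (h4 := sqrt_lt_R0 _ h2).
  rewrite <- (sqrt_pow2 (sqrt (a (S (S n)) / M) + sqrt (c (S (S n)) / M))) by lra.
  f_equal.
  replace ((sqrt (a (S (S n)) / M) + sqrt (c (S (S n)) / M)) ^ 2) with
    (sqrt (a (S (S n)) / M) ^ 2 + sqrt (c (S (S n)) / M) ^ 2
     + 2 * (sqrt (a (S (S n)) / M) * sqrt (c (S (S n)) / M))) by ring.
  rewrite !pow2_sqrt, <- sqrt_mult by lra.
  replace (a (S (S n)) / M * (c (S (S n)) / M)) with ((c (S n) / 2 / M) ^ 2).
  - rewrite sqrt_pow2 by (apply Rlt_le, Rdiv_lt_0_compat; [apply Rdiv_lt_0_compat|]; lra).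
    rewrite (agm_a_pred n), (agm_a_pred (S n)). field. lra.
  - generalize (agm_c_pred (S n)). intros e.
    replace ((c (S n) / 2 / M) ^ 2) with (c (S n) ^ 2 / 4 / M ^ 2) by (field; lra).
    rewrite e. field. lra.
Qed.

Lemma sqrt_agm_b_pred n : sqrt (b n / M) = sqrt (a (S (S n)) / M) - sqrt (c (S (S n)) / M).
Proof.
  generalize agm_limit_pos (agm_order (S (S n))) (agm_c_pos (S (S n))) (agm_c_pos (S n)) (agm_sqr (S (S n))).
  intros hM h hc hc1 hs.
  assert (h1 : 0 < a (S (S n)) / M) by (apply Rdiv_lt_0_compat; lra).
  assert (h2 : 0 < c (S (S n)) / M) by (apply Rdiv_lt_0_compat; lra).
  assert (h5 : sqrt (c (S (S n)) / M) <= sqrt (a (S (S n)) / M)).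
  { apply sqrt_le_1_alt. apply Rmult_le_compat_r; [apply Rlt_le, Rinv_0_lt_compat; lra|]. nra. }
  rewrite <- (sqrt_pow2 (sqrt (a (S (S n)) / M) - sqrt (c (S (S n)) / M))) by lra.
  f_equal.
  replace ((sqrt (a (S (S n)) / M) - sqrt (c (S (S n)) / M)) ^ 2) with
    (sqrt (a (S (S n)) / M) ^ 2 + sqrt (c (S (S n)) / M) ^ 2
     - 2 * (sqrt (a (S (S n)) / M) * sqrt (c (S (S n)) / M))) by ring.
  rewrite !pow2_sqrt, <- sqrt_mult by lra.
  replace (a (S (S n)) / M * (c (S (S n)) / M)) with ((c (S n) / 2 / M) ^ 2).
  - rewrite sqrt_pow2 by (apply Rlt_le, Rdiv_lt_0_compat; [apply Rdiv_lt_0_compat|]; lra).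
    rewrite (agm_b_pred n), (agm_a_pred (S n)). field. lra.
  - generalize (agm_c_pred (S n)). intros e.
    replace ((c (S n) / 2 / M) ^ 2) with (c (S n) ^ 2 / 4 / M ^ 2) by (field; lra).
    rewrite e. field. lra.
Qed.

Lemma sqrt_agm_c_pred n : sqrt (c n / M) ^ 2 = 2 * sqrt (c (S n) / M) * sqrt (a (S n) / M).
Proof.
  generalize agm_limit_pos (agm_order (S n)) (agm_c_pos n) (agm_c_pos (S n)). intros hM h hc hc1.
  assert (h0 : 0 < c n / M) by (apply Rdiv_lt_0_compat; lra).
  assert (h1 : 0 < c (S n) / M) by (apply Rdiv_lt_0_compat; lra).
  assert (h2 : 0 < a (S n) / M) by (apply Rdiv_lt_0_compat; lra).
  rewrite pow2_sqrt, Rmult_assoc, <- sqrt_mult by lra.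
  replace (c (S n) / M * (a (S n) / M)) with ((c n / 2 / M) ^ 2).
  - rewrite sqrt_pow2 by (apply Rlt_le, Rdiv_lt_0_compat; [apply Rdiv_lt_0_compat|]; lra). field. lra.
  - generalize (agm_c_pred n). intros e.
    replace ((c n / 2 / M) ^ 2) with (c n ^ 2 / 4 / M ^ 2) by (field; lra).
    rewrite e. field. lra.
Qed.

Let K' := ellK (compl_modulus k).
(** The fourth root of the nome: with it the prefactor of $\theta_2$ and all theta arguments are
    natural powers. *)
Let y := exp (- (PI * (K' / K) / 4)).

Lemma ellK_compl_pos : 0 < K'.
Proof.
  unfold K'. rewrite ellK_compl_gauss by exact hk.
  eapply Rlt_le_trans; [|apply gauss_int_bounds; lra].
  generalize PI_RGT_0. intros. apply Rdiv_lt_0_compat; lra.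
Qed.

Lemma nome_root_range : 0 < y < 1.
Proof.
  split; [apply exp_pos|]. rewrite <- exp_0. apply exp_increasing.
  assert (h : 0 < PI * (K' / K)).
  { apply Rmult_lt_0_compat; [apply PI_RGT_0|]. apply Rdiv_lt_0_compat; [apply ellK_compl_pos | apply ellK_pos]. }
  lra.
Qed.

Let yn n := y ^ (2 ^ n).

Lemma yn_S n : yn (S n) = yn n ^ 2.
Proof. unfold yn. rewrite <- pow_mult. f_equal. simpl. lia. Qed.

Lemma yn_range n : 0 < yn n < 1.
Proof.
  generalize nome_root_range. intros h. unfold yn. split; [apply pow_lt; lra|].
  apply pow_lt_1_compat; [lra|]. generalize (Nat.pow_nonzero 2 n). lia.
Qed.

Lemma Rabs_yn_pow n m : (0 < m)%nat -> Rabs (yn n ^ m) < 1.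
Proof.
  intros hm. apply Rabs_pow_pos_lt_1; [exact hm|]. generalize (yn_range n). intros.
  rewrite Rabs_pos_eq; lra.
Qed.

Lemma yn_pow_lim m : (0 < m)%nat -> is_lim_seq (fun n => yn n ^ m) 0.
Proof.
  intros hm.
  assert (l : is_lim_seq yn 0).
  { unfold yn. generalize nome_root_range. intros h.
    apply (is_lim_seq_subseq (fun n => y ^ n) 0 (fun n => (2 ^ n)%nat)).
    - apply eventually_subseq. intros n. simpl. generalize (Nat.pow_nonzero 2 n). lia.
    - apply is_lim_seq_geom. rewrite Rabs_pos_eq; lra. }
  refine (is_lim_seq_le_le (fun _ => 0) _ _ 0 _ (is_lim_seq_const 0) l).
  intros n. generalize (yn_range n). intros h. split; [apply pow_le; lra|].
  destruct m as [|m]; [lia|]. simpl. rewrite <- (Rmult_1_r (yn n)) at 3.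
  apply Rmult_le_compat_l; [lra|]. rewrite <- (pow1 m). apply pow_incr. lra.
Qed.

Lemma theta_agm n : phi (- yn n ^ 4) = sqrt (a n / M) /\ 2 * yn n * psi (yn n ^ 8) = sqrt (c n / M).
Proof.
  apply (recurrence_unique (fun n => phi (- yn n ^ 4)) (fun n => 2 * yn n * psi (yn n ^ 8))
    (fun n => sqrt (a n / M)) (fun n => sqrt (c n / M))); clear n.
  - intros n. apply phi_pos.
  - intros n. cbv beta. generalize (yn_range n) (psi_pos (yn n ^ 8)). intros h hp.
    apply Rmult_lt_0_compat; lra.
  - intros n. cbv beta. generalize (agm_order n) agm_limit_pos. intros h hM. apply sqrt_lt_R0, Rdiv_lt_0_compat; [lra | exact hM].
  - intros n. cbv beta. generalize (agm_c_pos n) agm_limit_pos. intros h hM. apply sqrt_lt_R0, Rdiv_lt_0_compat; assumption.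
  - intros n. rewrite (phi_split (yn n ^ 4)) by (apply Rabs_yn_pow; lia).
    rewrite !yn_S. rewrite <- !pow_mult. simpl Nat.mul. reflexivity.
  - intros n. apply sqrt_agm_a_pred.
  - intros n. rewrite yn_S.
    replace ((2 * yn n * psi (yn n ^ 8)) ^ 2) with (4 * yn n ^ 2 * psi (yn n ^ 8) ^ 2) by ring.
    rewrite psi_sqr by (apply Rabs_yn_pow; lia).
    rewrite <- !pow_mult. simpl Nat.mul. ring.
  - intros n. apply sqrt_agm_c_pred.
  - apply is_lim_seq_ext with (fun n => exp (ln (phi (- yn n ^ 4)))).
    + intros n. apply exp_ln, phi_pos.
    + rewrite <- exp_0. apply (is_lim_seq_continuous exp).
      * apply derivable_continuous_pt, derivable_pt_exp.
      * apply (fun h => proj1 (ln_phi_psi_lim (fun n => - yn n ^ 4) h)). rewrite <- Ropp_0.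
        apply (is_lim_seq_opp _ 0), yn_pow_lim. lia.
  - replace 1 with (sqrt (M / M)).
    2:{ generalize agm_limit_pos. intros. rewrite <- sqrt_1. f_equal. field. lra. }
    apply (is_lim_seq_continuous sqrt).
    + apply continuity_pt_sqrt. generalize agm_limit_pos. intros. apply Rlt_le, Rdiv_lt_0_compat; lra.
    + apply is_lim_seq_div'; [apply agm_lim | apply is_lim_seq_const | generalize agm_limit_pos; lra].
  (* The nome is identified here. One side is $2^n\ln y+O(1)$, the other $\frac12\ln c_n+O(1)$, and
     the leading coefficients agree because $\ln y=-MK'/2$. *)
  - assert (l := ln_phi_psi_lim _ (yn_pow_lim 8 ltac:(lia))). destruct l as [_ l].
    assert (l1 : is_lim_seq (fun n => (ln 2 + ln (psi (yn n ^ 8)) + / 2 * ln M) * / 2 ^ n + ln y - / 2 * (ln (c n) / 2 ^ n))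
      ((ln 2 + 0 + / 2 * ln M) * 0 + ln y - / 2 * (- (M * K')))).
    { apply is_lim_seq_minus'; [apply is_lim_seq_plus'; [apply is_lim_seq_mult'; [apply is_lim_seq_plus'; [apply is_lim_seq_plus'|]|]|]|].
      - apply is_lim_seq_const.
      - exact l.
      - apply is_lim_seq_const.
      - apply is_lim_seq_inv_pow2.
      - apply is_lim_seq_const.
      - apply is_lim_seq_mult'; [apply is_lim_seq_const | apply agm_ln_c_lim]. }
    replace ((ln 2 + 0 + / 2 * ln M) * 0 + ln y - / 2 * (- (M * K'))) with 0 in l1.
    2:{ unfold y, M. rewrite ln_exp. field. generalize ellK_pos. lra. }
    refine (is_lim_seq_ext _ _ _ _ l1). intros n.
    generalize (yn_range n) (psi_pos (yn n ^ 8)) (agm_c_pos n) agm_limit_pos nome_root_range. intros hy hp hc hM hy0.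
    rewrite !ln_mult by lra. rewrite ln_sqrt by (apply Rdiv_lt_0_compat; lra).
    rewrite ln_div by lra.
    replace (ln (yn n)) with (2 ^ n * ln y).
    2:{ unfold yn. rewrite ln_pow, pow_INR by lra. reflexivity. }
    field. apply pow_nonzero. lra.
Qed.

Lemma theta_values :
  phi (- y ^ 4) = sqrt (2 * K / PI) /\ phi (y ^ 4) = sqrt (2 * K * k' / PI) /\
  2 * y * psi (y ^ 8) = sqrt (2 * K * k / PI).
Proof.
  generalize ellK_pos PI_RGT_0. intros hK hpi.
  assert (e0 : yn 0 = y) by (unfold yn; simpl; ring).
  assert (e2 : yn 2 = y ^ 4) by (unfold yn; reflexivity).
  destruct (theta_agm 0) as [h1 h2]. destruct (theta_agm 2) as [h3 h4].
  rewrite e0 in h1, h2. rewrite e2 in h3, h4. split; [|split].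
  - rewrite h1. f_equal. unfold a, M. simpl. field. lra.
  (* $\theta_4(q)=\theta_3(q^4)-\theta_2(q^4)$ is [phi_split] at a negative argument, and
     $\sqrt{b_0/M}$ is the same difference of quantities already matched at index 2. *)
  - replace (2 * K * k' / PI) with (b 0 / M) by (unfold b, M; simpl; field; lra).
    rewrite sqrt_agm_b_pred, <- h3, <- h4.
    assert (hy : Rabs (- y ^ 4) < 1).
    { rewrite Rabs_Ropp, <- e0. apply Rabs_yn_pow. lia. }
    assert (hs := phi_split (- y ^ 4) hy). rewrite Ropp_involutive in hs.
    replace ((- y ^ 4) ^ 4) with ((y ^ 4) ^ 4) in hs by ring.
    replace ((- y ^ 4) ^ 8) with ((y ^ 4) ^ 8) in hs by ring.
    rewrite hs. ring.
  - rewrite h2. f_equal. unfold c, M. field. lra.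
Qed.

End Agm_sequences.

(* The nome of [k] is [exp (- PI * al)]. *)
Lemma euler_nome (k : R) : 0 < k < 1 ->
  let K := ellK k in let k' := compl_modulus k in
  let al := ellK k' / K in
  6 * ln (euler (exp (- 2 * PI * al))) = ln (2 * k * k' * K ^ 3 / PI ^ 3) + PI * al / 2 /\
  6 * (ln (euler (exp (- PI * al))) - ln (euler (exp (- 2 * PI * al))))
    = ln (2 * k' / sqrt k) - PI * al / 4.
Proof.
  intros hk K k' al.
  assert (hK : 0 < K) by (apply ellK_pos; exact hk).
  assert (hk' : 0 < k' < 1) by (apply compl_modulus_range; exact hk).
  assert (hpi := PI_RGT_0).
  destruct (theta_values k hk) as [h3 [h4 h2]].
  assert (hy := nome_root_range k hk).
  fold K k' in h2, h3, h4, hy. fold al in h2, h3, h4, hy.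
  set (y := exp (- (PI * al / 4))) in *.
  assert (ly : ln y = - (PI * al / 4)) by apply ln_exp.
  assert (e4 : exp (- PI * al) = y ^ 4).
  { rewrite <- (exp_ln (y ^ 4)) by (apply pow_lt; lra). rewrite ln_pow, ly by lra. f_equal. simpl. field. }
  assert (e8 : exp (- 2 * PI * al) = y ^ 8).
  { rewrite <- (exp_ln (y ^ 8)) by (apply pow_lt; lra). rewrite ln_pow, ly by lra. f_equal. simpl. field. }
  rewrite e4, e8.
  assert (hy4 : Rabs (y ^ 4) < 1).
  { apply Rabs_pow_pos_lt_1; [lia|]. rewrite Rabs_pos_eq; lra. }
  (* Combined, these give $\psi(q^2)\,\phi(q)\,\phi(-q)=G^3$, a product of known theta values. *)
  assert (hm := phi_mul_phi_opp _ hy4). assert (hp := psi_mul_phi_sqr (y ^ 8)).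
  replace ((y ^ 4) ^ 2) with (y ^ 8) in hm by ring.
  rewrite <- hm in hp.
  assert (ep4 := euler_pos (y ^ 4)). assert (ep8 := euler_pos (y ^ 8)).
  assert (hd : phi (y ^ 4) = euler (y ^ 4) ^ 2 / euler (y ^ 8)).
  { unfold phi. do 2 f_equal. ring. }
  assert (p1 := phi_pos (y ^ 4)). assert (p2 := phi_pos (- y ^ 4)). assert (p3 := psi_pos (y ^ 8)).
  set (P4 := phi (y ^ 4)) in *. set (Pm := phi (- y ^ 4)) in *. set (S8 := psi (y ^ 8)) in *.
  set (E4 := euler (y ^ 4)) in *. set (E8 := euler (y ^ 8)) in *.
  clearbody P4 Pm S8 E4 E8 y K k' al.
  (* In logarithms all five relations are linear, and both claims are linear combinations of
     them. *)
  apply (f_equal ln) in h2, h3, h4, hp, hd.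
  rewrite ln_sqrt in h2, h3, h4 by positive.
  rewrite ln_div in h2, h3, h4 by positive.
  rewrite ln_div in hd by positive.
  rewrite !ln_mult in h2 by positive. rewrite !ln_mult in h3 by positive. rewrite !ln_mult in h4 by positive.
  rewrite !ln_mult in hp by positive.
  rewrite ln_pow in hp, hd by lra. simpl INR in hp, hd.
  assert (hsk := sqrt_lt_R0 k ltac:(lra)).
  rewrite !ln_div by positive.
  rewrite !ln_mult by positive.
  rewrite !ln_pow, ln_sqrt by lra.
  simpl INR. split; lra.
Qed.

(** * The sine of a logarithm in the half disc *)

Section Log_coordinates.

Variable al : R.
Hypothesis al_pos : 0 < al.

(* [log_re r t + i log_im r t] is the logarithm of [1 + r e^(it)]. *)
Definition log_re (r t : R) : R := ln (1 + 2 * r * cos t + r ^ 2) / 2.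
Definition log_im (r t : R) : R := atan (r * sin t / (1 + r * cos t)).

(* [gap] is [2 |sin (log (1 + r e^(it)) / (2 al))|^2]; [sin_arg] is twice the argument of that sine,
   normalised by continuity in the upper half disc. *)
Definition gap (r t : R) : R := cosh (log_im r t / al) - cos (log_re r t / al).
Definition sin_arg (r t : R) : R :=
  - (log_re r t / al)
  - 2 * atan (sin (log_re r t / al) / (exp (log_im r t / al) - cos (log_re r t / al))).
Definition ln_gap_dr (r t : R) : R :=
  (sinh (log_im r t / al) * sin t + sin (log_re r t / al) * (cos t + r))
  / (al * (1 + 2 * r * cos t + r ^ 2) * gap r t).

Lemma dist2_pos (r t : R) : 0 < 1 + r * cos t -> 0 < 1 + 2 * r * cos t + r ^ 2.
Proof.
  intros h. replace (1 + 2 * r * cos t + r ^ 2)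
    with ((1 + r * cos t) ^ 2 + (r * sin t) ^ 2).
  - generalize (pow2_ge_0 (r * sin t)). nra.
  - rewrite Rpow_mult_distr, sin2_pow. ring.
Qed.

Lemma dist2_eq (r t : R) : 1 + 2 * r * cos t + r ^ 2 = (1 + r * cos t) ^ 2 + (r * sin t) ^ 2.
Proof. rewrite (Rpow_mult_distr r (sin t)), sin2_pow. ring. Qed.

Lemma is_derive_log_re_r (r t : R) : 0 < 1 + r * cos t ->
  is_derive (fun r => log_re r t) r ((cos t + r) / (1 + 2 * r * cos t + r ^ 2)).
Proof.
  intros h. assert (hD := dist2_pos r t h). unfold log_re. auto_derive.
  - replace (1 + 2 * r * cos t + r * (r * 1)) with (1 + 2 * r * cos t + r ^ 2) by ring. exact hD.
  - eqR. field. repeat split; lra.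
Qed.

Lemma is_derive_log_re_t (r t : R) : 0 < 1 + r * cos t ->
  is_derive (fun t => log_re r t) t (- (r * sin t) / (1 + 2 * r * cos t + r ^ 2)).
Proof.
  intros h. assert (hD := dist2_pos r t h). unfold log_re. auto_derive.
  - replace (1 + 2 * r * cos t + r * (r * 1)) with (1 + 2 * r * cos t + r ^ 2) by ring. exact hD.
  - eqR. field. repeat split; lra.
Qed.

Lemma is_derive_log_im_r (r t : R) : 0 < 1 + r * cos t ->
  is_derive (fun r => log_im r t) r (sin t / (1 + 2 * r * cos t + r ^ 2)).
Proof.
  intros h. assert (hD := dist2_pos r t h). rewrite dist2_eq in *. unfold log_im. auto_derive.
  - lra.
  - eqR. field. repeat split; lra.
Qed.

Lemma is_derive_log_im_t (r t : R) : 0 < 1 + r * cos t ->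
  is_derive (fun t => log_im r t) t (r * (cos t + r) / (1 + 2 * r * cos t + r ^ 2)).
Proof.
  intros h. assert (hD := dist2_pos r t h).
  replace (r * (cos t + r)) with (r * (cos t + r * (cos t ^ 2 + sin t ^ 2)))
    by (rewrite sin2_pow; ring).
  rewrite dist2_eq in *. unfold log_im. auto_derive.
  - lra.
  - eqR. field. repeat split; lra.
Qed.

Lemma is_derive_cosh (x : R) : is_derive cosh x (sinh x).
Proof. apply is_derive_Reals, derivable_pt_lim_cosh. Qed.

Lemma is_derive_ln_gap_r (r t : R) : 0 < 1 + r * cos t -> 0 < gap r t ->
  is_derive (fun r => ln (gap r t)) r (ln_gap_dr r t).
Proof.
  intros h hg. assert (hD := dist2_pos r t h).
  assert (h1 := is_derive_log_re_r r t h). assert (h2 := is_derive_log_im_r r t h).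
  assert (hc : is_derive (fun r => cosh (log_im r t / al)) r
    (sinh (log_im r t / al) * (sin t / (1 + 2 * r * cos t + r ^ 2) / al))).
  { rewrite Rmult_comm. apply (is_derive_comp cosh (fun r => log_im r t / al)).
    - apply is_derive_cosh.
    - apply (is_derive_ext (fun r => / al * log_im r t)); [intros; eqR; unfold Rdiv; ring|].
      replace (sin t / (1 + 2 * r * cos t + r ^ 2) / al)
        with (/ al * (sin t / (1 + 2 * r * cos t + r ^ 2))) by (unfold Rdiv; ring).
      apply (is_derive_scal (fun r => log_im r t) r (/ al)), h2. }
  assert (hco : is_derive (fun r => cos (log_re r t / al)) r
    (- sin (log_re r t / al) * ((cos t + r) / (1 + 2 * r * cos t + r ^ 2) / al))).
  { rewrite Rmult_comm. apply (is_derive_comp cos (fun r => log_re r t / al)).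
    - apply is_derive_cos.
    - apply (is_derive_ext (fun r => / al * log_re r t)); [intros; eqR; unfold Rdiv; ring|].
      replace ((cos t + r) / (1 + 2 * r * cos t + r ^ 2) / al)
        with (/ al * ((cos t + r) / (1 + 2 * r * cos t + r ^ 2))) by (unfold Rdiv; ring).
      apply (is_derive_scal (fun r => log_re r t) r (/ al)), h1. }
  assert (hgd := is_derive_minus _ _ _ _ _ hc hco).
  assert (hl := is_derive_comp ln (fun r => gap r t) r (/ gap r t) _ (is_derive_ln _ hg) hgd).
  eapply is_derive_ext_loc; [apply filter_forall; reflexivity|].
  replace (ln_gap_dr r t) with (scal (minus (sinh (log_im r t / al) * (sin t / (1 + 2 * r * cos t + r ^ 2) / al))
    (- sin (log_re r t / al) * ((cos t + r) / (1 + 2 * r * cos t + r ^ 2) / al))) (/ gap r t)).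
  - exact hl.
  - unfold scal, minus, plus, opp; simpl; unfold mult; simpl. unfold ln_gap_dr. field. lra.
Qed.

(* The Cauchy-Riemann equation in polar coordinates. *)
Lemma is_derive_sin_arg_t (r t : R) : 0 < 1 + r * cos t -> 0 <= log_im r t -> 0 < gap r t ->
  is_derive (fun t => sin_arg r t) t (r * ln_gap_dr r t).
Proof.
  intros h hi hg. assert (hD := dist2_pos r t h).
  assert (h1 := is_derive_log_re_t r t h). assert (h2 := is_derive_log_im_t r t h).
  (* With $w=\log(1+re^{it})/\alpha$ one has $2i\sin(w/2)=-e^{-iw/2}(1-e^{iw})$. The quantity shown
     positive is the real part of $1-e^{iw}$ times $e^{\mathrm{Im}\,w}$, so the principal arctangent
     follows the argument of that factor without jumps. *)
  assert (he : 0 < exp (log_im r t / al) - cos (log_re r t / al)).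
  { assert (0 <= log_im r t / al) by (apply Rle_mult_inv_pos; lra).
    destruct (Req_dec (log_im r t / al) 0) as [e | hn].
    - unfold gap in hg. rewrite e in hg |- *. rewrite cosh_0 in hg. rewrite exp_0. exact hg.
    - assert (exp 0 < exp (log_im r t / al)) by (apply exp_increasing; lra).
      rewrite exp_0 in *. generalize (COS_bound (log_re r t / al)). lra. }
  (* Here [f] and [g] stand for the imaginary and real parts of $w$; the trigonometric algebra is
     done before polar coordinates enter. *)
  assert (hgen : forall f g : R -> R, forall df dg : R, is_derive f t df -> is_derive g t dg ->
    0 < exp (f t) - cos (g t) -> 0 < cosh (f t) - cos (g t) ->
    is_derive (fun t => - g t - 2 * atan (sin (g t) / (exp (f t) - cos (g t)))) t
      ((- sinh (f t) * dg + sin (g t) * df) / (cosh (f t) - cos (g t)))).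
  { intros f g df dg hf hdg hp hq.
    assert (hf' : ex_derive f t) by (eexists; exact hf).
    assert (hg' : ex_derive g t) by (eexists; exact hdg).
    assert (ef : Derive (fun x => f x) t = df) by (apply is_derive_unique, hf).
    assert (eg : Derive (fun x => g x) t = dg) by (apply is_derive_unique, hdg).
    auto_derive; [repeat split; try assumption; lra|].
    rewrite ef, eg. unfold cosh, sinh in *. rewrite exp_Ropp in *.
    assert (hx := exp_pos (f t)). set (X := exp (f t)) in *.
    assert (hs := sin2_pow (g t)). set (s := sin (g t)) in *. set (c := cos (g t)) in *.
    assert (hq' : 0 < X ^ 2 + 1 - 2 * X * c).
    { replace (X ^ 2 + 1 - 2 * X * c) with (2 * X * ((X + / X) / 2 - c)) by (field; lra).
      repeat apply Rmult_lt_0_compat; lra. }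
    assert (hr : (X - c) ^ 2 + s ^ 2 = X ^ 2 + 1 - 2 * X * c) by (rewrite hs; ring).
    eqR.
    transitivity (- dg - 2 * ((c * dg * (X - c) - s * (X * df + s * dg)) / ((X - c) ^ 2 + s ^ 2))).
    - field. split; [rewrite hr|]; lra.
    - rewrite hr.
      replace (c * dg * (X - c) - s * (X * df + s * dg)) with (dg * (c * X - c ^ 2 - s ^ 2) - s * X * df) by ring.
      rewrite hs. field. repeat split; lra. }
  assert (hA : is_derive (fun t => log_im r t / al) t (/ al * (r * (cos t + r) / (1 + 2 * r * cos t + r ^ 2)))).
  { apply (is_derive_ext (fun t => / al * log_im r t)); [intros; eqR; unfold Rdiv; ring|].
    apply (is_derive_scal (fun t => log_im r t) t (/ al)), h2. }
  assert (hB : is_derive (fun t => log_re r t / al) t (/ al * (- (r * sin t) / (1 + 2 * r * cos t + r ^ 2)))).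
  { apply (is_derive_ext (fun t => / al * log_re r t)); [intros; eqR; unfold Rdiv; ring|].
    apply (is_derive_scal (fun t => log_re r t) t (/ al)), h1. }
  assert (hf := hgen _ _ _ _ hA hB he hg).
  unfold sin_arg.
  replace (r * ln_gap_dr r t) with
    ((- sinh (log_im r t / al) * (/ al * (- (r * sin t) / (1 + 2 * r * cos t + r ^ 2)))
      + sin (log_re r t / al) * (/ al * (r * (cos t + r) / (1 + 2 * r * cos t + r ^ 2))))
     / (cosh (log_im r t / al) - cos (log_re r t / al))); [exact hf|].
  unfold ln_gap_dr. unfold gap in *. field. lra.
Qed.

Lemma continuity_2d_comp (f : R -> R) (g : R -> R -> R) (x y : R) :
  continuity_2d_pt g x y -> ex_derive f (g x y) -> continuity_2d_pt (fun u v => f (g u v)) x y.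
Proof.
  intros hg hf. apply continuity_1d_2d_pt_comp; [|exact hg].
  apply continuity_pt_filterlim. apply (@ex_derive_continuous R_AbsRing R_NormedModule), hf.
Qed.

Lemma continuity_2d_log_re (r t : R) : 0 < 1 + r * cos t -> continuity_2d_pt log_re r t.
Proof.
  intros h. assert (hD := dist2_pos r t h). unfold log_re.
  apply (continuity_2d_comp (fun x => ln x / 2) (fun r t => 1 + 2 * r * cos t + r ^ 2)).
  - apply continuity_2d_pt_plus; [apply continuity_2d_pt_plus; [apply continuity_2d_pt_const|]|].
    + apply continuity_2d_pt_mult; [apply continuity_2d_pt_mult|].
      * apply continuity_2d_pt_const.
      * apply continuity_2d_pt_id1.
      * apply (continuity_2d_comp cos (fun _ t => t)); [apply continuity_2d_pt_id2 | auto_derive; exact I].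
    + apply (continuity_2d_comp (fun x => x ^ 2) (fun r _ => r)); [apply continuity_2d_pt_id1 | auto_derive; exact I].
  - auto_derive. exact hD.
Qed.

Lemma continuity_2d_log_im (r t : R) : 0 < 1 + r * cos t -> continuity_2d_pt log_im r t.
Proof.
  intros h. unfold log_im.
  apply (continuity_2d_comp atan (fun r t => r * sin t / (1 + r * cos t))); [|auto_derive; exact I].
  apply continuity_2d_pt_mult.
  - apply continuity_2d_pt_mult; [apply continuity_2d_pt_id1|].
    apply (continuity_2d_comp sin (fun _ t => t)); [apply continuity_2d_pt_id2 | auto_derive; exact I].
  - apply continuity_2d_pt_inv; [|lra].
    apply continuity_2d_pt_plus; [apply continuity_2d_pt_const|].
    apply continuity_2d_pt_mult; [apply continuity_2d_pt_id1|].
    apply (continuity_2d_comp cos (fun _ t => t)); [apply continuity_2d_pt_id2 | auto_derive; exact I].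
Qed.

Lemma ex_derive_cosh (x : R) : ex_derive cosh x.
Proof. eexists. apply is_derive_cosh. Qed.

Lemma ex_derive_sinh (x : R) : ex_derive sinh x.
Proof. eexists. apply is_derive_Reals, derivable_pt_lim_sinh. Qed.

Lemma continuity_2d_log_re_al (r t : R) : 0 < 1 + r * cos t ->
  continuity_2d_pt (fun r t => log_re r t / al) r t.
Proof.
  intros h. apply continuity_2d_pt_mult; [apply continuity_2d_log_re, h | apply continuity_2d_pt_const].
Qed.

Lemma continuity_2d_log_im_al (r t : R) : 0 < 1 + r * cos t ->
  continuity_2d_pt (fun r t => log_im r t / al) r t.
Proof.
  intros h. apply continuity_2d_pt_mult; [apply continuity_2d_log_im, h | apply continuity_2d_pt_const].
Qed.

Lemma continuity_2d_gap (r t : R) : 0 < 1 + r * cos t -> continuity_2d_pt gap r t.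
Proof.
  intros h. unfold gap. apply continuity_2d_pt_minus.
  - apply (continuity_2d_comp cosh (fun r t => log_im r t / al)); [|apply ex_derive_cosh].
    apply continuity_2d_log_im_al, h.
  - apply (continuity_2d_comp cos (fun r t => log_re r t / al)); [|auto_derive; exact I].
    apply continuity_2d_log_re_al, h.
Qed.

Lemma continuity_2d_ln_gap (r t : R) : 0 < 1 + r * cos t -> 0 < gap r t ->
  continuity_2d_pt (fun r t => ln (gap r t)) r t.
Proof.
  intros h hg. apply (continuity_2d_comp ln gap); [apply continuity_2d_gap, h | auto_derive; exact hg].
Qed.

(** Joint continuity is the condition for differentiating the circle mean under the integral
    sign. *)
Lemma continuity_2d_ln_gap_dr (r t : R) : 0 < 1 + r * cos t -> 0 < gap r t ->
  continuity_2d_pt ln_gap_dr r t.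
Proof.
  intros h hg. assert (hD := dist2_pos r t h). unfold ln_gap_dr.
  assert (hs : continuity_2d_pt (fun _ t => sin t) r t).
  { apply (continuity_2d_comp sin (fun _ t => t)); [apply continuity_2d_pt_id2 | auto_derive; exact I]. }
  assert (hc : continuity_2d_pt (fun _ t => cos t) r t).
  { apply (continuity_2d_comp cos (fun _ t => t)); [apply continuity_2d_pt_id2 | auto_derive; exact I]. }
  apply continuity_2d_pt_mult; [apply continuity_2d_pt_plus|].
  - apply continuity_2d_pt_mult; [|exact hs].
    apply (continuity_2d_comp sinh (fun r t => log_im r t / al)); [|apply ex_derive_sinh].
    apply continuity_2d_log_im_al, h.
  - apply continuity_2d_pt_mult.
    + apply (continuity_2d_comp sin (fun r t => log_re r t / al)); [|auto_derive; exact I].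
      apply continuity_2d_log_re_al, h.
    + apply continuity_2d_pt_plus; [exact hc | apply continuity_2d_pt_id1].
  - apply continuity_2d_pt_inv.
    + apply continuity_2d_pt_mult; [apply continuity_2d_pt_mult|apply continuity_2d_gap, h].
      * apply continuity_2d_pt_const.
      * apply continuity_2d_pt_plus; [apply continuity_2d_pt_plus; [apply continuity_2d_pt_const|]|].
        -- apply continuity_2d_pt_mult; [|exact hc].
           apply continuity_2d_pt_mult; [apply continuity_2d_pt_const | apply continuity_2d_pt_id1].
        -- apply (continuity_2d_comp (fun x => x ^ 2) (fun r _ => r)); [apply continuity_2d_pt_id1 | auto_derive; exact I].
    + apply Rgt_not_eq. repeat apply Rmult_lt_0_compat; assumption.
Qed.

Lemma continuity_2d_section (f : R -> R -> R) (x y : R) :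
  continuity_2d_pt f x y -> continuous (f x) y.
Proof.
  intros h. apply continuity_2d_pt_filterlim in h.
  intros P hP. specialize (h P hP). destruct h as [d hd]. exists d. intros z hz.
  apply (hd (x, z)). split; [apply ball_center | exact hz].
Qed.

End Log_coordinates.

(** * Circle means between two zeros *)

Lemma cosh_ge_1 (x : R) : 1 <= cosh x.
Proof.
  unfold cosh. rewrite exp_Ropp. assert (h := exp_pos x). set (X := exp x) in *.
  apply (Rmult_le_reg_r (2 * X)); [lra|].
  replace ((X + / X) / 2 * (2 * X)) with (X ^ 2 + 1) by (field; lra).
  generalize (pow2_ge_0 (X - 1)). lra.
Qed.

Lemma cosh_le_exp (x : R) : 0 <= x -> cosh x <= exp x.
Proof.
  intros hx. unfold cosh. assert (exp (- x) <= exp x); [|lra].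
  destruct (Req_dec x 0) as [-> | hn]; [rewrite Ropp_0; lra|].
  apply Rlt_le, exp_increasing. lra.
Qed.

Lemma sinh_bounds (x : R) : 0 <= x -> x <= sinh x <= x * exp x.
Proof.
  intros hx.
  destruct (MVT_gen sinh 0 x cosh) as [c [hc e]].
  - intros y _. apply is_derive_Reals, derivable_pt_lim_sinh.
  - intros y _. apply derivable_continuous_pt, derivable_pt_sinh.
  - rewrite Rmin_left, Rmax_right in hc by lra.
    rewrite sinh_0, !Rminus_0_r in e. rewrite e.
    assert (h1 := cosh_ge_1 c). assert (h2 := cosh_le_exp c ltac:(lra)).
    assert (h3 : exp c <= exp x).
    { destruct (Req_dec c x) as [-> | hn]; [lra|]. apply Rlt_le, exp_increasing. lra. }
    split; nra.
Qed.

Lemma cosh_bounds (x : R) : 0 <= x -> x ^ 2 / 2 <= cosh x - 1 <= x ^ 2 / 2 * exp x.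
Proof.
  intros hx.
  assert (e : cosh x - 1 = 2 * sinh (x / 2) ^ 2).
  { unfold cosh, sinh. rewrite !exp_Ropp. replace x with (x / 2 + x / 2) at 1 2 by field.
    rewrite exp_plus. assert (h := exp_pos (x / 2)). field. lra. }
  assert (h := sinh_bounds (x / 2) ltac:(lra)).
  assert (e2 : exp x = exp (x / 2) * exp (x / 2)) by (rewrite <- exp_plus; f_equal; field).
  assert (h1 : (x / 2) ^ 2 <= sinh (x / 2) ^ 2) by (apply pow_incr; lra).
  assert (h2 : sinh (x / 2) ^ 2 <= (x / 2 * exp (x / 2)) ^ 2) by (apply pow_incr; lra).
  rewrite e, e2. split; nra.
Qed.

Lemma cosh_gt_1 (x : R) : 0 < x -> 1 < cosh x.
Proof. intros hx. assert (h := cosh_bounds x ltac:(lra)). nra. Qed.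

Lemma cosh_opp (x : R) : cosh (- x) = cosh x.
Proof. unfold cosh. rewrite Ropp_involutive. lra. Qed.

(** The quotient is $\cot(b/2)$, and the range of [b] keeps $\pi/2-b/2$ on the principal branch. It
    makes [sin_arg] piecewise constant on the real axis. *)
Lemma atan_half_angle (b : R) : 0 < b < 2 * PI -> atan (sin b / (1 - cos b)) = PI / 2 - b / 2.
Proof.
  intros hb. assert (hs : 0 < sin (b / 2)) by (apply sin_gt_0; lra).
  assert (e : sin b / (1 - cos b) = tan (PI / 2 - b / 2)).
  { replace b with (2 * (b / 2)) at 1 2 by field. rewrite sin_2a, cos_2a_sin.
    unfold tan. rewrite cos_shift, sin_shift.
    replace (1 - (1 - 2 * sin (b / 2) * sin (b / 2))) with (2 * sin (b / 2) * sin (b / 2)) by ring.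
    field. lra. }
  rewrite e. apply atan_tan. lra.
Qed.

Section Circle_means.

Variable al : R.
Hypothesis al_pos : 0 < al.

Lemma log_re_0 (r : R) : 0 < 1 + r -> log_re r 0 = ln (1 + r).
Proof.
  intros h. unfold log_re. rewrite cos_0.
  replace (1 + 2 * r * 1 + r ^ 2) with ((1 + r) ^ 2) by ring.
  rewrite ln_pow by exact h. simpl INR. field.
Qed.

Lemma log_re_PI (r : R) : r < 1 -> log_re r PI = ln (1 - r).
Proof.
  intros h. unfold log_re. rewrite cos_PI.
  replace (1 + 2 * r * -1 + r ^ 2) with ((1 - r) ^ 2) by ring.
  rewrite ln_pow by lra. simpl INR. field.
Qed.

Lemma log_im_sin_0 (r t : R) : sin t = 0 -> log_im r t = 0.
Proof. intros h. unfold log_im. rewrite h, Rmult_0_r, Rdiv_0_l. apply atan_0. Qed.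

Lemma one_add_r_cos_pos (r t : R) : 0 <= r < 1 -> 0 < 1 + r * cos t.
Proof. intros h. generalize (COS_bound t). intros. nra. Qed.

Lemma log_im_pos (r t : R) : 0 < r -> 0 < 1 + r * cos t -> 0 < sin t -> 0 < log_im r t.
Proof.
  intros hr h hs. unfold log_im. rewrite <- atan_0. apply atan_increasing.
  apply Rdiv_lt_0_compat; [apply Rmult_lt_0_compat|]; assumption.
Qed.

Lemma gap_pos_interior (r t : R) : 0 < r -> 0 < 1 + r * cos t -> 0 < sin t -> 0 < gap al r t.
Proof.
  intros hr h hs. assert (hi := log_im_pos r t hr h hs). unfold gap.
  assert (h1 := cosh_gt_1 (log_im r t / al) (Rdiv_lt_0_compat _ _ hi al_pos)).
  generalize (COS_bound (log_re r t / al)). lra.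
Qed.

(* No zero of [sin (log (1 + z) / (2 al))] lies on the circle of radius [r]. *)
Definition zero_free (r : R) : Prop :=
  0 < r < 1 /\ cos (ln (1 - r) / al) < 1 /\ cos (ln (1 + r) / al) < 1.

(** Off the real axis $\cosh>1$ suffices; on it the zero-free condition decides. Treating all [t]
    makes [ln gap] continuous on the whole line. *)
Lemma gap_pos (r t : R) : zero_free r -> 0 < gap al r t.
Proof.
  intros [hr [hm hp]]. assert (h := one_add_r_cos_pos r t ltac:(lra)).
  destruct (Rtotal_order (sin t) 0) as [hs | [hs | hs]].
  - replace (gap al r t) with (gap al r (- t)).
    + apply gap_pos_interior; [lra | rewrite cos_neg; exact h | rewrite sin_neg; lra].
    + unfold gap, log_re, log_im. rewrite cos_neg, sin_neg. f_equal.
      replace (r * - sin t / (1 + r * cos t)) with (- (r * sin t / (1 + r * cos t))) by (field; lra).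
      rewrite atan_opp. rewrite <- cosh_opp. f_equal. field. lra.
  - unfold gap. rewrite (log_im_sin_0 r t hs), Rdiv_0_l, cosh_0.
    assert (hc : cos t = 1 \/ cos t = -1).
    { generalize (sin2_pow t). rewrite hs. intros e.
      assert (e' : (cos t - 1) * (cos t + 1) = 0) by lra.
      apply Rmult_integral in e'. lra. }
    destruct hc as [hc | hc]; unfold log_re; rewrite hc.
    + replace (1 + 2 * r * 1 + r ^ 2) with (1 + 2 * r * cos 0 + r ^ 2) by (rewrite cos_0; ring).
      fold (log_re r 0). rewrite log_re_0 by lra. lra.
    + replace (1 + 2 * r * -1 + r ^ 2) with (1 + 2 * r * cos PI + r ^ 2) by (rewrite cos_PI; ring).
      fold (log_re r PI). rewrite log_re_PI by lra. lra.
  - apply gap_pos_interior; lra.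
Qed.

Definition circle_int (r : R) : R := RInt (fun t => ln (gap al r t)) 0 PI.

Lemma continuous_ln_gap (r t : R) : zero_free r -> continuous (fun t => ln (gap al r t)) t.
Proof.
  intros hz. apply (continuity_2d_section (fun r t => ln (gap al r t))).
  apply continuity_2d_ln_gap.
  - apply one_add_r_cos_pos. destruct hz. lra.
  - apply gap_pos, hz.
Qed.

Lemma log_im_nonneg (r t : R) : 0 <= r < 1 -> 0 <= sin t -> 0 <= log_im r t.
Proof.
  intros hr hs. assert (h := one_add_r_cos_pos r t hr). unfold log_im. rewrite <- atan_0.
  destruct (Req_dec (r * sin t / (1 + r * cos t)) 0) as [-> | hn]; [lra|].
  apply Rlt_le, atan_increasing.
  assert (0 <= r * sin t / (1 + r * cos t)); [|lra].
  apply Rle_mult_inv_pos; [apply Rmult_le_pos; lra | exact h].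
Qed.

(** The radial derivative of the integrand is $1/r$ times the angular derivative of [sin_arg], so
    the integral over the half circle is an increment; the open interval of zero-free radii
    justifies differentiation under the integral. *)
Lemma is_derive_circle_int (lo hi r : R) : lo < r < hi ->
  (forall x, lo < x < hi -> zero_free x) ->
  is_derive circle_int r ((sin_arg al r PI - sin_arg al r 0) / r).
Proof.
  intros hr hz. assert (hpi := PI_RGT_0).
  assert (hd : 0 < Rmin (r - lo) (hi - r)) by (apply Rmin_glb_lt; lra).
  assert (hball : forall x, Rabs (x - r) < Rmin (r - lo) (hi - r) -> lo < x < hi).
  { intros x hx. assert (h1 := Rmin_l (r - lo) (hi - r)). assert (h2 := Rmin_r (r - lo) (hi - r)).
    apply Rabs_def2 in hx. lra. }
  assert (hcos : forall x t, lo < x < hi -> 0 < 1 + x * cos t).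
  { intros x t hx. apply one_add_r_cos_pos. destruct (hz x hx). lra. }
  assert (hD : forall x t, lo < x < hi -> is_derive (fun r => ln (gap al r t)) x (ln_gap_dr al x t)).
  { intros x t hx. apply is_derive_ln_gap_r; [exact al_pos | now apply hcos | now apply gap_pos, hz]. }
  assert (hD' : forall x t, lo < x < hi -> Derive (fun r => ln (gap al r t)) x = ln_gap_dr al x t).
  { intros x t hx. apply is_derive_unique, hD, hx. }
  assert (c2 : forall t, continuity_2d_pt (ln_gap_dr al) r t).
  { intros t. apply continuity_2d_ln_gap_dr; [exact al_pos | now apply hcos | now apply gap_pos, hz]. }
  assert (e : RInt (fun t => Derive (fun x => ln (gap al x t)) r) 0 PI
    = (sin_arg al r PI - sin_arg al r 0) / r).
  { assert (hr0 : 0 < r) by (destruct (hz r hr); lra).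
    rewrite (RInt_ext _ (fun t => / r * (r * ln_gap_dr al r t))).
    2:{ intros t _. rewrite hD' by exact hr. eqR. field. lra. }
    assert (cc : forall t, continuous (fun t => r * ln_gap_dr al r t) t).
    { intros t. apply (continuous_mult (fun _ => r) (ln_gap_dr al r)).
      - apply continuous_const.
      - apply continuity_2d_section, c2. }
    rewrite RInt_scal_R by (apply ex_RInt_cont, cc).
    rewrite (RInt_derive_R (sin_arg al r)).
    - eqR. unfold Rdiv. ring.
    - intros t ht. rewrite Rmin_left, Rmax_right in ht by lra.
      apply is_derive_sin_arg_t; [exact al_pos | now apply hcos | | now apply gap_pos, hz].
      apply log_im_nonneg; [destruct (hz r hr); lra|]. apply sin_ge_0; lra.
    - intros; apply cc. }
  rewrite <- e. unfold circle_int.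
  apply (is_derive_RInt_param (fun r t => ln (gap al r t))).
  - exists (mkposreal _ hd). intros x hx t _. eexists. apply hD, hball, hx.
  - intros t _. apply (continuity_2d_pt_ext_loc (ln_gap_dr al)); [|apply c2].
    exists (mkposreal _ hd). intros x y hx _. symmetry. apply hD', hball, hx.
  - exists (mkposreal _ hd). intros x hx. apply ex_RInt_cont. intros t.
    apply continuous_ln_gap, hz, hball, hx.
Qed.

(** The arctangent cancels the linear term. The bound by $2\pi$ is where the lower bound on $\alpha$
    will enter. *)
Lemma sin_arg_0 (r : R) : 0 < r < 1 -> 0 < ln (1 + r) / al < 2 * PI -> sin_arg al r 0 = - PI.
Proof.
  intros hr hb. unfold sin_arg. rewrite log_im_sin_0 by apply sin_0.
  rewrite log_re_0, Rdiv_0_l, exp_0, atan_half_angle by lra. field. lra.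
Qed.

(** Adding $2\pi(n+1)$ brings the angle into $(0,2\pi)$; this shift survives, so each zero passed on
    the negative axis raises the value by $2\pi$. *)
Lemma sin_arg_PI (n : nat) (r : R) : 0 < r < 1 ->
  - (2 * PI * INR (S n)) < ln (1 - r) / al < - (2 * PI * INR n) ->
  sin_arg al r PI = PI + 2 * PI * INR n.
Proof.
  intros hr hb. unfold sin_arg. rewrite log_im_sin_0 by apply sin_PI.
  rewrite log_re_PI, Rdiv_0_l, exp_0 by lra.
  rewrite <- (sin_period _ (S n)), <- (cos_period _ (S n)).
  rewrite S_INR in *. rewrite atan_half_angle; lra.
Qed.

Hypothesis al_large : ln 2 < 2 * PI * al.

(** The modulus of the zero $q^{2n}-1$; index 0 is the zero at the centre. *)
Definition zero_radius (n : nat) : R := 1 - exp (- 2 * PI * al * INR n).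

Lemma ln_between (r lo hi : R) : 1 - exp hi < r < 1 - exp lo -> lo < ln (1 - r) < hi.
Proof.
  intros h. assert (h1 := exp_pos lo). split.
  - rewrite <- (ln_exp lo). apply ln_increasing; lra.
  - rewrite <- (ln_exp hi). apply ln_increasing; lra.
Qed.

Lemma ln_1_sub_between (n : nat) (r : R) : zero_radius n < r < zero_radius (S n) ->
  - (2 * PI * INR (S n)) < ln (1 - r) / al < - (2 * PI * INR n).
Proof.
  intros h. apply ln_between in h. destruct h as [h1 h2]. split.
  - apply Rlt_div_r; lra.
  - apply Rlt_div_l; lra.
Qed.

Lemma zero_radius_range (n : nat) : 0 <= zero_radius n < 1.
Proof.
  unfold zero_radius. assert (h := exp_pos (- 2 * PI * al * INR n)). split; [|lra].
  assert (exp (- 2 * PI * al * INR n) <= 1); [|lra].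
  rewrite <- exp_0. assert (hn := pos_INR n). assert (hp := PI_RGT_0).
  assert (0 <= 2 * PI * al * INR n) by (apply Rmult_le_pos; [nra | lra]).
  destruct (Req_dec (- 2 * PI * al * INR n) 0) as [-> | hne]; [lra|].
  apply Rlt_le, exp_increasing. lra.
Qed.

Lemma ln_1_add_range (r : R) : 0 < r <= 1 -> 0 < ln (1 + r) / al < 2 * PI.
Proof.
  intros hr. assert (h1 : 0 < ln (1 + r)) by (rewrite <- ln_1; apply ln_increasing; lra).
  assert (h2 : ln (1 + r) <= ln 2) by (apply ln_le; lra). split.
  - apply Rdiv_lt_0_compat; lra.
  - apply Rlt_div_l; lra.
Qed.

Lemma cos_lt_1 (b : R) : 0 < b < 2 * PI -> cos b < 1.
Proof.
  intros hb. replace b with (2 * (b / 2)) by field. rewrite cos_2a_sin.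
  assert (0 < sin (b / 2)) by (apply sin_gt_0; lra). nra.
Qed.

Lemma zero_free_between (n : nat) (r : R) : zero_radius n < r < zero_radius (S n) -> zero_free r.
Proof.
  intros h. assert (h0 := zero_radius_range n). assert (h1 := zero_radius_range (S n)).
  assert (hl := ln_1_sub_between n r h). split; [lra|]. split.
  - rewrite <- (cos_period _ (S n)). apply cos_lt_1. rewrite S_INR in *. lra.
  - apply cos_lt_1, ln_1_add_range. lra.
Qed.

(** The increment of [sin_arg] is $2\pi(n+1)$, which counts the centre and the $n$ further zeros
    inside, so this is the slope of the mean as a function of $\ln r$. *)
Lemma circle_int_step (n : nat) (r1 r2 : R) :
  zero_radius n < r1 < zero_radius (S n) -> zero_radius n < r2 < zero_radius (S n) ->
  circle_int r2 - 2 * PI * INR (S n) * ln r2 = circle_int r1 - 2 * PI * INR (S n) * ln r1.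
Proof.
  intros h1 h2. assert (h0 := zero_radius_range n).
  assert (hd : forall r, zero_radius n < r < zero_radius (S n) ->
    is_derive (fun r => circle_int r - 2 * PI * INR (S n) * ln r) r 0).
  { intros r hr. assert (hz := zero_free_between n r hr). assert (hr01 := proj1 hz).
    assert (hc := is_derive_circle_int _ _ r hr (zero_free_between n)).
    rewrite (sin_arg_PI n), sin_arg_0 in hc; try lra.
    2: apply ln_1_add_range; lra.
    2: apply ln_1_sub_between, hr.
    replace 0 with ((PI + 2 * PI * INR n - - PI) / r - 2 * PI * INR (S n) * / r).
    2:{ rewrite S_INR. field. lra. }
    apply (is_derive_minus circle_int (fun r => 2 * PI * INR (S n) * ln r)); [exact hc|].
    apply (is_derive_scal ln). apply is_derive_ln. lra. }
  destruct (MVT_gen (fun r => circle_int r - 2 * PI * INR (S n) * ln r) r1 r2 (fun _ => 0)) as [c [_ e]].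
  - intros x hx. apply hd. revert hx. unfold Rmin, Rmax. destruct Rle_dec; lra.
  - intros x hx. apply continuity_pt_filterlim.
    apply (@ex_derive_continuous R_AbsRing R_NormedModule
      (fun r => circle_int r - 2 * PI * INR (S n) * ln r)). exists 0. apply hd.
    revert hx. unfold Rmin, Rmax. destruct Rle_dec; lra.
  - lra.
Qed.

End Circle_means.

(** * Passing across a zero and to the limits *)

Lemma atan_lower (y : R) : 0 <= y -> y / (1 + y ^ 2) <= atan y <= y.
Proof.
  intros hy.
  destruct (MVT_gen atan 0 y (fun x => / (1 + x²))) as [c [hc e]].
  - intros x _. apply is_derive_atan.
  - intros x _. apply derivable_continuous_pt, derivable_pt_atan.
  - rewrite Rmin_left, Rmax_right in hc by lra.
    rewrite atan_0, !Rminus_0_r in e. rewrite e. unfold Rsqr.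
    assert (h1 : / (1 + y ^ 2) <= / (1 + c * c)) by (apply Rinv_le_contravar; nra).
    assert (h2 : / (1 + c * c) <= / 1) by (apply Rinv_le_contravar; nra).
    rewrite Rinv_1 in h2. unfold Rdiv. split; nra.
Qed.

Lemma Rabs_sin_le (x : R) : Rabs (sin x) <= Rabs x.
Proof.
  destruct (MVT_gen sin 0 x cos) as [c [_ e]].
  - intros y _. apply is_derive_sin.
  - intros y _. apply continuity_sin.
  - rewrite sin_0, !Rminus_0_r in e. rewrite e, Rabs_mult.
    assert (h : Rabs (cos c) <= 1) by (apply Rabs_le, COS_bound).
    assert (h0 := Rabs_pos x). nra.
Qed.

Lemma one_sub_cos (x : R) : 1 - cos x = 2 * sin (x / 2) ^ 2.
Proof. replace x with (2 * (x / 2)) at 1 by field. rewrite cos_2a_sin. ring. Qed.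

Lemma one_sub_cos_le (x : R) : 1 - cos x <= x ^ 2 / 2.
Proof.
  rewrite one_sub_cos. assert (h := Rabs_sin_le (x / 2)).
  rewrite <- (pow2_abs (sin _)), <- (pow2_abs x).
  rewrite Rabs_div, (Rabs_pos_eq 2) in h by lra.
  assert (h0 := Rabs_pos (sin (x / 2))). nra.
Qed.

Lemma sin_ge_cubic (x : R) : 0 <= x <= 1 -> x * (1 - x ^ 2 / 2) <= sin x.
Proof.
  intros hx. destruct (MVT_gen sin 0 x cos) as [c [hc e]].
  - intros y _. apply is_derive_sin.
  - intros y _. apply continuity_sin.
  - rewrite Rmin_left, Rmax_right in hc by lra.
    rewrite sin_0, !Rminus_0_r in e. rewrite e.
    assert (h := one_sub_cos_le c). assert (c ^ 2 <= x ^ 2) by nra.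
    rewrite (Rmult_comm x). apply Rmult_le_compat_r; lra.
Qed.

Lemma one_sub_cos_ge (x : R) : Rabs x <= 2 -> x ^ 2 / 2 * (1 - x ^ 2 / 4) <= 1 - cos x.
Proof.
  assert (H : forall y, 0 <= y <= 2 -> y ^ 2 / 2 * (1 - y ^ 2 / 4) <= 1 - cos y).
  { intros y hy. rewrite one_sub_cos. assert (h := sin_ge_cubic (y / 2) ltac:(lra)).
    assert (h2 : (y / 2 * (1 - (y / 2) ^ 2 / 2)) ^ 2 <= sin (y / 2) ^ 2).
    { apply pow_incr. split; [|exact h]. apply Rmult_le_pos; nra. }
    assert (h3 : 0 <= y ^ 2) by nra. nra. }
  intros hx. assert (h0 := Rabs_pos x).
  rewrite <- (pow2_abs x). replace (cos x) with (cos (Rabs x)).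
  - apply H. lra.
  - unfold Rabs. destruct Rcase_abs; [apply cos_neg | reflexivity].
Qed.

Section Limits.

Variable al : R.
Hypothesis al_pos : 0 < al.

Lemma one_add_r_cos_pos_half_open (r t : R) : 0 <= r <= 1 -> 0 <= t < PI -> 0 < 1 + r * cos t.
Proof.
  intros hr ht. assert (h : -1 < cos t).
  { rewrite <- cos_PI. apply cos_decreasing_1; lra. }
  destruct (Rle_or_lt 0 (cos t)); nra.
Qed.

(** Near $t=\pi$ the zeros come close to the circles, but the imaginary part of the logarithm is at
    least $\rho(\pi-t)/4$. Hence [gap] is at least a constant times $(\pi-t)^2$ wherever the zeros
    lie, uniformly up to and including $r=1$. *)
Lemma ln_gap_tail (rho : R) : 0 < rho -> exists C, 0 < C /\ forall r t, rho <= r <= 1 ->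
  PI - 1 <= t < PI -> Rabs (ln (gap al r t)) <= C * (1 + / sqrt (PI - t)).
Proof.
  intros hrho. assert (hpi := PI2_1).
  set (c1 := ln (exp (PI / 2 / al) + 1)).
  set (c2 := Rabs (ln (rho / (8 * al)))).
  assert (hc1 : 0 < c1).
  { unfold c1. rewrite <- ln_1. apply ln_increasing; [lra|]. generalize (exp_pos (PI / 2 / al)). lra. }
  assert (hc2 : 0 <= c2) by apply Rabs_pos.
  exists (c1 + 2 * c2 + 4). split; [lra|]. intros r t hr ht.
  set (tau := PI - t). assert (htau : 0 < tau <= 1) by (unfold tau; lra).
  assert (hsin : tau / 2 <= sin t <= 1).
  { split; [|apply SIN_bound]. rewrite <- sin_PI_x. fold tau.
    generalize (sin_ge_cubic tau ltac:(lra)). nra. }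
  assert (hP := one_add_r_cos_pos_half_open r t ltac:(lra) ltac:(lra)).
  assert (hcos : cos t <= 0) by (apply cos_le_0; lra).
  assert (hlow : rho * tau / 4 <= log_im r t).
  { assert (hs : 0 <= rho * sin t <= 1) by nra.
    apply Rle_trans with (atan (rho * sin t)).
    - apply Rle_trans with (rho * sin t / 2); [nra|].
      apply Rle_trans with (2 := proj1 (atan_lower _ (proj1 hs))).
      apply Rmult_le_compat_l; [lra|]. apply Rinv_le_contravar; nra.
    - unfold log_im.
      assert (hy : rho * sin t <= r * sin t / (1 + r * cos t)).
      { apply (proj1 (Rle_div_r _ _ _ hP)). apply Rle_trans with (rho * sin t * 1); [|rewrite Rmult_1_r; apply Rmult_le_compat_r; lra].
        apply Rmult_le_compat_l; nra. }
      destruct (Req_dec (rho * sin t) (r * sin t / (1 + r * cos t))) as [<- | hn]; [lra|].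
      apply Rlt_le, atan_increasing. lra. }
  assert (hup : log_im r t <= PI / 2) by (apply Rlt_le, atan_bound).
  assert (hpos : 0 < rho * tau / 4) by nra.
  assert (hg := gap_pos_interior al al_pos r t ltac:(lra) hP ltac:(lra)).
  assert (ha : rho * tau / 4 / al <= log_im r t / al <= PI / 2 / al).
  { split; apply Rmult_le_compat_r; try lra; apply Rlt_le, Rinv_0_lt_compat, al_pos. }
  assert (ha0 : 0 < rho * tau / 4 / al) by (apply Rdiv_lt_0_compat; lra).
  assert (hco := COS_bound (log_re r t / al)).
  assert (hs0 : 0 < sqrt tau) by (apply sqrt_lt_R0; lra).
  assert (hi0 : 0 < / sqrt tau) by (apply Rinv_0_lt_compat, hs0).
  apply Rabs_le. split.
  - assert (hb := proj1 (cosh_bounds (log_im r t / al) ltac:(lra))).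
    assert (h1 : (rho / (8 * al) * tau) ^ 2 <= gap al r t).
    { unfold gap. apply Rle_trans with ((log_im r t / al) ^ 2 / 2); [|lra].
      replace (rho / (8 * al) * tau) with (rho * tau / 4 / al / 2) by (field; lra).
      nra. }
    assert (hk : 0 < rho / (8 * al)) by (apply Rdiv_lt_0_compat; lra).
    apply ln_le in h1; [|apply pow_lt, Rmult_lt_0_compat; lra].
    rewrite ln_pow in h1 by (apply Rmult_lt_0_compat; lra). rewrite ln_mult in h1 by lra. simpl INR in h1.
    (* Using $\ln u\ge1-1/u$ at $\sqrt\tau$ instead of $\tau$ yields the integrable singularity
       $1/\sqrt\tau$. *)
    assert (h2 : 2 * (1 - / sqrt tau) <= ln tau).
    { rewrite <- (sqrt_sqrt tau) at 2 by lra. rewrite ln_mult by lra.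
      generalize (ln_ge_1_sub_inv (sqrt tau) hs0). lra. }
    assert (h3 : - c2 <= ln (rho / (8 * al))).
    { unfold c2. generalize (Rle_abs (- ln (rho / (8 * al)))). rewrite Rabs_Ropp. lra. }
    fold tau. nra.
  - apply Rle_trans with c1.
    + apply ln_le; [exact hg|]. unfold gap.
      assert (hc := cosh_le_exp (log_im r t / al) ltac:(lra)).
      assert (he : exp (log_im r t / al) <= exp (PI / 2 / al)).
      { destruct (Req_dec (log_im r t / al) (PI / 2 / al)) as [-> | hn]; [lra|].
        apply Rlt_le, exp_increasing. lra. }
      lra.
    + fold tau. nra.
Qed.

(** The majorant is unbounded at [b], so the estimate is made up to $x<b$, where the majorant has an
    elementary antiderivative, and $x$ then tends to [b]. *)
Lemma RInt_sqrt_tail (f : R -> R) (b eta C : R) : 0 < eta -> 0 <= C ->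
  (forall x, continuous f x) ->
  (forall t, b - eta <= t < b -> Rabs (f t) <= C * (1 + / sqrt (b - t))) ->
  Rabs (RInt f (b - eta) b) <= C * (eta + 2 * sqrt eta).
Proof.
  intros he hC hf hb.
  assert (hs : 0 <= sqrt eta) by apply sqrt_pos.
  assert (hx : forall x, b - eta < x < b -> Rabs (RInt f (b - eta) x) <= C * (eta + 2 * sqrt eta)).
  { intros x hx.
    set (P := fun t => C * (t - 2 * sqrt (b - t))).
    assert (hd : forall t, t < b -> is_derive P t (C * (1 + / sqrt (b - t)))).
    { intros t ht. unfold P. assert (h0 : 0 < sqrt (b - t)) by (apply sqrt_lt_R0; lra).
      auto_derive; [lra|]. replace (b + - t) with (b - t) by ring. field. lra. }
    assert (hc : forall t, t < b -> continuous (fun t => C * (1 + / sqrt (b - t))) t).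
    { intros t ht. apply (@ex_derive_continuous R_AbsRing R_NormedModule).
      assert (h0 : 0 < sqrt (b - t)) by (apply sqrt_lt_R0; lra).
      auto_derive. replace (b + - t) with (b - t) by ring. repeat split; lra. }
    assert (hi : RInt (fun t => C * (1 + / sqrt (b - t))) (b - eta) x = P x - P (b - eta)).
    { apply RInt_derive_R; intros t ht; rewrite Rmin_left, Rmax_right in ht by lra;
        [apply hd | apply hc]; lra. }
    eapply Rle_trans; [apply abs_RInt_le; [lra | apply ex_RInt_cont, hf]|].
    eapply Rle_trans.
    - apply RInt_le with (g := fun t => C * (1 + / sqrt (b - t))); [lra | | |].
      + apply ex_RInt_cont. intros t. apply (continuous_comp f Rabs); [apply hf|].
        apply continuous_Rabs.
      + apply (@ex_RInt_continuous R_CompleteNormedModule). intros t ht.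
        rewrite Rmin_left, Rmax_right in ht by lra. apply hc. lra.
      + intros t ht. apply hb. lra.
    - rewrite hi. unfold P. replace (b - (b - eta)) with eta by ring.
      assert (hq : 0 <= sqrt (b - x)) by apply sqrt_pos.
      rewrite <- Rmult_minus_distr_l. apply Rmult_le_compat_l; lra. }
  assert (hl : is_lim_seq (fun n => b - eta * / INR (S (S n))) b).
  { replace (Finite b) with (Finite (b - eta * 0)) by (f_equal; ring).
    apply is_lim_seq_minus'; [apply is_lim_seq_const|].
    apply is_lim_seq_mult'; [apply is_lim_seq_const|].
    apply (is_lim_seq_inv (fun n => INR (S (S n))) p_infty); [|discriminate].
    apply (is_lim_seq_incr_1 (fun n => INR (S n))), (is_lim_seq_incr_1 INR), is_lim_seq_INR. }
  assert (hcont : is_lim_seq (fun n => Rabs (RInt f (b - eta) (b - eta * / INR (S (S n))))) (Rabs (RInt f (b - eta) b))).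
  { apply (is_lim_seq_abs _ (RInt f (b - eta) b)).
    apply (is_lim_seq_continuous (fun x => RInt f (b - eta) x)); [|exact hl].
    apply continuity_pt_filterlim.
    apply (@ex_derive_continuous R_AbsRing R_NormedModule (fun x => RInt f (b - eta) x)).
    exists (f b). apply (is_derive_RInt f (fun x => RInt f (b - eta) x) (b - eta)).
    - apply filter_forall. intros x. apply (RInt_correct (V := R_CompleteNormedModule)), ex_RInt_cont, hf.
    - apply hf. }
  refine (is_lim_seq_le _ _ (Finite _) (Finite _) _ hcont (is_lim_seq_const (C * (eta + 2 * sqrt eta)))).
  intros n. apply hx.
  assert (h1 : 1 < INR (S (S n))) by (apply (lt_INR 1); lia).
  assert (h2 : 0 < / INR (S (S n))) by (apply Rinv_0_lt_compat; lra).
  assert (h3 : / INR (S (S n)) < 1) by (rewrite <- Rinv_1; apply Rinv_lt_contravar; lra).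
  nra.
Qed.

(* [circle_int] is approached uniformly by integrals avoiding the point [-r]; since these are continuous
   in [r], zeros on the circle and the boundary circle [r = 1] cause no jump. *)
Lemma circle_int_near (rs eps : R) : 0 < rs <= 1 -> cos (ln (1 + rs) / al) < 1 -> 0 < eps ->
  exists eta0, 0 < eta0 <= 1 /\ forall eta, 0 < eta <= eta0 ->
  exists delta, 0 < delta /\ forall r, zero_free al r -> Rabs (r - rs) < delta ->
    Rabs (circle_int al r - RInt (fun t => ln (gap al rs t)) 0 (PI - eta)) <= eps.
Proof.
  intros hrs hcos heps. assert (hpi := PI2_1).
  destruct (ln_gap_tail (rs / 2)) as [C [hC htail]]; [lra|].
  (* For $\eta\le e_1^2$ and $e_1\le1$ the tail bound $C(\eta+2\sqrt\eta)$ is at most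
     $3Ce_1\le\varepsilon/2$. *)
  set (e1 := Rmin 1 (eps / (6 * C))).
  assert (he1 : 0 < e1 <= 1).
  { unfold e1. split; [apply Rmin_glb_lt; [lra | apply Rdiv_lt_0_compat; lra] | apply Rmin_l]. }
  assert (he1' : 3 * C * e1 <= eps / 2).
  { apply Rle_trans with (3 * C * (eps / (6 * C))); [|right; field; lra].
    apply Rmult_le_compat_l; [lra | apply Rmin_r]. }
  exists (e1 ^ 2). split; [nra|]. intros eta heta.
  assert (hse : sqrt eta <= e1).
  { rewrite <- (sqrt_pow2 e1) by lra. apply sqrt_le_1_alt. lra. }
  assert (heta1 : eta <= e1) by nra.
  assert (hc2 : forall t, 0 <= t <= PI - eta -> continuity_2d_pt (fun r t => ln (gap al r t)) rs t).
  { intros t ht. assert (hP := one_add_r_cos_pos_half_open rs t ltac:(lra) ltac:(lra)).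
    apply continuity_2d_ln_gap; [exact hP|].
    destruct (Req_dec t 0) as [-> | hn].
    - unfold gap. rewrite log_im_sin_0 by apply sin_0.
      rewrite log_re_0, Rdiv_0_l, cosh_0 by lra. lra.
    - apply gap_pos_interior; [exact al_pos | lra | exact hP | apply sin_gt_0; lra]. }
  (* The other half of [eps]: integrands within $\varepsilon/(2\pi)$ on an interval shorter than
     $\pi$. *)
  destruct (uniform_continuity_2d_1d' (fun r t => ln (gap al r t)) 0 (PI - eta) rs hc2
    (mkposreal (eps / (2 * PI)) ltac:(apply Rdiv_lt_0_compat; lra))) as [d hd]. simpl in hd.
  exists (Rmin d (rs / 2)). split; [apply Rmin_glb_lt; [apply cond_pos | lra]|].
  intros r hz hr.
  assert (hr1 : Rabs (r - rs) < d) by (eapply Rlt_le_trans; [exact hr | apply Rmin_l]).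
  assert (hr2 : Rabs (r - rs) < rs / 2) by (eapply Rlt_le_trans; [exact hr | apply Rmin_r]).
  apply Rabs_def2 in hr1. apply Rabs_def2 in hr2.
  assert (hr01 := proj1 hz). assert (hd0 := cond_pos d).
  assert (hcr : forall t, continuous (fun t => ln (gap al r t)) t).
  { intros t. apply continuous_ln_gap; assumption. }
  assert (ex1 : ex_RInt (fun t => ln (gap al rs t)) 0 (PI - eta)).
  { apply (@ex_RInt_continuous R_CompleteNormedModule). intros t ht.
    rewrite Rmin_left, Rmax_right in ht by lra.
    apply (continuity_2d_section (fun r t => ln (gap al r t))), hc2, ht. }
  unfold circle_int.
  rewrite <- (RInt_Chasles _ 0 (PI - eta) PI) by (apply ex_RInt_cont, hcr).
  unfold plus; simpl.
  replace (RInt (fun t => ln (gap al r t)) 0 (PI - eta) + RInt (fun t => ln (gap al r t)) (PI - eta) PI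
    - RInt (fun t => ln (gap al rs t)) 0 (PI - eta))
    with ((RInt (fun t => ln (gap al r t)) 0 (PI - eta) - RInt (fun t => ln (gap al rs t)) 0 (PI - eta))
      + RInt (fun t => ln (gap al r t)) (PI - eta) PI) by (eqR; ring).
  eapply Rle_trans; [apply Rabs_triang|].
  replace eps with (eps / 2 + eps / 2) by field. apply Rplus_le_compat.
  - rewrite <- (RInt_minus (V := R_CompleteNormedModule)) by (try exact ex1; apply ex_RInt_cont, hcr).
    eapply Rle_trans.
    + apply abs_RInt_le_const with (M := eps / (2 * PI)); [lra| |].
      * apply (ex_RInt_minus (V := R_NormedModule)); [apply ex_RInt_cont, hcr | exact ex1].
      * intros t ht. apply Rlt_le. apply (hd t rs t r); try lra.
        rewrite Rminus_eq_0, Rabs_R0. exact hd0.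
    + apply Rle_trans with (PI * (eps / (2 * PI))); [|right; field; lra].
      apply Rmult_le_compat_r; [apply Rlt_le, Rdiv_lt_0_compat; lra | lra].
  - eapply Rle_trans; [apply RInt_sqrt_tail with (C := C)|].
    + lra.
    + lra.
    + exact hcr.
    + intros t ht. apply htail; lra.
    + nra.
Qed.

(** Near the centre $\log(1+z)=z+O(z^2)$ and $\cosh v-\cos u\approx(u^2+v^2)/2$, so [gap] is
    $r^2/(2\alpha^2)$ up to a factor $1+O(r)$, uniformly in [t]. *)
Lemma ln_gap_small (r t : R) : 0 < r -> r <= / 100 -> r <= al / 100 -> 0 <= t <= PI ->
  0 < gap al r t ->
  Rabs (ln (gap al r t) - 2 * ln r + ln (2 * al ^ 2)) <= (72 + 2 / al + 2 / al ^ 2) * r.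
Proof.
  intros hr hr1 hr2 ht hg.
  assert (hs : 0 <= sin t) by (apply sin_ge_0; lra).
  assert (hcb := COS_bound t). assert (hsb := SIN_bound t).
  assert (hsc := sin2_pow t). assert (hP := one_add_r_cos_pos r t ltac:(lra)).
  assert (hl : Rabs (log_re r t - r * cos t) <= 9 * r ^ 2).
  { unfold log_re. set (x := 2 * r * cos t + r ^ 2).
    assert (hx : - 3 * r <= x <= 3 * r) by (unfold x; split; nra).
    replace (1 + 2 * r * cos t + r ^ 2) with (1 + x) by (unfold x; ring).
    assert (h1 := ln_le_sub_1 (1 + x) ltac:(lra)).
    assert (h2 := ln_ge_1_sub_inv (1 + x) ltac:(lra)).
    assert (h3 : x - 2 * x ^ 2 <= 1 - / (1 + x)).
    { apply (Rmult_le_reg_r (1 + x)); [lra|].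
      replace ((1 - / (1 + x)) * (1 + x)) with x by (field; lra).
      assert (0 <= x ^ 2) by nra. nra. }
    assert (h4 : x ^ 2 <= 9 * r ^ 2) by nra.
    apply Rabs_le. assert (0 <= r ^ 2) by nra. unfold x in *. split; lra. }
  assert (hi : 0 <= log_im r t /\ Rabs (log_im r t - r * sin t) <= 3 * r ^ 2).
  { unfold log_im. set (y := r * sin t / (1 + r * cos t)).
    assert (hy0 : 0 <= y) by (apply Rle_mult_inv_pos; [nra | exact hP]).
    assert (hy : y * (1 + r * cos t) = r * sin t) by (unfold y; field; lra).
    assert (hyr : y <= 2 * r) by nra.
    assert (h1 := atan_lower y hy0).
    assert (h2 : y - y ^ 3 <= y / (1 + y ^ 2)).
    { apply Rle_div_r; [nra|]. assert (0 <= y ^ 3) by (apply pow_le; lra).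
      assert (0 <= y ^ 2) by nra. nra. }
    assert (h3 : y ^ 3 <= r ^ 2).
    { assert (y ^ 2 <= 4 * r ^ 2) by nra. assert (0 <= r ^ 2) by nra.
      replace (y ^ 3) with (y * y ^ 2) by ring. nra. }
    split; [|apply Rabs_le].
    - apply Rle_trans with (2 := proj1 h1). apply Rle_mult_inv_pos; nra.
    - assert (h5 : Rabs (y * (r * cos t)) <= 2 * r ^ 2).
      { rewrite !Rabs_mult, (Rabs_pos_eq y), (Rabs_pos_eq r) by lra.
        assert (Rabs (cos t) <= 1) by (apply Rabs_le; lra).
        assert (0 <= Rabs (cos t)) by apply Rabs_pos.
        assert (y * r <= 2 * r * r) by nra. nra. }
      apply Rabs_le_between in h5. lra. }
  destruct hi as [hi0 hi]. apply Rabs_le_between in hl. apply Rabs_le_between in hi.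
  set (L := log_re r t) in *. set (I := log_im r t) in *.
  (* Differences of squares in each coordinate: the errors $9r^2$ and $3r^2$ each meet a factor at
     most $3r$, giving $27+9=36$. *)
  assert (hS : Rabs (L ^ 2 + I ^ 2 - r ^ 2) <= 36 * r ^ 3).
  { replace (L ^ 2 + I ^ 2 - r ^ 2) with
      ((L - r * cos t) * (L + r * cos t) + (I - r * sin t) * (I + r * sin t)).
    2:{ transitivity (L ^ 2 + I ^ 2 - r ^ 2 * (cos t ^ 2 + sin t ^ 2)); [ring | rewrite hsc; ring]. }
    eapply Rle_trans; [apply Rabs_triang|]. rewrite !Rabs_mult.
    assert (h1 : Rabs (L - r * cos t) <= 9 * r ^ 2) by (apply Rabs_le; lra).
    assert (h2 : Rabs (I - r * sin t) <= 3 * r ^ 2) by (apply Rabs_le; lra).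
    assert (h3 : Rabs (L + r * cos t) <= 3 * r) by (apply Rabs_le; split; nra).
    assert (h4 : Rabs (I + r * sin t) <= 3 * r) by (apply Rabs_le; split; nra).
    replace (36 * r ^ 3) with (9 * r ^ 2 * (3 * r) + 3 * r ^ 2 * (3 * r)) by ring.
    apply Rplus_le_compat; apply Rmult_le_compat; try apply Rabs_pos; assumption. }
  apply Rabs_le_between in hS.
  assert (hLb : - (2 * r) <= L <= 2 * r) by (split; nra).
  assert (hIb : 0 <= I <= 2 * r) by (split; nra).
  set (S := (L ^ 2 + I ^ 2) / r ^ 2).
  assert (hr2p : 0 < r ^ 2) by nra.
  assert (hSb : 1 - 36 * r <= S <= 1 + 36 * r).
  { unfold S. split; [apply Rle_div_r | apply Rle_div_l]; try lra; nra. }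
  assert (hA : 0 <= I / al <= 2 / al * r).
  { assert (hia : 0 < / al) by (apply Rinv_0_lt_compat, al_pos). unfold Rdiv. split; nra. }
  assert (hB : (L / al) ^ 2 <= 4 / al ^ 2 * r ^ 2).
  { replace (4 / al ^ 2 * r ^ 2) with ((2 * r) ^ 2 * (/ al) ^ 2) by (field; lra).
    replace ((L / al) ^ 2) with (L ^ 2 * (/ al) ^ 2) by (field; lra).
    apply Rmult_le_compat_r; [apply pow2_ge_0|]. nra. }
  assert (hral : r / al <= / 100) by (apply Rle_div_l; lra).
  assert (hral0 : 0 < r / al) by (apply Rdiv_lt_0_compat; lra).
  assert (hB4 : (L / al) ^ 2 <= 4 * (r / al) ^ 2).
  { replace (4 * (r / al) ^ 2) with (4 / al ^ 2 * r ^ 2) by (field; lra). exact hB. }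
  assert (hB1 : (L / al) ^ 2 / 4 <= / 100) by nra.
  assert (hBa : Rabs (L / al) <= 2) by (apply Rabs_le; split; nra).
  assert (h1 := one_sub_cos_ge (L / al) hBa). assert (h2 := one_sub_cos_le (L / al)).
  assert (h3 := cosh_bounds (I / al) (proj1 hA)).
  assert (hB0 : 0 <= (L / al) ^ 2) by apply pow2_ge_0.
  assert (hI0 : 0 <= (I / al) ^ 2) by apply pow2_ge_0.
  assert (hT : ((L / al) ^ 2 + (I / al) ^ 2) / 2 = S * (r ^ 2 / (2 * al ^ 2))).
  { unfold S. field. lra. }
  assert (hex : 1 <= exp (I / al)) by (generalize (exp_ineq1_le (I / al)); lra).
  assert (hq : 0 < r ^ 2 / (2 * al ^ 2)) by (apply Rdiv_lt_0_compat; nra).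
  (* In logarithms, [S] accounts for the constant 72, the cosine factor for $2/\alpha^2$, and the
     exponential factor of the hyperbolic cosine for $2/\alpha$. *)
  assert (elow : S * (r ^ 2 / (2 * al ^ 2)) * (1 - (L / al) ^ 2 / 4) <= gap al r t).
  { rewrite <- hT. unfold gap. fold L I. nra. }
  assert (eup : gap al r t <= S * (r ^ 2 / (2 * al ^ 2)) * exp (I / al)).
  { rewrite <- hT. unfold gap. fold L I. nra. }
  assert (hlq : ln (r ^ 2 / (2 * al ^ 2)) = 2 * ln r - ln (2 * al ^ 2)).
  { rewrite ln_div by nra. rewrite ln_pow by lra. simpl INR. ring. }
  set (Q := r ^ 2 / (2 * al ^ 2)) in *. clearbody Q S.
  assert (hSp : 0 < S) by lra.
  assert (hF : 0 < 1 - (L / al) ^ 2 / 4) by lra.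
  apply ln_le in elow; [|apply Rmult_lt_0_compat; [apply Rmult_lt_0_compat|]; assumption].
  apply ln_le in eup; [|exact hg].
  rewrite !ln_mult in elow, eup by (try apply exp_pos; try apply Rmult_lt_0_compat; assumption).
  rewrite hlq in elow, eup. rewrite ln_exp in eup.
  assert (hlnS : - (72 * r) <= ln S <= 36 * r).
  { split.
    - apply Rle_trans with (1 - / S); [|apply ln_ge_1_sub_inv, hSp].
      apply (Rmult_le_reg_r S); [exact hSp|].
      replace ((1 - / S) * S) with (S - 1) by (field; lra). nra.
    - generalize (ln_le_sub_1 S hSp). lra. }
  assert (hlnF : - (2 * (r / al) ^ 2) <= ln (1 - (L / al) ^ 2 / 4)).
  { set (F := 1 - (L / al) ^ 2 / 4) in *.
    apply Rle_trans with (1 - / F); [|apply ln_ge_1_sub_inv, hF].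
    apply (Rmult_le_reg_r F); [exact hF|].
    replace ((1 - / F) * F) with (F - 1) by (field; lra).
    assert (hFl : 1 - (r / al) ^ 2 <= F) by (unfold F; lra).
    assert (0 <= (r / al) ^ 2) by nra. assert (/ 2 <= F) by (unfold F; lra). nra. }
  assert (hral2 : (r / al) ^ 2 <= / al ^ 2 * r).
  { replace ((r / al) ^ 2) with (/ al ^ 2 * (r * r)) by (field; lra).
    apply Rmult_le_compat_l; [apply Rlt_le, Rinv_0_lt_compat; nra | nra]. }
  assert (hia2 : 0 < / al ^ 2) by (apply Rinv_0_lt_compat; nra).
  assert (hia : 0 < / al) by (apply Rinv_0_lt_compat, al_pos).
  assert (0 < / al ^ 2 * r) by nra. assert (0 < / al * r) by nra.
  unfold Rdiv in hA |- *. unfold Rdiv in eup. apply Rabs_le. split; lra.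
Qed.

Lemma circle_int_small (r : R) : r <= / 100 -> r <= al / 100 -> zero_free al r ->
  Rabs (circle_int al r - 2 * PI * ln r - PI * ln (/ (2 * al ^ 2)))
    <= PI * ((72 + 2 / al + 2 / al ^ 2) * r).
Proof.
  intros h1 h2 hz. assert (hr := proj1 hz). assert (hpi := PI_RGT_0).
  assert (hc : forall t, continuous (fun t => ln (gap al r t)) t).
  { intros t. apply continuous_ln_gap; assumption. }
  assert (e : circle_int al r - 2 * PI * ln r - PI * ln (/ (2 * al ^ 2))
    = RInt (fun t => minus (ln (gap al r t)) (2 * ln r - ln (2 * al ^ 2))) 0 PI).
  { rewrite (RInt_minus (V := R_CompleteNormedModule) (fun t => ln (gap al r t))
      (fun _ => 2 * ln r - ln (2 * al ^ 2)));
      [|apply ex_RInt_cont, hc | apply ex_RInt_const].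
    rewrite (RInt_const (V := R_CompleteNormedModule)).
    unfold minus, plus, opp, scal; simpl; unfold mult; simpl. unfold circle_int.
    rewrite ln_Rinv by nra. eqR. ring. }
  rewrite e. rewrite <- (Rminus_0_r PI) at 2.
  apply abs_RInt_le_const; [lra| |].
  - apply (ex_RInt_minus (V := R_NormedModule)); [apply ex_RInt_cont, hc | apply ex_RInt_const].
  - intros t ht.
    change (Rabs (ln (gap al r t) - (2 * ln r - ln (2 * al ^ 2))) <= (72 + 2 / al + 2 / al ^ 2) * r).
    replace (ln (gap al r t) - (2 * ln r - ln (2 * al ^ 2)))
      with (ln (gap al r t) - 2 * ln r + ln (2 * al ^ 2)) by ring.
    apply ln_gap_small; try lra. apply gap_pos; assumption.
Qed.

End Limits.

(** * The unit circle *)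

Lemma is_RInt_const_R (m a b : R) : is_RInt (fun _ => m) a b ((b - a) * m).
Proof. exact (is_RInt_const (V := R_NormedModule) a b m). Qed.

(** Upgrades an improper integral to a Riemann integral: boundedness near [b] limits what a strip of
    width [eta] contributes to any fine Riemann sum. *)
Lemma is_RInt_bounded_end (f : R -> R) (a b c0 M l : R) : a <= c0 -> c0 < b -> 0 <= M ->
  (forall x, c0 <= x <= b -> Rabs (f x) <= M) ->
  (forall eps, 0 < eps -> exists eta0, 0 < eta0 /\ forall eta, 0 < eta <= eta0 ->
    exists I : R, is_RInt f a (b - eta) I /\ Rabs (I - l) <= eps) ->
  is_RInt f a b l.
Proof.
  intros hac hcb hM hf hlim. unfold is_RInt. apply filterlim_locally. intros eps.
  assert (heps := cond_pos eps).
  destruct (hlim (eps / 4) ltac:(lra)) as [eta0 [heta0 H]].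
  (* Error budget: [eps / 4] each for the truncated sum, for [I] and for the sum of the majorant,
     plus [eps / 8] for the strip. *)
  set (eta := Rmin eta0 (Rmin ((b - c0) / 2) (eps / (8 * (M + 1))))).
  assert (he1 : 0 < eta).
  { unfold eta. repeat apply Rmin_glb_lt; [lra | lra | apply Rdiv_lt_0_compat; lra]. }
  assert (he2 : eta <= eta0) by apply Rmin_l.
  assert (he3 : eta <= (b - c0) / 2).
  { eapply Rle_trans; [apply Rmin_r | apply Rmin_l]. }
  assert (he4 : M * eta <= eps / 8).
  { assert (h : eta <= eps / (8 * (M + 1))) by (eapply Rle_trans; [apply Rmin_r | apply Rmin_r]).
    apply Rle_trans with ((M + 1) * (eps / (8 * (M + 1)))); [nra|]. right. field. lra. }
  destruct (H eta ltac:(lra)) as [I [hI hIl]].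
  set (c := b - eta) in *.
  (* [fc] truncates [f] at [c], and [g] dominates the discarded part, so $|\sum f-\sum fc|\le\sum g$
     on each subdivision. *)
  set (fc := fun x => if Rle_dec x c then f x else 0).
  set (g := fun x => if Rle_dec x c then 0 else M).
  assert (hac' : a < c) by (unfold c; lra). assert (hcb' : c < b) by (unfold c; lra).
  assert (ifc : is_RInt fc a b I).
  { rewrite <- (Rplus_0_r I). apply (is_RInt_Chasles fc a c b).
    - apply (is_RInt_ext f); [|exact hI]. intros x hx. rewrite Rmax_right in hx by lra.
      unfold fc. destruct Rle_dec; [reflexivity | lra].
    - apply (is_RInt_ext (fun _ => 0)).
      + intros x hx. rewrite Rmin_left in hx by lra. unfold fc. destruct Rle_dec; [lra | reflexivity].
      + generalize (is_RInt_const_R 0 c b). rewrite Rmult_0_r. trivial. }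
  assert (ig : is_RInt g a b (0 + M * eta)).
  { apply (is_RInt_Chasles g a c b).
    - apply (is_RInt_ext (fun _ => 0)).
      + intros x hx. rewrite Rmax_right in hx by lra. unfold g. destruct Rle_dec; [reflexivity | lra].
      + generalize (is_RInt_const_R 0 a c). rewrite Rmult_0_r. trivial.
    - apply (is_RInt_ext (fun _ => M)).
      + intros x hx. rewrite Rmin_left in hx by lra. unfold g. destruct Rle_dec; [lra | reflexivity].
      + replace (M * eta) with ((b - c) * M) by (unfold c; ring). apply is_RInt_const_R. }
  unfold is_RInt in ifc, ig.
  assert (h1 := proj1 (filterlim_locally _ _) ifc (mkposreal (eps / 4) ltac:(lra))).
  assert (h2 := proj1 (filterlim_locally _ _) ig (mkposreal (eps / 4) ltac:(lra))).
  assert (h3 : Riemann_fine a b (fun ptd => pointed_subdiv ptd /\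
    SF_h ptd = Rmin a b /\ seq.last (SF_h ptd) (SF_lx ptd) = Rmax a b)).
  { exists (mkposreal 1 Rlt_0_1). intros ptd _ h. exact h. }
  generalize (filter_and _ _ (filter_and _ _ h1 h2) h3). apply filter_imp.
  intros ptd [[b1 b2] [hp [hh hl]]]. rewrite Rmin_left in hh by lra. rewrite Rmax_right in hl by lra.
  rewrite sign_eq_1 in b1, b2 |- * by lra.
  assert (hd : Rabs (Riemann_sum f ptd - Riemann_sum fc ptd) <= Riemann_sum g ptd).
  { assert (e := Riemann_sum_minus f fc ptd).
    replace (Riemann_sum f ptd - Riemann_sum fc ptd) with (Riemann_sum (fun x => minus (f x) (fc x)) ptd)
      by exact e.
    apply (Riemann_sum_norm (V := R_NormedModule)); [exact hp|].
    intros t ht. assert (ht' : a <= t <= b) by (rewrite <- hh at 1; rewrite <- hl; exact ht). unfold fc, g.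
    change (Rabs (f t - (if Rle_dec t c then f t else 0)) <= (if Rle_dec t c then 0 else M)).
    destruct Rle_dec as [hle | hgt].
    - rewrite Rminus_eq_0, Rabs_R0. lra.
    - rewrite Rminus_0_r. apply hf. unfold c in hgt. lra. }
  change (Rabs (1 * Riemann_sum fc ptd - I) < eps / 4) in b1.
  change (Rabs (1 * Riemann_sum g ptd - (0 + M * eta)) < eps / 4) in b2.
  change (Rabs (1 * Riemann_sum f ptd - l) < eps).
  apply Rabs_def2 in b1. apply Rabs_def2 in b2. apply Rabs_le_between in hd.
  apply Rabs_le_between in hIl. apply Rabs_def1; lra.
Qed.

Section Boundary.

Variable al : R.
Hypothesis al_pos : 0 < al.
Hypothesis al_large : ln 2 < 2 * PI * al.

Let z := zero_radius al.
(** The radius $1-q^{2n+1}$: it samples the interval between two consecutive zeros and also tends to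
    1. *)
Let mid n := 1 - exp (- 2 * PI * al * (INR n + / 2)).
Let Q := exp (- 2 * PI * al).

Lemma exp_decay_lt (x y : R) : 0 < x -> exp (- 2 * PI * al * (y + x)) < exp (- 2 * PI * al * y).
Proof.
  intros hx. apply exp_increasing. assert (h := PI_RGT_0).
  assert (0 < PI * al) by nra. assert (0 < PI * al * x) by nra. lra.
Qed.

Lemma mid_radius_between n : z n < mid n < z (S n).
Proof.
  unfold z, zero_radius, mid. rewrite S_INR.
  assert (h1 := exp_decay_lt (/ 2) (INR n) ltac:(lra)).
  assert (h2 := exp_decay_lt (/ 2) (INR n + / 2) ltac:(lra)).
  replace (INR n + / 2 + / 2) with (INR n + 1) in h2 by field. lra.
Qed.

Lemma mid_radius_zero_free n : zero_free al (mid n).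
Proof. apply (zero_free_between al al_pos al_large n), mid_radius_between. Qed.

Lemma zero_radius_lt_S n : z n < z (S n).
Proof. generalize (mid_radius_between n). lra. Qed.

Lemma zero_radius_S_range n : 0 < z (S n) < 1.
Proof.
  generalize (zero_radius_lt_S n) (zero_radius_range al al_pos n) (zero_radius_range al al_pos (S n)).
  fold z. lra.
Qed.

Let const n := circle_int al (mid n) - 2 * PI * INR (S n) * ln (mid n).

Lemma circle_int_const n r : z n < r < z (S n) ->
  circle_int al r = const n + 2 * PI * INR (S n) * ln r.
Proof.
  intros hr. assert (h := circle_int_step al al_pos al_large n (mid n) r (mid_radius_between n) hr).
  unfold const. lra.
Qed.

(** On the innermost interval [circle_int r - 2 * PI * ln r] is constant, so its limit as $r\to0$ is
    its value. *)
Lemma circle_const_0 : const 0 = PI * ln (/ (2 * al ^ 2)).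
Proof.
  assert (hpi := PI_RGT_0). set (K := 72 + 2 / al + 2 / al ^ 2).
  assert (hK : 0 < K).
  { assert (0 < 2 / al) by (apply Rdiv_lt_0_compat; lra).
    assert (0 < 2 / al ^ 2) by (apply Rdiv_lt_0_compat; [lra | apply pow_lt; lra]).
    unfold K. lra. }
  assert (hz0 : z 0 = 0).
  { unfold z, zero_radius. simpl INR. rewrite Rmult_0_r, exp_0. ring. }
  assert (hb : forall eps, 0 < eps -> Rabs (const 0 - PI * ln (/ (2 * al ^ 2))) <= eps).
  { intros eps heps. assert (h1 := zero_radius_S_range 0).
    set (r := Rmin (z 1 / 2) (Rmin (/ 100) (Rmin (al / 100) (eps / (PI * K))))).
    assert (hr0 : 0 < r).
    { unfold r. repeat apply Rmin_glb_lt; try lra. apply Rdiv_lt_0_compat; nra. }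
    assert (hr1 : r <= z 1 / 2) by apply Rmin_l.
    assert (hr2 : r <= / 100) by (eapply Rle_trans; [apply Rmin_r | apply Rmin_l]).
    assert (hr3 : r <= al / 100).
    { eapply Rle_trans; [apply Rmin_r|]. eapply Rle_trans; [apply Rmin_r | apply Rmin_l]. }
    assert (hr4 : r <= eps / (PI * K)).
    { eapply Rle_trans; [apply Rmin_r|]. eapply Rle_trans; [apply Rmin_r | apply Rmin_r]. }
    assert (hrz : z 0 < r < z 1) by (rewrite hz0; lra).
    assert (h := circle_int_small al al_pos r hr2 hr3 (zero_free_between al al_pos al_large 0 r hrz)).
    rewrite (circle_int_const 0 r hrz) in h. simpl (INR 1) in h.
    replace (const 0 + 2 * PI * 1 * ln r - 2 * PI * ln r - PI * ln (/ (2 * al ^ 2)))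
      with (const 0 - PI * ln (/ (2 * al ^ 2))) in h by ring.
    eapply Rle_trans; [exact h|]. fold K.
    apply Rle_trans with (PI * K * (eps / (PI * K))); [|right; field; lra].
    rewrite <- Rmult_assoc. apply Rmult_le_compat_l; nra. }
  apply Rminus_diag_uniq. apply Rle_antisym; apply le_epsilon; intros eps heps;
    specialize (hb eps heps); apply Rabs_le_between in hb; lra.
Qed.

(** The mean is continuous at [z (S n)] while its slope in $\ln r$ jumps by $2\pi$; the constant
    must compensate by $-2\pi\ln z_{n+1}$. *)
Lemma circle_const_S n : const (S n) = const n - 2 * PI * ln (z (S n)).
Proof.
  assert (hpi := PI_RGT_0). assert (hz := zero_radius_S_range n).
  assert (hN : 0 < INR (S (S n))) by (apply lt_0_INR; lia).
  assert (hN' : INR (S (S n)) = INR (S n) + 1) by apply S_INR.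
  assert (hN0 : 0 < INR (S n)) by (apply lt_0_INR; lia).
  assert (hb : forall eps, 0 < eps -> Rabs (const (S n) - const n + 2 * PI * ln (z (S n))) <= eps).
  { intros eps heps.
    destruct (circle_int_near al al_pos (z (S n)) (eps / 4)) as [eta0 [heta0 H]]; [lra| |lra|].
    { apply cos_lt_1, ln_1_add_range; [exact al_pos | exact al_large | lra]. }
    destruct (H eta0 ltac:(lra)) as [d [hd Hd]].
    (* Four errors of at most [eps / 4]: two from the continuity of the mean, two from the
       logarithms, whose slopes are at most $2\pi(n+2)$. *)
    set (e1 := eps / (8 * PI * INR (S (S n)))).
    assert (he1 : 0 < e1) by (apply Rdiv_lt_0_compat; [lra|]; nra).
    assert (hln : continuity_pt ln (z (S n))).
    { apply derivable_continuous_pt. exists (/ z (S n)). apply derivable_pt_lim_ln. lra. }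
    destruct (proj1 (continuity_pt_locally _ _) hln (mkposreal e1 he1)) as [d2 hd2].
    simpl in hd2. assert (hd2p := cond_pos d2).
    set (h := Rmin (d / 2) (Rmin (d2 / 2) (Rmin ((z (S n) - z n) / 2) ((z (S (S n)) - z (S n)) / 2)))).
    assert (hz1 := zero_radius_lt_S n). assert (hz2 := zero_radius_lt_S (S n)).
    assert (hh0 : 0 < h) by (unfold h; repeat apply Rmin_glb_lt; lra).
    assert (hh1 : h <= d / 2) by apply Rmin_l.
    assert (hh2 : h <= d2 / 2) by (eapply Rle_trans; [apply Rmin_r | apply Rmin_l]).
    assert (hh3 : h <= (z (S n) - z n) / 2).
    { eapply Rle_trans; [apply Rmin_r|]. eapply Rle_trans; [apply Rmin_r | apply Rmin_l]. }
    assert (hh4 : h <= (z (S (S n)) - z (S n)) / 2).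
    { eapply Rle_trans; [apply Rmin_r|]. eapply Rle_trans; [apply Rmin_r | apply Rmin_r]. }
    assert (r1 : z n < z (S n) - h < z (S n)) by lra.
    assert (r2 : z (S n) < z (S n) + h < z (S (S n))) by lra.
    assert (a1 : Rabs (z (S n) - h - z (S n)) = h).
    { replace (z (S n) - h - z (S n)) with (- h) by ring. rewrite Rabs_Ropp. apply Rabs_pos_eq. lra. }
    assert (a2 : Rabs (z (S n) + h - z (S n)) = h).
    { replace (z (S n) + h - z (S n)) with h by ring. apply Rabs_pos_eq. lra. }
    assert (k1 := Hd _ (zero_free_between al al_pos al_large n _ r1) ltac:(rewrite a1; lra)).
    assert (k2 := Hd _ (zero_free_between al al_pos al_large (S n) _ r2) ltac:(rewrite a2; lra)).
    rewrite (circle_int_const n _ r1) in k1. rewrite (circle_int_const (S n) _ r2) in k2.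
    assert (l1 : Rabs (ln (z (S n) - h) - ln (z (S n))) < e1).
    { apply hd2. change (Rabs (z (S n) - h - z (S n)) < d2). rewrite a1. lra. }
    assert (l2 : Rabs (ln (z (S n) + h) - ln (z (S n))) < e1).
    { apply hd2. change (Rabs (z (S n) + h - z (S n)) < d2). rewrite a2. lra. }
    apply Rabs_le_between in k1. apply Rabs_le_between in k2.
    apply Rabs_def2 in l1. apply Rabs_def2 in l2.
    assert (he : 2 * PI * INR (S (S n)) * e1 = eps / 4) by (unfold e1; field; lra).
    assert (hpn : 0 < 2 * PI * INR (S (S n))) by nra.
    assert (hpn0 : 0 < 2 * PI * INR (S n)) by nra.
    assert (hpn1 : 2 * PI * INR (S n) * e1 <= eps / 4) by (rewrite <- he; nra).
    set (x := ln (z (S n) - h) - ln (z (S n))) in *.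
    set (y := ln (z (S n) + h) - ln (z (S n))) in *.
    assert (q1 : - (eps / 4) <= 2 * PI * INR (S n) * x <= eps / 4) by (split; nra).
    assert (q2 : - (eps / 4) <= 2 * PI * INR (S (S n)) * y <= eps / 4) by (split; nra).
    unfold x in q1. unfold y in q2. rewrite hN' in *.
    apply Rabs_le. split; lra. }
  apply Rminus_diag_uniq. apply Rle_antisym; apply le_epsilon; intros eps heps;
    specialize (hb eps heps); apply Rabs_le_between in hb; lra.
Qed.

Lemma nome_sqr_range : 0 < Q < 1.
Proof.
  split; [apply exp_pos|]. unfold Q. rewrite <- exp_0. apply exp_increasing.
  assert (h := PI_RGT_0). nra.
Qed.

Lemma exp_mul_INR (c : R) (n : nat) : exp (c * INR n) = exp c ^ n.
Proof.
  induction n as [|n IH]; [simpl; rewrite Rmult_0_r; apply exp_0|].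
  rewrite S_INR. simpl. rewrite <- IH, <- exp_plus. f_equal. ring.
Qed.

Lemma circle_const_euler n : const n = PI * ln (/ (2 * al ^ 2)) - 2 * PI * ln (euler_prod Q n).
Proof.
  induction n as [|n IH].
  - rewrite circle_const_0. simpl. rewrite ln_1. ring.
  - assert (hQ := nome_sqr_range). assert (hQ' : Rabs Q < 1) by (rewrite Rabs_pos_eq; lra).
    rewrite circle_const_S, IH. cbn [euler_prod].
    rewrite ln_mult by (try apply euler_prod_pos; try apply one_sub_pow_pos; exact hQ').
    unfold z, zero_radius. rewrite exp_mul_INR. fold Q. ring.
Qed.

Lemma mid_radius_eq n : mid n = 1 - exp (- PI * al) * Q ^ n.
Proof.
  unfold mid, Q. rewrite <- exp_mul_INR, <- exp_plus. do 2 f_equal. field.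
Qed.

Lemma nome_range : 0 < exp (- PI * al) < 1.
Proof.
  split; [apply exp_pos|]. rewrite <- exp_0. apply exp_increasing.
  assert (h := PI_RGT_0). nra.
Qed.

(** The term $2\pi(n+1)\ln r$ disappears because $1-r=q^{2n+1}$ decays geometrically and outweighs
    the number of zeros. *)
Lemma circle_int_mid_lim :
  is_lim_seq (fun n => circle_int al (mid n)) (PI * ln (/ (2 * al ^ 2)) - 2 * PI * ln (euler Q)).
Proof.
  assert (hQ := nome_sqr_range). assert (hQ' : Rabs Q < 1) by (rewrite Rabs_pos_eq; lra).
  assert (hh := nome_range).
  apply is_lim_seq_ext with (fun n => PI * ln (/ (2 * al ^ 2)) - 2 * PI * ln (euler_prod Q n)
    + 2 * PI * (INR (S n) * ln (mid n))).
  { intros n. rewrite <- circle_const_euler. unfold const. ring. }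
  replace (PI * ln (/ (2 * al ^ 2)) - 2 * PI * ln (euler Q)) with
    (PI * ln (/ (2 * al ^ 2)) - 2 * PI * ln (euler Q) + 2 * PI * 0) by ring.
  apply is_lim_seq_plus'; [apply is_lim_seq_minus'|].
  - apply is_lim_seq_const.
  - apply is_lim_seq_mult'; [apply is_lim_seq_const|].
    apply is_lim_seq_continuous; [|apply euler_prod_lim, hQ'].
    apply derivable_continuous_pt. exists (/ euler Q). apply derivable_pt_lim_ln, euler_pos.
  - apply is_lim_seq_mult'; [apply is_lim_seq_const|].
    set (h := exp (- PI * al)) in *.
    apply is_lim_seq_abs_0.
    refine (is_lim_seq_le_le (fun _ => 0) _ (fun n => h / (1 - h) / Q * (INR (S n) * Q ^ S n)) 0 _ (is_lim_seq_const 0) _).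
    + intros n. split; [apply Rabs_pos|].
      rewrite Rabs_mult, (Rabs_pos_eq (INR (S n))) by apply pos_INR.
      replace (h / (1 - h) / Q * (INR (S n) * Q ^ S n)) with (INR (S n) * (h * Q ^ n / (1 - h)))
        by (simpl pow; field; lra).
      apply Rmult_le_compat_l; [apply pos_INR|].
      rewrite mid_radius_eq. fold h.
      assert (hp : 0 < Q ^ n <= 1).
      { split; [apply pow_lt; lra|]. rewrite <- (pow1 n). apply pow_incr. lra. }
      assert (hy : 0 < h * Q ^ n <= h) by nra.
      eapply Rle_trans; [apply Rabs_ln_1_sub; rewrite Rabs_pos_eq; lra|].
      rewrite Rabs_pos_eq by lra. apply Rmult_le_compat_l; [lra|].
      apply Rinv_le_contravar; lra.
    + replace (Finite 0) with (Finite (h / (1 - h) / Q * 0)) by (f_equal; ring).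
      apply is_lim_seq_mult'; [apply is_lim_seq_const|].
      apply (is_lim_seq_incr_1 (fun n => INR n * Q ^ n)), is_lim_seq_nat_geom. lra.
Qed.

Lemma mid_radius_lim : is_lim_seq mid 1.
Proof.
  assert (hQ := nome_sqr_range).
  apply is_lim_seq_ext with (fun n => 1 - exp (- PI * al) * Q ^ n); [intros; symmetry; apply mid_radius_eq|].
  replace (Finite 1) with (Finite (1 - exp (- PI * al) * 0)) by (f_equal; ring).
  apply is_lim_seq_minus'; [apply is_lim_seq_const|].
  apply is_lim_seq_mult'; [apply is_lim_seq_const|].
  apply is_lim_seq_geom. rewrite Rabs_pos_eq; lra.
Qed.

(** From $1+e^{it}=2\cos(t/2)e^{it/2}$; at $t=\pi$ the quotient degenerates to $0/0$, hence the
    strict bound. *)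
Lemma log_im_1 (t : R) : 0 <= t < PI -> log_im 1 t = t / 2.
Proof.
  intros ht. unfold log_im. assert (hc : 0 < cos (t / 2)) by (apply cos_gt_0; lra).
  replace (1 * sin t / (1 + 1 * cos t)) with (tan (t / 2)); [apply atan_tan; lra|].
  replace t with (2 * (t / 2)) at 2 3 by field. rewrite sin_2a, cos_2a_cos. unfold tan.
  replace (1 + 1 * (2 * cos (t / 2) * cos (t / 2) - 1)) with (2 * cos (t / 2) * cos (t / 2)) by ring.
  field. lra.
Qed.

Lemma log_re_1 (t : R) : 0 <= t < PI -> log_re 1 t = ln (2 * cos (t / 2)).
Proof.
  intros ht. unfold log_re. assert (hc : 0 < cos (t / 2)) by (apply cos_gt_0; lra).
  replace (1 + 2 * 1 * cos t + 1 ^ 2) with ((2 * cos (t / 2)) ^ 2).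
  - rewrite ln_pow by lra. simpl INR. field.
  - replace t with (2 * (t / 2)) at 2 by field. rewrite cos_2a_cos. ring.
Qed.

(** On the unit circle the imaginary part $t/2$ stays above $1/2$, so $\cosh$ exceeds 1 by a fixed
    amount; the cosine oscillates as $t\to\pi$ but the integrand stays bounded. *)
Lemma ln_gap_1_bounded : exists M, 0 <= M /\ forall t, 1 <= t < PI -> Rabs (ln (gap al 1 t)) <= M.
Proof.
  set (lo := / (8 * al ^ 2)). set (hi := exp (PI / 2 / al) + 1).
  assert (hlo : 0 < lo) by (apply Rinv_0_lt_compat; nra).
  exists (Rabs (ln lo) + Rabs (ln hi)). split; [generalize (Rabs_pos (ln lo)) (Rabs_pos (ln hi)); lra|].
  intros t ht. assert (hcb := COS_bound (log_re 1 t / al)).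
  assert (hia : 0 < / al) by (apply Rinv_0_lt_compat, al_pos).
  assert (ha : / (2 * al) <= t / 2 / al <= PI / 2 / al).
  { rewrite Rinv_mult. unfold Rdiv. split; nra. }
  assert (ha0 : 0 < / (2 * al)) by (apply Rinv_0_lt_compat; lra).
  assert (hc := cosh_bounds (t / 2 / al) ltac:(lra)).
  assert (he := cosh_le_exp (t / 2 / al) ltac:(lra)).
  assert (he2 : exp (t / 2 / al) <= exp (PI / 2 / al)).
  { destruct (Req_dec (t / 2 / al) (PI / 2 / al)) as [-> | hn]; [lra|].
    apply Rlt_le, exp_increasing. lra. }
  assert (h1 : lo <= gap al 1 t).
  { unfold gap. rewrite log_im_1 by lra.
    apply Rle_trans with ((/ (2 * al)) ^ 2 / 2); [right; unfold lo; field; lra|]. nra. }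
  assert (h2 : gap al 1 t <= hi) by (unfold gap; rewrite log_im_1 by lra; unfold hi; lra).
  apply ln_le in h1; [|exact hlo]. apply ln_le in h2; [|unfold lo in *; generalize (ln_le_sub_1 lo hlo);
     unfold gap; rewrite log_im_1 by lra; nra].
  generalize (Rle_abs (- ln lo)) (Rle_abs (ln hi)) (Rabs_pos (ln lo)) (Rabs_pos (ln hi)).
  rewrite Rabs_Ropp. intros. apply Rabs_le. lra.
Qed.

Lemma is_RInt_unit_circle :
  is_RInt (fun t => ln (gap al 1 t)) 0 PI (PI * ln (/ (2 * al ^ 2)) - 2 * PI * ln (euler Q)).
Proof.
  assert (hpi := PI2_1). set (L := PI * ln (/ (2 * al ^ 2)) - 2 * PI * ln (euler Q)).
  destruct ln_gap_1_bounded as [M [hM hb]].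
  (* A bound on the closed interval is required, and the formulas for the logarithm fail at $\pi$;
     the value there is reset to 0. *)
  apply (is_RInt_ext (fun t => if Rlt_dec t PI then ln (gap al 1 t) else 0)).
  { intros t ht. rewrite Rmax_right in ht by lra. destruct Rlt_dec; [reflexivity | lra]. }
  apply (is_RInt_bounded_end _ 0 PI 1 M); [lra | lra | exact hM | |].
  { intros t ht. destruct Rlt_dec as [h | h]; [apply hb; lra | rewrite Rabs_R0; exact hM]. }
  intros eps heps.
  destruct (circle_int_near al al_pos 1 (eps / 2)) as [eta0 [heta0 H]]; [lra| |lra|].
  { apply cos_lt_1, ln_1_add_range; [exact al_pos | exact al_large | lra]. }
  exists eta0. split; [lra|]. intros eta heta.
  destruct (H eta heta) as [d [hd Hd]].
  exists (RInt (fun t => ln (gap al 1 t)) 0 (PI - eta)). split.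
  - apply (is_RInt_ext (fun t => ln (gap al 1 t))).
    { intros t ht. rewrite Rmax_right in ht by lra. destruct Rlt_dec; [reflexivity | lra]. }
    apply (RInt_correct (V := R_CompleteNormedModule)).
    apply (@ex_RInt_continuous R_CompleteNormedModule). intros t ht.
    rewrite Rmin_left, Rmax_right in ht by lra.
    apply (continuity_2d_section (fun r t => ln (gap al r t))).
    assert (hP := one_add_r_cos_pos_half_open 1 t ltac:(lra) ltac:(lra)).
    apply continuity_2d_ln_gap; [exact hP|].
    destruct (Req_dec t 0) as [-> | hn].
    + unfold gap. rewrite log_im_sin_0 by apply sin_0.
      rewrite log_re_0, Rdiv_0_l, cosh_0 by lra.
      assert (hc := cos_lt_1 _ (ln_1_add_range al al_pos al_large 1 ltac:(lra))). lra.
    + apply gap_pos_interior; [exact al_pos | lra | exact hP | apply sin_gt_0; lra].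
  (* The truncated integral on the unit circle is compared with the mean at one radius [mid n], near
     1 and with the mean near its limit. *)
  - assert (l1 := mid_radius_lim). assert (l2 := circle_int_mid_lim). fold L in l2.
    apply is_lim_seq_spec in l1. apply is_lim_seq_spec in l2.
    destruct (l1 (mkposreal d hd)) as [N1 h1].
    destruct (l2 (mkposreal (eps / 2) ltac:(lra))) as [N2 h2]. simpl in h1, h2.
    set (n := Nat.max N1 N2).
    specialize (h1 n (Nat.le_max_l _ _)). specialize (h2 n (Nat.le_max_r _ _)).
    assert (h3 := Hd (mid n) (mid_radius_zero_free n) h1).
    apply Rabs_def2 in h2. apply Rabs_le_between in h3. apply Rabs_le. lra.
Qed.

Lemma is_RInt_ln_cosh_sub_cos :
  is_RInt (fun x => ln (cosh (x / al) - cos (ln (2 * cos x) / al))) 0 (PI / 2)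
    (- (PI / 2 * ln 2) - PI * ln al - PI * ln (euler Q)).
Proof.
  assert (hpi := PI_RGT_0). assert (h := is_RInt_unit_circle).
  (* Substitution $t=2x$, under which $\log(1+e^{it})=\ln(2\cos x)+ix$. *)
  replace 0 with (2 * 0 + 0) in h at 1 by ring.
  replace PI with (2 * (PI / 2) + 0) in h at 1 by field.
  apply (is_RInt_comp_lin (V := R_NormedModule)) in h.
  apply (is_RInt_scal (V := R_NormedModule) _ _ _ (/ 2)) in h.
  replace (- (PI / 2 * ln 2) - PI * ln al - PI * ln (euler Q)) with
    (scal (/ 2) (PI * ln (/ (2 * al ^ 2)) - 2 * PI * ln (euler Q))).
  - refine (is_RInt_ext _ _ _ _ _ _ h). intros x hx. rewrite Rmin_left, Rmax_right in hx by lra.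
    change (/ 2 * (2 * ln (gap al 1 (2 * x + 0))) = ln (cosh (x / al) - cos (ln (2 * cos x) / al))).
    unfold gap. rewrite log_im_1, log_re_1 by lra.
    replace ((2 * x + 0) / 2) with x by field. field.
  - unfold scal; simpl; unfold mult; simpl. rewrite ln_Rinv by nra.
    replace (2 * (al * (al * 1))) with (2 * (al * al)) by ring.
    rewrite !ln_mult by nra. field.
Qed.

End Boundary.

Theorem theorem1 (alpha k : R)
    (halpha : 0 < alpha)
    (hk : 0 < k < 1)
    (hratio : ellK (compl_modulus k) / ellK k = alpha) :
  (ln 2 / (2 * PI) < alpha ->
   is_RInt
     (fun x => ln (cosh (x / alpha) - cos (ln (2 * cos x) / alpha)))
     0 (PI / 2)
     (- (PI ^ 2 * alpha / 12)
      - PI / 6 * ln (16 * k * compl_modulus k * ellK k ^ 3 * alpha ^ 6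
                     / PI ^ 3)))
  /\
  (ln 2 / PI < alpha ->
   is_RInt
     (fun x => ln (cosh (x / alpha) + cos (ln (2 * cos x) / alpha)))
     0 (PI / 2)
     (PI ^ 2 * alpha / 24
      + PI / 6 * ln (4 * sqrt k / compl_modulus k))).
Proof.
  assert (hpi := PI_RGT_0).
  assert (hK : 0 < ellK k) by (apply ellK_pos, hk).
  assert (hk' := compl_modulus_range k hk).
  destruct (euler_nome k hk) as [e1 e2]. rewrite hratio in e1, e2.
  assert (hsk := sqrt_lt_R0 k (proj1 hk)).
  set (K := ellK k) in *. set (k' := compl_modulus k) in *.
  set (E2 := ln (euler (exp (- 2 * PI * alpha)))) in *.
  set (E1 := ln (euler (exp (- PI * alpha)))) in *.
  assert (l2k : ln (2 * k * k' * K ^ 3 / PI ^ 3) = ln 2 + ln k + ln k' + 3 * ln K - 3 * ln PI).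
  { rewrite ln_div by positive.
    rewrite !ln_mult by positive.
    rewrite !ln_pow by lra. simpl INR. ring. }
  assert (l16 : ln (16 * k * k' * K ^ 3 * alpha ^ 6 / PI ^ 3)
    = 4 * ln 2 + ln k + ln k' + 3 * ln K + 6 * ln alpha - 3 * ln PI).
  { rewrite ln_div by positive.
    rewrite !ln_mult by positive.
    replace 16 with (2 ^ 4) by ring. rewrite !ln_pow by lra. simpl INR. ring. }
  assert (l2s : ln (2 * k' / sqrt k) = ln 2 + ln k' - ln (sqrt k)).
  { rewrite ln_div, ln_mult by lra. reflexivity. }
  assert (l4s : ln (4 * sqrt k / k') = 2 * ln 2 + ln (sqrt k) - ln k').
  { rewrite ln_div, ln_mult by lra. replace 4 with (2 ^ 2) by ring. rewrite ln_pow by lra. simpl INR. ring. }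
  split; intros hal.
  - assert (hal' : ln 2 < 2 * PI * alpha) by (apply Rlt_div_l in hal; lra).
    replace (- (PI ^ 2 * alpha / 12) - PI / 6 * ln (16 * k * k' * K ^ 3 * alpha ^ 6 / PI ^ 3))
      with (- (PI / 2 * ln 2) - PI * ln alpha - PI * E2).
    + apply is_RInt_ln_cosh_sub_cos; assumption.
    + assert (eE : E2 = (ln (2 * k * k' * K ^ 3 / PI ^ 3) + PI * alpha / 2) / 6) by lra.
      rewrite eE, l2k, l16. field.
  - assert (hal' : ln 2 < PI * alpha) by (apply Rlt_div_l in hal; lra).
    assert (ln2 : 0 < ln 2) by (rewrite <- ln_1; apply ln_increasing; lra).
    assert (i1 := is_RInt_ln_cosh_sub_cos alpha halpha ltac:(lra)).
    (* At $\alpha/2$ the Euler product is taken at $e^{-\pi\alpha}$ instead of its square, and the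
       threshold becomes $\alpha>\ln2/\pi$, the hypothesis of this case. *)
    assert (i2 := is_RInt_ln_cosh_sub_cos (alpha / 2) ltac:(lra) ltac:(lra)).
    replace (- 2 * PI * (alpha / 2)) with (- PI * alpha) in i2 by field.
    fold E1 in i2. fold E2 in i1.
    (* The integral of [ln 2] removes the factor 2 of the double-angle factorisation. *)
    assert (i3 := is_RInt_minus _ _ _ _ _ _ (is_RInt_minus _ _ _ _ _ _ i2 i1)
      (is_RInt_const (V := R_NormedModule) 0 (PI / 2) (ln 2))).
    replace (PI ^ 2 * alpha / 24 + PI / 6 * ln (4 * sqrt k / k')) with
      (minus (minus (- (PI / 2 * ln 2) - PI * ln (alpha / 2) - PI * E1)
        (- (PI / 2 * ln 2) - PI * ln alpha - PI * E2)) (scal (PI / 2 - 0) (ln 2))).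
    + refine (is_RInt_ext _ _ _ _ _ _ i3). intros x hx. rewrite Rmin_left, Rmax_right in hx by lra.
      set (A := x / alpha). set (B := ln (2 * cos x) / alpha).
      change (ln (cosh (x / (alpha / 2)) - cos (ln (2 * cos x) / (alpha / 2)))
        - ln (cosh A - cos B) - ln 2 = ln (cosh A + cos B)).
      replace (x / (alpha / 2)) with (2 * A) by (unfold A; field; lra).
      replace (ln (2 * cos x) / (alpha / 2)) with (2 * B) by (unfold B; field; lra).
      assert (hA : 1 < cosh A) by (apply cosh_gt_1, Rdiv_lt_0_compat; lra).
      assert (hB := COS_bound B).
      replace (cosh (2 * A) - cos (2 * B)) with (2 * (cosh A - cos B) * (cosh A + cos B)).
      * rewrite !ln_mult by (try apply Rmult_lt_0_compat; lra). ring.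
      * rewrite cos_2a_cos. unfold cosh. rewrite !exp_Ropp.
        replace (2 * A) with (A + A) by ring. rewrite exp_plus.
        assert (h := exp_pos A). field. lra.
    + change ((- (PI / 2 * ln 2) - PI * ln (alpha / 2) - PI * E1
        - (- (PI / 2 * ln 2) - PI * ln alpha - PI * E2)) - (PI / 2 - 0) * ln 2
        = PI ^ 2 * alpha / 24 + PI / 6 * ln (4 * sqrt k / k')).
      rewrite ln_div by lra.
      assert (eE : E1 = E2 + (ln (2 * k' / sqrt k) - PI * alpha / 4) / 6) by lra.
      rewrite eE, l2s, l4s. field.
Qed.
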